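(* Let $A$ be a complex affine Poisson algebra of Krull dimension at most $3$. Then the Poisson Dixmier–Moeglin equivalence holds for $A$: the sets of Poisson primitive ideals, Poisson locally closed ideals, and Poisson rational ideals of $A$ coincide.
   Context: A Poisson algebra over a field $k$ is a commutative $k$-algebra $A$ with a $k$-bilinear Lie bracket $\{-,-\}$ such that $\{-,x\}$ is a derivation for each $x\in A$. Complex affine means finitely generated over $\mathbb C$ and an integral domain. A Poisson ideal is an ideal $I$ with $\{I,A\}\subseteq I$; a Poisson prime is a prime Poisson ideal; $\mathrm{PSpec}\,A$ is the set of Poisson primes with the relative Zariski topology. A Poisson prime $P$ is Poisson locally closed if $\{P\}$ is locally closed in $\mathrm{PSpec}\,A$ (equivalently, the intersection of all Poisson primes strictly containing $P$ strictly contains $P$); Poisson primitive if it is the largest Poisson ideal contained in some maximal ideal; Poisson rational if the Poisson centre $\{z:\{z,-\}\equiv0\}$ of $\operatorname{Frac}(A/P)$ is algebraic over $\mathbb C$. *)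

(* Defs.v *)
(* The field of complex numbers is modelled as
   [complex R] (= R[i]) for an arbitrary [R : realType]; every realType is
   a complete archimedean ordered field, i.e. (isomorphic to) the reals, so
   [complex R] is (isomorphic to) C. *)
From HB Require Import structures.
From mathcomp Require Import all_boot all_order all_algebra.
From mathcomp Require Import reals.
From mathcomp.real_closed Require Import complex.

Set Implicit Arguments.
Unset Strict Implicit.
Unset Printing Implicit Defensive.

Import Order.TTheory GRing.Theory Num.Theory.
Local Open Scope ring_scope.

Section Poisson.
Variable (K : comNzRingType) (A : comAlgType K).

Definition generates (s : seq A) : Prop :=
  forall S : A -> Prop,
    (forall x, x \in s -> S x) -> S 1 ->
    (forall x y, S x -> S y -> S (x + y)) ->
    (forall x y, S x -> S y -> S (x * y)) ->
    (forall (c : K) x, S x -> S (c *: x)) ->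
    forall a, S a.

Definition finitely_generated : Prop := exists s : seq A, generates s.

Definition integral_domain : Prop :=
  (1 : A) != 0 /\ forall x y : A, x * y = 0 -> x = 0 \/ y = 0.

Definition poisson_bracket (br : A -> A -> A) : Prop :=
  [/\
      (forall (c : K) x y z, br (c *: x + y) z = c *: br x z + br y z),
      (forall (c : K) x y z, br z (c *: x + y) = c *: br z x + br z y),
      (forall x, br x x = 0),
      (forall x y z, br x (br y z) + br y (br z x) + br z (br x y) = 0)
    &
      (forall x y z, br (y * z) x = y * br z x + br y x * z)].

Definition complex_affine_poisson_algebra (br : A -> A -> A) : Prop :=
  [/\ finitely_generated, integral_domain & poisson_bracket br].

Definition ideal (I : A -> Prop) : Prop :=
  [/\ I 0, (forall x y, I x -> I y -> I (x + y)) & (forall a x, I x -> I (a * x))].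

Definition prime_ideal (I : A -> Prop) : Prop :=
  [/\ ideal I, ~ I 1 & forall x y, I (x * y) -> I x \/ I y].

Definition maximal_ideal (I : A -> Prop) : Prop :=
  [/\ ideal I, ~ I 1 &
      forall J, ideal J -> (forall x, I x -> J x) -> (forall x, J x <-> I x) \/ J 1].

Definition subideal (I J : A -> Prop) : Prop := forall x, I x -> J x.
Definition strict_subideal (I J : A -> Prop) : Prop :=
  subideal I J /\ exists x, J x /\ ~ I x.

Definition krull_dim_le (n : nat) : Prop :=
  forall Q : nat -> A -> Prop,
    (forall i, (i <= n.+1)%N -> prime_ideal (Q i)) ->
    ~ (forall i, (i < n.+1)%N -> strict_subideal (Q i) (Q i.+1)).

Variable br : A -> A -> A.

Definition poisson_ideal (I : A -> Prop) : Prop :=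
  ideal I /\ forall x a, I x -> I (br x a).

Definition poisson_prime (P : A -> Prop) : Prop :=
  prime_ideal P /\ forall x a, P x -> P (br x a).

Definition poisson_primitive (P : A -> Prop) : Prop :=
  exists M, [/\ maximal_ideal M, poisson_ideal P, subideal P M &
                forall I, poisson_ideal I -> subideal I M -> subideal I P].

(* Zariski topology on PSpec A: closed sets are
   V(S) = {Q in PSpec A | S \subseteq Q} for S a subset of A.
   {P} is locally closed iff {P} = V(S) \cap (PSpec A \ V(T)) for some S, T. *)
Definition pspec_closed_set (S : A -> Prop) (Q : A -> Prop) : Prop :=
  poisson_prime Q /\ subideal S Q.

Definition poisson_locally_closed (P : A -> Prop) : Prop :=
  poisson_prime P /\
  exists S T : A -> Prop,
    forall Q, poisson_prime Q ->
      ((pspec_closed_set S Q /\ ~ pspec_closed_set T Q) <->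
       (forall x, Q x <-> P x)).

(* Frac(A/P) for a prime P: elements are fractions a/b (a, b in A, b \notin P),
   a/b = 0 iff a \in P.  The bracket extends uniquely to Frac(A/P) by the
   quotient rule:
     {a/b, c/d} = ({a,c}bd - {a,d}bc - {b,c}ad + {b,d}ac) / (b^2 d^2). *)
Definition frac_br_num (a b c d : A) : A :=
  br a c * b * d - br a d * b * c - br b c * a * d + br b d * a * c.

Definition frac_poisson_central (P : A -> Prop) (a b : A) : Prop :=
  forall c d, ~ P d -> P (frac_br_num a b c d).

(* numerator of p(a/b) over the common denominator b^(deg p) *)
Definition frac_poly_eval_num (p : {poly K}) (a b : A) : A :=
  \sum_(i < size p) p`_i *: (a ^+ i * b ^+ ((size p).-1 - i)%N).

Definition frac_algebraic (P : A -> Prop) (a b : A) : Prop :=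
  exists p : {poly K}, p != 0 /\ P (frac_poly_eval_num p a b).

Definition poisson_rational (P : A -> Prop) : Prop :=
  poisson_prime P /\
  forall a b, ~ P b -> frac_poisson_central P a b -> frac_algebraic P a b.

End Poisson.

(* Main.v *)
(* The substantial implication is rational => locally closed. If all brackets lie in [P] then
   [A / P] is the field of scalars. Otherwise some [h = {x1, x2}] is not in [P], and modulo a
   Poisson prime [Q] avoiding [h] the elements [x1, x2] stay algebraically independent, since
   the kernel of [K[x1, x2] -> A / Q] is stable under both partial derivatives. As the
   dimension is at most three, the only such [Q] containing [P] is [P] itself, unless [P = 0]
   and [A] has transcendence degree three.

   In that case suppose infinitely many nonzero Poisson primes [Q_i] avoid [h]. With generic
   [x1, x2, x3], the trace of [Frac (A / Q_i)] over [k = K(x1, x2)] is a functional [t_i] on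
   [A] that commutes with the two Hamiltonian derivations [{-, x2} / h] and [{x1, -} / h], and
   [t_i (x3 ^ l * y)] is a polynomial of total degree at most [l + const], as valuations show.
   Let [a_i] in [F = Frac A] represent [t_i] through
   [Res_(x3 = oo) Tr_(F / k(x3)) (a_i * y) = t_i y]. The two Lie derivatives of [a_i] pair
   with [A] without residues, so their coordinates are polynomials, of degree bounded
   independently of [i]: they lie in a fixed finite-dimensional space. Hence two combinations
   [a], [b] of disjoint blocks of the [a_i] are killed by both Lie derivatives, and [a / b] is
   killed by both Hamiltonian derivations. The bracket having rank two, [a / b] is Poisson
   central, hence a scalar as [0] is rational; this contradicts the linear independence of
   the [t_i]. *)
Require Import Defs.
From HB Require Import structures.
From mathcomp Require Import all_boot all_order all_algebra.
From mathcomp Require Import boolp classical_sets.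
From mathcomp Require Import reals.
From mathcomp.real_closed Require Import complex.
From mathcomp Require Import ring lra zify.
Import Order.TTheory GRing.Theory Num.Theory.
Set Implicit Arguments.
Unset Strict Implicit.
Unset Printing Implicit Defensive.
Local Open Scope ring_scope.

(** The uncountability of the base field enters twice. [A] has countable dimension, so a
    transcendental element can be specialized to a scalar, which turns algebraically independent
    elements into chains of primes; and one linear change of coordinates can be generic for
    countably many primes at once. The obstacle is that the degree of [Frac (A / Q_i)] over
    [K(x1, x2)] need not be bounded in [i]: the [a_i] have poles along surfaces [q_i = 0] of
    arbitrary degree and span no finite-dimensional space. What is bounded is their failure to be
    invariant. Once a denominator independent of [i] is cleared, the trace coordinates of a Lie
    derivative of [a_i] have denominator [q_i ^ 2] and a numerator of degree at most
    [2 deg q_i + const]; as they are polynomials, their degree is at most [const]. On functions the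
    Lie derivative acts as [V + c], with [V] a derivation and [c] independent of [i]. A solution of
    [V f + c * f = 0] is not central by itself, but [c] cancels in the quotient of two solutions,
    hence the two disjoint blocks. *)

Section Uncountable.
Variable R : realType.

(** The left piece ends halfway between [I.1] and [m], strictly below [m], so that the closed
    interval misses [v] also when [v = m]. *)
Definition shrink (v : R) (I : R * R) : R * R :=
  let m := (I.1 + I.2) / 2 in
  if v < m then (m, I.2) else (I.1, (I.1 + m) / 2).

Lemma shrinkP (v : R) (I : R * R) : I.1 < I.2 ->
  [/\ I.1 <= (shrink v I).1, (shrink v I).1 < (shrink v I).2,
      (shrink v I).2 <= I.2 & ~ ((shrink v I).1 <= v <= (shrink v I).2)].
Proof.
case: I => a b /= ab; rewrite /shrink /=.
case: ltP => vm /=; split; try lra.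
Qed.

Lemma real_uncountable (r : nat -> R) : exists x, forall n, r n <> x.
Proof.
pose I := fix I n := if n is m.+1 then shrink (r m) (I m) else (0, 1) : R * R.
have Ilt n : (I n).1 < (I n).2.
  by elim: n => [|n /shrinkP IHn] /=; [exact: ltr01 | case: (IHn (r n))].
have Imono m n : (m <= n)%N -> (I m).1 <= (I n).1 /\ (I n).2 <= (I m).2.
  elim: n => [|n IHn]; first by rewrite leqn0 => /eqP ->.
  rewrite leq_eqVlt => /predU1P[->//|/IHn[h1 h2]].
  have [h3 _ h4 _] := shrinkP (r n) (Ilt n); split.
    exact: le_trans h1 h3.
  exact: le_trans h4 h2.
have Icross m n : (I m).1 <= (I n).2.
  have [h1 _] := Imono m (maxn m n) (leq_maxl _ _).
  have [_ h2] := Imono n (maxn m n) (leq_maxr _ _).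
  exact: le_trans h1 (le_trans (ltW (Ilt _)) h2).
pose L : set R := range (fun n => (I n).1).
have supL : has_sup L.
  split; first by exists (I 0%N).1, 0%N.
  by exists (I 0%N).2 => _ [n _ <-].
exists (sup L) => n rn.
have [_ _ _] := shrinkP (r n) (Ilt n); apply.
rewrite rn -rn -/(I n.+1) [in X in _ <= X <= _]rn; apply/andP; split.
  by apply: sup_upper_bound => //; exists n.+1.
by apply: ge_sup => [|_ [m _ <-]]; [case: supL | exact: Icross].
Qed.

(** The real parts of all listed scalars form one sequence, indexed by pairs of a set and a
    position, and any real number off this sequence will do. All generic choices of scalars below go
    through this lemma. *)
Lemma avoid_countable (B : nat -> R[i] -> Prop) :
  (forall i, exists s : seq R[i], forall c, B i c -> c \in s) ->
  exists c, forall i, ~ B i c.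
Proof.
move=> /choice[s sP].
pose r n := if unpickle n is Some (i, j) then complex.Re (s i)`_j else 0.
have [x xP] := real_uncountable r.
pose c : R[i] := Complex x 0.
exists c => i /sP xs; apply: (xP (pickle (i, index c (s i)))).
by rewrite /r pickleK nth_index.
Qed.

End Uncountable.

(** * Ideals, transcendental elements and chains of primes *)

Section Ideals.
Variables (K : comNzRingType) (A : comAlgType K).
Implicit Types (I J P Q T : A -> Prop).

Lemma idealN I x : ideal I -> I x -> I (- x).
Proof. by case=> _ _ IM Ix; rewrite -mulN1r; apply: IM. Qed.

Lemma idealB I x y : ideal I -> I x -> I y -> I (x - y).
Proof. by move=> idI Ix Iy; case: (idI) => _ ID _; apply: ID => //; apply: idealN. Qed.

Lemma idealMr I x y : ideal I -> I x -> I (x * y).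
Proof. by case=> _ _ IM Ix; rewrite mulrC; apply: IM. Qed.

Lemma idealZ I c x : ideal I -> I x -> I (c *: x).
Proof. by case=> _ _ IM Ix; rewrite -[x]mul1r scalerAl; apply: IM. Qed.

Lemma ideal_sum I (J : Type) (r : seq J) (p : pred J) (F : J -> A) :
  ideal I -> (forall j, p j -> I (F j)) -> I (\sum_(j <- r | p j) F j).
Proof. by case=> I0 ID _ IF; elim/big_ind: _. Qed.

Lemma ideal_subr I x y : ideal I -> I (x - y) -> I y -> I x.
Proof. by case=> _ ID _ Ixy Iy; rewrite -(subrK y x); apply: ID. Qed.

Lemma zero_prime : integral_domain A -> prime_ideal (fun a : A => a = 0).
Proof.
case=> d1 d2; split=> [|/eqP|x y /d2 //]; last by rewrite (negPf d1).
by split=> // [x y -> ->|a x ->]; rewrite ?addr0 ?mulr0.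
Qed.

Lemma prime_exp P x n : prime_ideal P -> P (x ^+ n) -> P x.
Proof.
case=> _ P1 PM; elim: n => [|n IHn]; first by rewrite expr0.
by rewrite exprS => /PM[].
Qed.

Definition add_ideal I x : A -> Prop := fun z => exists a, I (z - a * x).

Lemma ideal_add_ideal I x : ideal I -> ideal (add_ideal I x).
Proof.
move=> idI; have [I0 ID IM] := idI; split.
- by exists 0; rewrite mul0r subr0.
- move=> y z [a Ia] [b Ib]; exists (a + b).
  by rewrite mulrDl opprD addrACA; apply: ID.
- by move=> c y [a Ia]; exists (c * a); rewrite -mulrA -mulrBr; apply: IM.
Qed.

Lemma sub_add_ideal I x z : ideal I -> I z -> add_ideal I x z.
Proof. by exists 0; rewrite mul0r subr0. Qed.

Lemma mem_add_ideal I x : ideal I -> add_ideal I x x.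
Proof. by case=> I0 _ _; exists 1; rewrite mul1r subrr. Qed.

Lemma prime_avoid I T : ideal I -> T 1 -> (forall x y, T x -> T y -> T (x * y)) ->
  (forall x, I x -> ~ T x) ->
  exists Q, [/\ prime_ideal Q, forall x, I x -> Q x & forall x, Q x -> ~ T x].
Proof.
move=> idI T1 TM IT; have [I0 _ _] := idI.
pose F J := [/\ ideal J, forall x, I x -> J x & forall x, J x -> ~ T x].
have [F' F'F totF'|Q [[Q0|FQ] Qmax]] :=
  Zorn_bigcup (P := [set J : set A | (J = set0 \/ F J)%classic]%classic).
- have [[J [FJ nJ0]]|noJ] := pselect (exists J, F' J /\ (J <> set0)%classic); last first.
    left; apply/seteqP; split=> // x [J FJ Jx]; apply: noJ; exists J; split=> //.
    by move=> J0; rewrite J0 in Jx.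
  right; have FF J' x : F' J' -> J' x -> F J'.
    by move=> /F'F[->|].
  have [x Jx] : exists x, J x.
    by apply: contrapT => nJ; apply: nJ0; apply/seteqP; split=> // x Jx; apply: nJ; exists x.
  have [idJ IJ JT] := FF _ _ FJ Jx.
  split; first split.
  + by exists J => //; apply: IJ.
  + move=> y z [Y FY Yy] [Z FZ Zz].
    have [[_ YD _] _ _] := FF _ _ FY Yy; have [[_ ZD _] _ _] := FF _ _ FZ Zz.
    have [YZ|ZY] := totF' _ _ FY FZ.
      by exists Z => //; apply: ZD => //; apply: YZ.
    by exists Y => //; apply: YD => //; apply: ZY.
  + move=> a y [Y FY Yy]; exists Y => //.
    by have [[_ _ YM] _ _] := FF _ _ FY Yy; apply: YM.
  + by move=> y Iy; exists J => //; apply: IJ.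
  + by move=> y [Y FY Yy]; have [_ _] := FF _ _ FY Yy; apply.
- exfalso; apply: (Qmax I); last by right; split.
  by rewrite Q0; split=> // /(_ _ I0).
have [idQ IQ QT] := FQ; exists Q; split=> //; split=> //.
  by move=> /QT.
move=> x y Qxy; apply: contrapT => /not_orP[nQx nQy].
have meet z : ~ Q z -> exists2 t, T t & add_ideal Q z t.
  move=> nQz; apply: contrapT => no.
  apply: (Qmax (add_ideal Q z)).
    split=> [w Qw|sub]; first exact: sub_add_ideal.
    by apply/nQz/sub/mem_add_ideal.
  right; split; first exact: ideal_add_ideal.
    by move=> w Iw; apply/sub_add_ideal/IQ.
  by move=> w Qw Tw; apply: no; exists w.
have [t Tt [a Qa]] := meet x nQx; have [u Tu [b Qb]] := meet y nQy.
apply: (QT (t * u)); last exact: TM.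
have -> : t * u = (t - a * x) * u + a * x * (u - b * y) + a * b * (x * y) by ring.
have [_ QD QM] := idQ.
by apply: (QD); [apply: (QD); [apply: idealMr | apply: (QM)] | apply: (QM)].
Qed.

End Ideals.

Lemma infinite_uniq (T : eqType) (B : T -> Prop) :
  (forall s : seq T, exists2 c, B c & c \notin s) ->
  forall k, exists s : seq T, [/\ size s = k, uniq s & forall c, c \in s -> B c].
Proof.
move=> Binf; elim=> [|k [s [sk us sB]]]; first by exists [::].
have [c Bc cs] := Binf s; exists (c :: s); split=> /=; first by rewrite sk.
  by rewrite cs us.
by move=> d; rewrite inE => /predU1P[->//|/sB].
Qed.

Lemma wide_dependent (K : fieldType) (n : nat) (M : 'M[K]_(n.+1, n)) :
  exists2 v : 'rV[K]_n.+1, v != 0 & v *m M = 0.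
Proof.
have kM : kermx M != 0.
  rewrite kermx_eq0 /row_free; apply: contraTneq (rank_leq_col M) => ->.
  by rewrite ltnn.
exists (nz_row (kermx M)); first by rewrite nz_row_eq0.
by apply/sub_kermxP; rewrite nz_row_sub.
Qed.

Definition evalp (B L : comNzRingType) (phi : {rmorphism B -> L}) (x : L) :
  {poly B} -> L := horner_morph (fun a => mulrC x (phi a)).
HB.instance Definition _ (B L : comNzRingType) (phi : {rmorphism B -> L}) (x : L) :=
  GRing.RMorphism.on (evalp phi x).

Section Evalp.
Variables (B L : comNzRingType) (phi : {rmorphism B -> L}) (x : L).
Lemma evalpC b : evalp phi x b%:P = phi b. Proof. exact: horner_morphC. Qed.
Lemma evalpX : evalp phi x 'X = x. Proof. exact: horner_morphX. Qed.
Lemma evalpE p : evalp phi x p = (map_poly phi p).[x]. Proof. by []. Qed.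
Lemma evalp_sum (p : {poly B}) n : (size p <= n)%N ->
  evalp phi x p = \sum_(i < n) phi p`_i * x ^+ i.
Proof.
move=> pn; rewrite evalpE (@horner_coef_wide _ n).
  by apply: eq_bigr => i _; rewrite coef_map.
exact: leq_trans (size_poly _ _) pn.
Qed.
End Evalp.

Section Affine.
Variables (R : realType).
Local Notation K := R[i].
Variable A : comAlgType K.
Implicit Types (I J P Q T : A -> Prop).

Definition partial_span (m : nat -> A) n a :=
  exists c : nat -> K, a = \sum_(i < n) c i *: m i.

Lemma partial_span_le m n n' a : (n <= n')%N -> partial_span m n a -> partial_span m n' a.
Proof.
move=> nn' [c ->]; exists (fun i => if (i < n)%N then c i else 0).
rewrite (big_ord_widen n' (fun i => c i *: m i) nn') [RHS](bigID (fun i : 'I_n' => (i < n)%N)) /=.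
rewrite [X in _ = _ + X]big1 ?addr0; last by move=> i /negPf->; rewrite scale0r.
by apply: eq_bigr => i ->.
Qed.

(** Monomials in the generators are indexed by sequences of indices, hence by natural numbers. This
    countable dimension is played against the uncountable field in the next lemma. *)
Lemma countable_span : finitely_generated A ->
  exists m : nat -> A, forall a, exists n, partial_span m n a.
Proof.
case=> s gens.
pose mon (l : seq nat) := \prod_(i <- l) s`_i.
pose m n := if unpickle n is Some l then mon l else 0.
exists m.
have mE l : m (pickle l) = mon l by rewrite /m pickleK.
suff spn : forall a, exists l : seq (K * seq nat), a = \sum_(p <- l) p.1 *: mon p.2.
  move=> a; have [l ->] := spn a; elim: l => [|[c l'] l [n IHl]].
    by exists 0%N, (fun=> 0); rewrite big_nil big_ord0.
  exists (maxn n (pickle l').+1); rewrite big_cons /=.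
  have [c1 ->] : partial_span m (maxn n (pickle l').+1) (\sum_(p <- l) p.1 *: mon p.2).
    exact: partial_span_le (leq_maxl _ _) IHl.
  exists (fun i => c1 i + (i == pickle l')%:R * c).
  under [RHS]eq_bigr do rewrite scalerDl.
  rewrite big_split /= addrC; congr (_ + _).
  have lt : (pickle l' < maxn n (pickle l').+1)%N by rewrite leq_max ltnSn orbT.
  rewrite (bigD1 (Ordinal lt)) //= eqxx mul1r mE big1 ?addr0 // => i /negPf i_neq.
  by rewrite -val_eqE /= in i_neq; rewrite i_neq mul0r scale0r.
apply: (gens (fun a => exists l : seq (K * seq nat), a = \sum_(p <- l) p.1 *: mon p.2)).
- move=> x xs; exists [:: (1, [:: index x s])].
  by rewrite big_seq1 /mon big_seq1 nth_index // scale1r.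
- by exists [:: (1, [::])]; rewrite big_seq1 /mon big_nil scale1r.
- by move=> x y [l ->] [l' ->]; exists (l ++ l'); rewrite big_cat.
- move=> x y [l ->] [l' ->].
  exists [seq (p.1 * q.1, p.2 ++ q.2) | p <- l, q <- l'].
  rewrite big_allpairs_dep big_distrlr /=; apply: eq_bigr => p _.
  apply: eq_bigr => q _; rewrite /mon big_cat /=.
  by rewrite -scalerAl -scalerAr scalerA.
- move=> c x [l ->]; exists [seq (c * p.1, p.2) | p <- l].
  by rewrite big_map scaler_sumr; apply: eq_bigr => p _; rewrite scalerA.
Qed.

(** Amitsur's trick. If for no scalar [l] a prime over [P + (x - l)] avoids all [f ^ N * phi tau]
    with [tau] nonzero, then for every [l] one of these elements is congruent to some
    [u_l * (x - l)] modulo [P]. The dimension of [A] being countable, infinitely many [u_l], with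
    the same [N], lie in one finite-dimensional space. A linear relation between them is a relation
    between fractions [tau_l / (x - l)], which partial fractions exclude for a transcendental
    [x]. *)
Lemma drop_transcendental (B : idomainType) (kappa : {rmorphism K -> B})
    (phi : {rmorphism B -> A}) P x f :
  finitely_generated A -> (forall c, phi (kappa c) = c%:A) ->
  prime_ideal P -> (forall p, P (evalp phi x p) -> p = 0) -> ~ P f ->
  exists Q, [/\ prime_ideal Q, strict_subideal P Q, ~ Q f & forall b, Q (phi b) -> b = 0].
Proof.
move=> /countable_span[m mP] phik pP xP Pf.
have [idP P1 PM] := pP; have [P0 PD PMl] := idP.
apply: contrapT => noQ.
pose bad N n l := exists tau u, [/\ tau != 0, partial_span m n u &
  P (f ^+ N * phi tau - u * (x - l%:A))].
have badP l : exists N n, bad N n l.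
  apply: contrapT => nobad.
  pose T z := exists N tau, tau != 0 /\ z = f ^+ N * phi tau.
  have [|||Q [pQ PQ QT]] := @prime_avoid _ _ (add_ideal P (x - l%:A)) T (ideal_add_ideal _ idP).
  - by exists 0%N, 1; rewrite oner_neq0 rmorph1 mulr1 expr0.
  - move=> _ _ [N [t [t0 ->]]] [N' [t' [t'0 ->]]]; exists (N + N')%N, (t * t').
    by rewrite mulf_neq0 // rmorphM exprD; split=> //; ring.
  - move=> z [u Pu] [N [t [t0 zE]]]; have [n un] := mP u.
    by apply: nobad; exists N, n, t, u; rewrite -zE.
  apply: noQ; exists Q; split=> //.
  - split; first by move=> y Py; apply/PQ/sub_add_ideal.
    exists (x - l%:A); split; first exact/PQ/mem_add_ideal.
    move=> Px; have /xP/eqP : P (evalp phi x ('X - (kappa l)%:P)).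
      by rewrite rmorphB /= evalpX evalpC phik.
    by rewrite polyXsubC_eq0.
  - move=> /QT; apply; exists 1%N, 1; rewrite oner_neq0 rmorph1 mulr1 expr1; by split.
  - move=> b Qb; apply/eqP; apply: contrapT => /negP b0; apply: (QT _ Qb).
    by exists 0%N, b; rewrite expr0 mul1r.
have [j jinf] : exists j : nat * nat, forall s : seq K, exists2 c, bad j.1 j.2 c & c \notin s.
  apply: contrapT => nojinf.
  pose Bd j l := if unpickle j is Some (N, n) then bad N n l else False.
  have [|l lP] := @avoid_countable _ Bd.
    move=> j; rewrite /Bd; case: unpickle => [[N n]|]; last by exists [::].
    apply: contrapT => nos; apply: nojinf; exists (N, n) => s /=.
    apply: contrapT => noc; apply: nos; exists s => c bc.
    by apply: contrapT => /negP cs; apply: noc; exists c.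
  have [N [n Nn]] := badP l; apply: (lP (pickle (N, n))).
  by rewrite /Bd pickleK.
case: j jinf => N n /= /infinite_uniq/(_ n.+1)[L [sL uL LB]].
have {LB} : forall i : 'I_n.+1, exists d : B * A * (nat -> K), [/\ d.1.1 != 0,
    d.1.2 = \sum_(j < n) d.2 j *: m j & P (f ^+ N * phi d.1.1 - d.1.2 * (x - (L`_i)%:A))].
  move=> i; have /LB[t [u [t0 [c uE] Pu]]] : L`_i \in L by rewrite mem_nth // sL.
  by exists (t, u, c).
move=> /choice[d dP].
have [v v0 vM] := wide_dependent (\matrix_(i, j) (d i).2 j).
have vu : \sum_i v 0 i *: (d i).1.2 = 0.
  transitivity (\sum_(j < n) \sum_i (v 0 i * (d i).2 j) *: m j).
    rewrite exchange_big /=; apply: eq_bigr => i _; have [_ -> _] := dP i.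
    by rewrite scaler_sumr; apply: eq_bigr => j _; rewrite scalerA.
  rewrite big1 // => j _; rewrite -scaler_suml.
  have /rowP/(_ j) := vM; rewrite !mxE => vMj.
  suff -> : \sum_i v 0 i * (d i).2 j = 0 by rewrite scale0r.
  by rewrite -[RHS]vMj; apply: eq_bigr => i _; rewrite mxE.
(* This clears the denominators in [\sum_i v_i tau_i / (x - l_i)]; only the summand [i] of [p]
   survives evaluation at [l_i]. *)
pose W (i : 'I_n.+1) : {poly B} := \prod_(j < n.+1 | j != i) ('X - (kappa L`_j)%:P).
pose p : {poly B} := \sum_i (kappa (v 0 i) * (d i).1.1)%:P * W i.
have evW (i : 'I_n.+1) : evalp phi x (W i) = \prod_(j < n.+1 | j != i) (x - (L`_j)%:A).
  by rewrite rmorph_prod; apply: eq_bigr => j _; rewrite rmorphB /= evalpX evalpC phik.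
have /xP p0 : P (evalp phi x p).
  suff /PM[/(prime_exp pP)//|//] : P (f ^+ N * evalp phi x p).
  pose X := \prod_(j < n.+1) (x - (L`_j)%:A).
  have vuX : (\sum_i v 0 i *: (d i).1.2) * X = 0 by rewrite vu mul0r.
  have -> : f ^+ N * evalp phi x p = \sum_i v 0 i *:
     ((f ^+ N * phi (d i).1.1 - (d i).1.2 * (x - (L`_i)%:A)) * evalp phi x (W i)).
    rewrite -[LHS]subr0 -[X in _ - X = _]vuX mulr_suml rmorph_sum mulr_sumr /= -sumrB.
    apply: eq_bigr => i _; rewrite rmorphM /= evalpC rmorphM /= phik.
    rewrite mulrBl scalerBr; congr (_ - _).
      by rewrite -[RHS]mulr_algl; ring.
    rewrite /X (bigD1 i) //= evW -scalerAl mulrA; congr (_ *: _).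
  apply: ideal_sum => // i _; apply: idealZ => //; apply: idealMr => //.
  by have [] := dP i.
have [i vi] : exists i, v 0 i != 0 by apply/rV0Pn.
have : p.[kappa L`_i] = 0 by rewrite p0 horner0.
rewrite horner_sum (bigD1 i) //= [X in _ + X]big1 ?addr0.
  rewrite hornerM hornerC horner_prod => /eqP; rewrite mulf_eq0; apply/negP/norP; split.
    by rewrite mulf_neq0 //; [rewrite fmorph_eq0 | have [] := dP i].
  apply/prodf_neq0 => j ji; rewrite hornerXsubC -rmorphB fmorph_eq0 subr_eq0.
  by rewrite nth_uniq ?sL // eq_sym.
move=> k ki; rewrite hornerM [X in _ * X](_ : _ = 0) ?mulr0 //.
apply/eqP; rewrite horner_prod; apply/prodf_eq0; exists i; first by rewrite eq_sym.
by rewrite hornerXsubC subrr.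
Qed.

End Affine.

Section Chains.
Variables (K : comNzRingType) (A : comAlgType K).
Implicit Types (P Q : A -> Prop).

Fixpoint prime_chain (n : nat) P : Prop :=
  prime_ideal P /\
  if n is n'.+1 then exists Q, strict_subideal P Q /\ prime_chain n' Q else True.

Lemma prime_chain_fun n P : prime_chain n P ->
  exists Q : nat -> A -> Prop, [/\ Q 0%N = P, forall i, (i <= n)%N -> prime_ideal (Q i) &
    forall i, (i < n)%N -> strict_subideal (Q i) (Q i.+1)].
Proof.
elim: n P => [|n IHn] P [pP].
  by move=> _; exists (fun=> P); split.
move=> [Q [PQ /IHn[F [F0 Fp Fs]]]].
exists (fun i => if i is j.+1 then F j else P); split=> //.
  by case=> // i /Fp.
by case=> [|i] //=; [rewrite F0 | move=> /Fs].
Qed.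

Lemma krull_dim_chain n P : krull_dim_le A n -> ~ prime_chain n.+1 P.
Proof. by move=> dimA /prime_chain_fun[Q [_ Qp Qs]]; apply: (dimA Q). Qed.

End Chains.

Section Affine.
Variables (R : realType).
Local Notation K := R[i].
Variable A : comAlgType K.
Hypothesis fgA : finitely_generated A.
Implicit Types (I J P Q T : A -> Prop) (x y z : A).

Definition ev1 x : {rmorphism {poly K} -> A} := evalp (in_alg A) x.
Definition ev2 x y : {rmorphism {poly {poly K}} -> A} := evalp (ev1 x) y.
Definition ev3 x y z : {rmorphism {poly {poly {poly K}}} -> A} := evalp (ev2 x y) z.
Definition ev4 x y z t : {rmorphism {poly {poly {poly {poly K}}}} -> A} :=
  evalp (ev3 x y z) t.

Lemma alg_neq0 P c : prime_ideal P -> P c%:A -> c = 0.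
Proof.
move=> [idP P1 _] Pc; apply/eqP; apply: contrapT => /negP c0; apply: P1.
by rewrite -[1](scale1r) -(mulVf c0) -scalerA; apply: idealZ.
Qed.

(** Over an algebraically closed field a relation splits into linear factors, one of which falls
    into the prime. *)
Lemma alg_point P x (p : {poly K}) : prime_ideal P -> p != 0 -> P (ev1 x p) ->
  exists l : K, P (x - l%:A).
Proof.
move=> pP; have [idP P1 PM] := pP => p0.
have [r ->] := closed_field_poly_normal p.
rewrite -mul_polyC rmorphM /= evalpC => /PM[/(alg_neq0 pP)/eqP|].
  by rewrite lead_coef_eq0 (negPf p0).
elim: r => [|l r IHr]; first by rewrite big_nil rmorph1.
rewrite big_cons rmorphM => /PM[|/IHr//].
by rewrite rmorphB /= evalpX evalpC; exists l.
Qed.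

Lemma drop1 P x f : prime_ideal P -> (forall p, P (ev1 x p) -> p = 0) -> ~ P f ->
  exists Q, [/\ prime_ideal Q, strict_subideal P Q & ~ Q f].
Proof.
move=> pP xP Pf.
have [//|//|//|//|Q []] := @drop_transcendental _ _ _ (idfun : {rmorphism K -> K}) (in_alg A) P x f fgA.
by move=> *; exists Q.
Qed.

(** [drop_transcendental] keeps [B] embedded modulo the larger prime, so each further independent
    element adds one strict inclusion. This is how transcendence degree gets bounded by Krull
    dimension. *)
Lemma indep_chainS n (B : idomainType) (kappa : {rmorphism K -> B})
    (phi : {rmorphism B -> A}) x : (forall c, phi (kappa c) = c%:A) ->
  (forall P, prime_ideal P -> (forall b, P (phi b) -> b = 0) -> prime_chain n P) ->
  forall P, prime_ideal P -> (forall p, P (evalp phi x p) -> p = 0) -> prime_chain n.+1 P.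
Proof.
move=> phik IH P pP xP; have [_ P1 _] := pP; split=> //.
have [Q [pQ PQ _ Qx]] := drop_transcendental fgA phik pP xP P1.
by exists Q; split=> //; apply: IH.
Qed.

Lemma ev1C x c : ev1 x c%:P = c%:A. Proof. exact: evalpC. Qed.
Lemma ev2C x y p : ev2 x y p%:P = ev1 x p. Proof. exact: evalpC. Qed.
Lemma ev3C x y z p : ev3 x y z p%:P = ev2 x y p. Proof. exact: evalpC. Qed.

Lemma indep2_chain x y P : prime_ideal P -> (forall p, P (ev2 x y p) -> p = 0) ->
  prime_chain 2 P.
Proof.
apply: (@indep_chainS _ _ polyC (ev1 x) y (ev1C x)).
by apply: (@indep_chainS _ _ idfun (in_alg A) x (fun=> erefl)).
Qed.

Lemma indep3_chain x y z P : prime_ideal P -> (forall p, P (ev3 x y z p) -> p = 0) ->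
  prime_chain 3 P.
Proof.
apply: (@indep_chainS _ _ (polyC \o polyC) (ev2 x y) z); last exact: indep2_chain.
by move=> c; rewrite -(ev1C x) -(ev2C x y).
Qed.

Lemma indep4_chain x y z t P : prime_ideal P -> (forall p, P (ev4 x y z t p) -> p = 0) ->
  prime_chain 4 P.
Proof.
apply: (@indep_chainS _ _ (polyC \o polyC \o polyC) (ev3 x y z) t); last exact: indep3_chain.
by move=> c; rewrite -(ev1C x) -(ev2C x y) -(ev3C x y z).
Qed.

(** As long as some element is transcendental modulo [P], pass to a larger prime avoiding [f]. The
    bound on chains stops this, and then every element is algebraic, hence a scalar, modulo the
    prime reached. *)
Lemma nullstellensatz n P f : ~ prime_chain n P -> prime_ideal P -> ~ P f ->
  exists M, [/\ prime_ideal M, subideal P M, ~ M f & forall a, exists l : K, M (a - l%:A)].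
Proof.
elim: n P => [|n IHn] P nch pP Pf; first by case: nch.
have [[x xP]|alg] := pselect (exists x, forall p, P (ev1 x p) -> p = 0).
  have [Q [pQ PQ Qf]] := drop1 pP xP Pf.
  have [|//|//|M [pM QM Mf Mp]] := IHn Q; first by move=> chQ; case: nch; split=> //; exists Q.
  by exists M; split=> // a /PQ.1 /QM.
exists P; split=> // a; apply: contrapT => na; apply: alg; exists a => p Pp.
by apply/eqP; apply: contrapT => /negP p0; apply: na; apply: alg_point p0 Pp.
Qed.

Lemma maximal_of_points M : prime_ideal M -> (forall a, exists l : K, M (a - l%:A)) ->
  maximal_ideal (A := A) M.
Proof.
move=> pM Mp; have [idM M1 _] := pM; split=> // J idJ MJ.
have [[x [Jx Mx]]|no] := pselect (exists x, J x /\ ~ M x).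
  right; have [l Ml] := Mp x.
  have l0 : l != 0.
    by apply/eqP => l0; apply: Mx; rewrite l0 scale0r subr0 in Ml.
  rewrite -[1](scale1r) -(mulVf l0) -scalerA; apply: idealZ => //.
  by apply: (@ideal_subr _ _ _ _ x) => //; rewrite -opprB; apply: idealN => //; apply: MJ.
left=> x; split; last exact: MJ.
by move=> Jx; apply: contrapT => Mx; apply: no; exists x.
Qed.

Lemma maximal_prime M : maximal_ideal (A := A) M -> prime_ideal M.
Proof.
move=> [idM M1 Mmax]; split=> // x y Mxy; apply: contrapT => /not_orP[Mx My].
have [MX|[a Ma]] := Mmax _ (ideal_add_ideal x idM) (fun z Mz => sub_add_ideal x idM Mz).
  by apply: Mx; rewrite -MX; apply: mem_add_ideal.
apply: My; rewrite -[y](subrK (a * x * y)); have [_ MD MM] := idM; apply: (MD).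
  by rewrite -{1}[y]mul1r -mulrBl; apply: idealMr.
by rewrite -mulrA; apply: (MM).
Qed.

Lemma maximal_points n M : krull_dim_le A n -> maximal_ideal (A := A) M ->
  forall a, exists l : K, M (a - l%:A).
Proof.
move=> dimA maxM; have pM := maximal_prime maxM.
have [idM M1 Mmax] := maxM.
have [N [[idN N1 _] MN _ Np]] := nullstellensatz (krull_dim_chain dimA) pM M1.
have [NM|//] := Mmax N idN MN.
by move=> a; have [l /NM] := Np a; exists l.
Qed.

End Affine.

(** * Poisson ideals and the easy implications *)

Section Bracket.
Variables (K : comNzRingType) (A : comAlgType K) (br : A -> A -> A).
Hypothesis hbr : poisson_bracket br.
Implicit Types (I J P Q M : A -> Prop) (x y z a b : A).

Lemma brDl x y z : br (x + y) z = br x z + br y z.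
Proof. by case: hbr => H _ _ _ _; rewrite -[x]scale1r H !scale1r. Qed.

Lemma brDr x y z : br z (x + y) = br z x + br z y.
Proof. by case: hbr => _ H _ _ _; rewrite -[x]scale1r H !scale1r. Qed.

Lemma br0l z : br 0 z = 0.
Proof. by apply: (addrI (br 0 z)); rewrite -brDl !addr0. Qed.

Lemma brZl c x z : br (c *: x) z = c *: br x z.
Proof. by case: hbr => H _ _ _ _; rewrite -[c *: x]addr0 H br0l addr0. Qed.

Lemma brNl x z : br (- x) z = - br x z.
Proof. by rewrite -!scaleN1r brZl. Qed.

Lemma brBl x y z : br (x - y) z = br x z - br y z.
Proof. by rewrite brDl brNl. Qed.

Lemma brC x y : br x y = - br y x.
Proof.
case: hbr => _ _ alt _ _; apply/eqP; rewrite -addr_eq0; apply/eqP.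
by have := alt (x + y); rewrite brDl !brDr !alt add0r addr0.
Qed.

Lemma brMl x y z : br (x * y) z = x * br y z + br x z * y.
Proof. by case: hbr => _ _ _ _ H; exact: H. Qed.

Lemma br1l z : br 1 z = 0.
Proof.
have := brMl 1 1 z; rewrite !mul1r mulr1 => H.
by apply: (addrI (br 1 z)); rewrite addr0 -H.
Qed.

Lemma br1r z : br z 1 = 0. Proof. by rewrite brC br1l oppr0. Qed.

Lemma br_alg c z : br c%:A z = 0.
Proof. by rewrite brZl br1l scaler0. Qed.

Lemma brXl x n z : br (x ^+ n) z = (x ^+ n.-1 * br x z) *+ n.
Proof.
elim: n => [|n IHn]; first by rewrite expr0 br1l mulr0n.
rewrite exprS brMl IHn; case: n {IHn} => [|n] /=.
  by rewrite !expr0 mulr0n mulr0 mulr1 mul1r add0r mulr1n.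
by rewrite mulrnAr mulrA -exprS [br x z * _]mulrC -mulrSr.
Qed.

(** The Poisson core of [M], its largest Poisson ideal, as the set of elements whose iterated
    brackets all stay in [M]. *)
Definition core M x := forall l : seq A, M (foldl br x l).

Lemma foldl_brD x y l : foldl br (x + y) l = foldl br x l + foldl br y l.
Proof. by elim: l x y => //= a l IHl x y; rewrite brDl IHl. Qed.

Lemma core_sub M : subideal (core M) M.
Proof. by move=> x /(_ [::]). Qed.

Lemma core_poisson M : ideal M -> poisson_ideal br (core M).
Proof.
move=> idM; have [M0 MD MM] := idM.
have cbr x a : core M x -> core M (br x a) by move=> cx l; apply: (cx (a :: l)).
split=> //; split.
- by move=> l; elim: l => //= a l; rewrite br0l.
- by move=> x y cx cy l; rewrite foldl_brD; apply: (MD).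
- move=> a x cx l; elim: l a x cx => [|b l IHl] a x cx /=; first by apply: (MM); apply: (cx [::]).
  by rewrite brMl foldl_brD; apply: (MD); apply: IHl => //; apply: cbr.
Qed.

Lemma core_largest M I : poisson_ideal br I -> subideal I M -> subideal I (core M).
Proof.
move=> [idI Ibr] IM x Ix l; apply: IM.
by elim: l x Ix => //= a l IHl x Ix; apply/IHl/Ibr.
Qed.

End Bracket.

Section CorePrime.
Variables (K : numFieldType) (A : comAlgType K) (br : A -> A -> A).
Hypothesis hbr : poisson_bracket br.
Implicit Types (I J P Q M : A -> Prop) (x y z a b : A).

Lemma idealMn_inv I x n : ideal I -> I (x *+ n.+1) -> I x.
Proof.
move=> idI; rewrite -scaler_nat => /(idealZ n.+1%:R^-1 idI).
by rewrite scalerA mulVf ?scale1r // pnatr_eq0.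
Qed.

(** Bracketing [x ^ j.+1 * d ^ m] with [a] and multiplying by [d] gives [j.+1] times
    [x ^ j * d ^ m.+2], up to a multiple of the element itself: one factor [x] is traded for two
    factors [d]. Characteristic zero removes [j.+1]. *)
Lemma nilpotent_br I x a n : poisson_ideal br I -> I (x ^+ n) -> exists m, I (br x a ^+ m).
Proof.
move=> [idI Ibr]; set d := br x a => Ix.
suff H j m : I (x ^+ j * d ^+ m) -> exists m, I (d ^+ m).
  by apply: (H n 0%N); rewrite expr0 mulr1.
elim: j m => [|j IHj] m; first by rewrite expr0 mul1r; exists m.
move=> Ixd; apply: (IHj m.+2); apply: (@idealMn_inv I _ j) => //.
have /(idealMr d idI) := Ibr _ a Ixd.
rewrite (brMl hbr) !(brXl hbr) -/d /= => H.
apply: (ideal_subr idI (y := - ((x ^+ j.+1 * d ^+ m) * br d a) *+ m)); last first.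
  by rewrite -scaler_nat; apply: idealZ => //; apply: idealN => //; apply: idealMr.
have mulE k : exists u : A, forall y, y *+ k = y * u.
  by exists k%:R => y; rewrite mulr_natr.
have [u uE] := mulE j.+1.
move: H; congr I; case: m Ixd => [|m] _ /=.
  by rewrite !mulr0n expr0 !uE mulr1 mulr0 add0r subr0; ring.
have [v vE] := mulE m.+1.
by rewrite !exprS !uE !vE; ring.
Qed.

(** By [nilpotent_br] all iterated brackets of [y] are nilpotent modulo the core, hence lie in the
    prime [M]. *)
Lemma core_semiprime M y : prime_ideal M -> core br M (y ^+ 2) -> core br M y.
Proof.
move=> pM cy; have [idM _ _] := pM.
have pcM := core_poisson hbr idM.
have H l x n : core br M (x ^+ n) -> exists m, core br M (foldl br x l ^+ m).
  elim: l x n => [|a l IHl] x n cx; first by exists n.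
  by have [m /IHl] := nilpotent_br a pcM cx.
move=> l; have [m /(_ [::])/=/(prime_exp pM)//] := H l _ _ cy.
Qed.

(** [br x b * a] equals [br (x * a) b] up to [x * br a b]. After squaring, the error acquires the
    factor [x * a], which is in the core, and the core is semiprime. *)
Lemma colon_poisson M a : prime_ideal M -> poisson_ideal br (fun x => core br M (x * a)).
Proof.
move=> pM; have [idM _ _] := pM; have [[c0 cD cM] cbr] := core_poisson hbr idM.
split; first split.
- by rewrite mul0r.
- by move=> x y cx cy; rewrite mulrDl; apply: (cD).
- by move=> b x cx; rewrite -mulrA; apply: (cM).
move=> x b cxa; apply: core_semiprime => //.
have -> : (br x b * a) ^+ 2 = (br x b * a) * br (x * a) b - (br x b * br a b) * (x * a).
  by rewrite (brMl hbr); ring.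
by apply: (@idealB _ _ (core br M)); [split | apply: (cM); apply: cbr | apply: (cM)].
Qed.

(** If [a * b] is in the core and [a] is not, the Poisson ideal of the elements multiplying [b] into
    the core is not inside [M]: some [s] outside [M] replaces [a]. The same done to [b] gives a
    product [t * s] in [M] of two elements outside [M]. *)
Lemma core_prime M : prime_ideal M -> poisson_prime br (core br M).
Proof.
move=> pM; have [idM M1 MM] := pM; have [idc cbr] := core_poisson hbr idM.
split=> //; split=> //; first by move=> /core_sub.
have meet a b : core br M (a * b) -> ~ core br M a -> exists2 s, ~ M s & core br M (s * b).
  move=> cab na; apply: contrapT => no; apply: na.
  apply: (core_largest (colon_poisson b pM)) cab => x cx.
  by apply: contrapT => Mx; apply: no; exists x.
move=> a b cab; apply: contrapT => /not_orP[na nb].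
have [s Ms csb] := meet a b cab na; rewrite mulrC in csb.
have [t Mt /core_sub/MM[]//] := meet b s csb nb.
Qed.

(** The open set can be shrunk to a basic one, given by a single [f] of [T] outside [P], and the
    closed set to that of [P]. *)
Lemma poisson_locally_closedP P : poisson_locally_closed br P <-> poisson_prime br P /\
  exists f, ~ P f /\ forall Q, poisson_prime br Q -> subideal P Q -> ~ Q f -> subideal Q P.
Proof.
split=> [[pP [S [T ST]]]|[pP [f [Pf fP]]]]; split=> //.
  have [_ /(_ (fun _ => iff_refl _))[[_ SP] TP]] := ST P pP.
  have [f [Tf Pf]] : exists f, T f /\ ~ P f.
    apply: contrapT => no; apply: TP; split=> // x Tx.
    by apply: contrapT => Px; apply: no; exists x.
  exists f; split=> // Q pQ PQ Qf x Qx; apply/(ST Q pQ).1 => //; split.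
    by split=> // y /SP/PQ.
  by case=> _ /(_ _ Tf).
exists P, (eq f) => Q pQ; split.
  move=> [[_ PQ] nf] x; split; last exact: PQ.
  by apply: fP => // Qf; apply: nf; split=> // _ <-.
move=> QP; split; first by split=> // x /QP.
by case=> _ /(_ f erefl)/QP.
Qed.

End CorePrime.

Section Primitive.
Variables (R : realType).
Local Notation K := R[i].
Variables (A : comAlgType K) (br : A -> A -> A) (n : nat).
Hypotheses (fgA : finitely_generated A) (dimA : krull_dim_le A n).
Hypothesis hbr : poisson_bracket br.
Implicit Types (P Q M : A -> Prop).

(** A maximal ideal over [P] avoiding the [f] that isolates [P] has as core a Poisson prime over [P]
    that avoids [f], hence [P] itself. *)
Lemma locally_closed_primitive P : poisson_locally_closed br P -> poisson_primitive br P.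
Proof.
move=> /poisson_locally_closedP[[pP Pbr] [f [Pf fP]]].
have idP : ideal P by case: pP.
have [M [pM PM Mf Mp]] := nullstellensatz fgA (krull_dim_chain dimA) pP Pf.
exists M; split=> //; first exact: maximal_of_points.
have cP : subideal (core br M) P.
  apply: fP; [exact: core_prime | exact: (core_largest (conj idP Pbr)) | by move=> /core_sub].
by move=> I pI IM x /(core_largest pI IM)/cP.
Qed.

(** If [c / d] is central, the quotient rule gives [{c, z} d = c {d, z}]: bracketing numerator and
    denominator with [z] represents the same fraction again. *)
Lemma central_fraction_br P a b d c z : prime_ideal P -> (forall x y, P x -> P (br x y)) ->
  ~ P b -> frac_poisson_central br P a b -> P (d * a - c * b) ->
  P (br d z * a - br c z * b).
Proof.
move=> pP Pbr Pb cen Pdc; have [idP P1 PM] := pP.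
have := cen z 1 P1; rewrite /frac_br_num !(br1r hbr) !mul0r !mulr1 subr0 addr0 => Pz.
suff : P ((br d z * a - br c z * b) * b) by case/PM.
have -> : (br d z * a - br c z * b) * b = br (d * a - c * b) z * b
    - d * (br a z * b - br b z * a) - br b z * (d * a - c * b).
  by rewrite (brBl hbr) !(brMl hbr); ring.
have [_ _ PMl] := idP; apply: idealB => //; last exact: PMl.
by apply: idealB => //; [apply: idealMr => //; apply: Pbr | apply: PMl].
Qed.

(** The ideal [D] of denominators of [a / b] modulo [P] is Poisson and contains [b], so it is not
    inside [M], and the fraction has a value [l] at [M]. The fraction minus [l] is again central, so
    its multiples in the local ring at [M] give a Poisson ideal inside [M]. This ideal lies in [P],
    and [a / b = l]. *)
Lemma primitive_rational P : poisson_primitive br P -> poisson_rational br P.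
Proof.
move=> [M [maxM Ppi PM maxP]].
have pM := maximal_prime maxM; have [idM M1 MM] := pM.
have MP := maximal_points fgA dimA maxM.
have PcM x : P x <-> core br M x.
  split; first exact: core_largest.
  by apply: maxP; [exact: core_poisson | exact: core_sub].
have [[_ c1 cM] cbr] := core_prime hbr pM.
have [idP Pbr] := Ppi.
have pP : prime_ideal P.
  split=> //; first by move/PcM.
  by move=> x y /PcM/cM[] /PcM; [left|right].
have [_ _ PMul] := pP; have [P0 PD PMl] := idP.
split=> // a b Pb cen.
pose D d := exists c, P (d * a - c * b).
have D_pi : poisson_ideal br D.
  split; first split.
  - by exists 0; rewrite !mul0r subrr.
  - by move=> x y [c Pc] [c' Pc']; exists (c + c'); rewrite !mulrDl opprD addrACA; apply: PD.
  - by move=> e x [c Pc]; exists (e * c); rewrite -!mulrA -mulrBr; apply: PMl.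
  - by move=> x z [c Pc]; exists (br c z); apply: central_fraction_br.
have [d [c Pdc] Md] : exists2 d, D d & ~ M d.
  apply: contrapT => no; apply: Pb; apply: (maxP D) => //.
    by move=> x Dx; apply: contrapT => Mx; apply: no; exists x.
  by exists a; rewrite [b * a]mulrC subrr.
have [l Ml] : exists l : K, M (c - l *: d).
  have [l1 Ml1] := MP c; have [l2 Ml2] := MP d.
  have l20 : l2 != 0.
    by apply/eqP => l20; apply: Md; rewrite l20 scale0r subr0 in Ml2.
  exists (l1 / l2).
  have -> : c - (l1 / l2) *: d = (c - l1%:A) - (l1 / l2) *: (d - l2%:A).
    by rewrite scalerBr scalerA divfK // opprB addrA subrK.
  by apply: idealB => //; apply: idealZ.
set c' := c - l *: d in Ml.
have [L LE] : exists L : A, forall y, l *: y = y * L.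
  by exists l%:A => y; rewrite mulr_algr.
have Pdcz z : P (br d z * c' - d * br c' z).
  suff : P ((br d z * c' - d * br c' z) * b) by case/PMul.
  have -> : (br d z * c' - d * br c' z) * b =
      d * (br d z * a - br c z * b) - br d z * (d * a - c * b).
    by rewrite /c' (brBl hbr) (brZl hbr) !LE; ring.
  by apply: idealB => //; apply: PMl => //; apply: central_fraction_br.
(* The preimage in [A] of the ideal generated by [c'] in the localization of [A / P] at [M]. It is
   Poisson since [c' / d] is central and [d] is a unit there. *)
pose J x := exists s y, ~ M s /\ P (s * x - c' * y).
have MsM s t : ~ M s -> ~ M t -> ~ M (s * t) by move=> ? ? /MM[].
have J_pi : poisson_ideal br J.
  split; first split.
  - by exists 1, 0; rewrite !mulr0 subrr.
  - move=> x y [s [u [Ms Pu]]] [t [v [Mt Pv]]]; exists (s * t), (u * t + v * s).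
    split; first exact: MsM.
    have -> : s * t * (x + y) - c' * (u * t + v * s) =
      (s * x - c' * u) * t + (t * y - c' * v) * s by ring.
    by apply: PD; apply: idealMr.
  - move=> e x [s [u [Ms Pu]]]; exists s, (e * u); split=> //.
    have -> : s * (e * x) - c' * (e * u) = e * (s * x - c' * u) by ring.
    exact: PMl.
  - move=> x z [s [y [Ms Py]]].
    exists (s * s * d), (s * d * br y z + s * y * br d z - d * br s z * y).
    split; first by apply: (MsM) => //; apply: MsM.
    have -> : s * s * d * br x z - c' * (s * d * br y z + s * y * br d z - d * br s z * y) =
        s * d * br (s * x - c' * y) z - d * br s z * (s * x - c' * y)
        - s * y * (br d z * c' - d * br c' z).
      by rewrite (brBl hbr) !(brMl hbr); ring.
    by apply: idealB => //; [apply: idealB => // |]; apply: PMl => //; apply: Pbr.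
have JM : subideal J M.
  move=> x [s [y [Ms /PM Msy]]].
  suff /MM[] : M (s * x) by [].
  by apply: ideal_subr Msy _ => //; apply: idealMr.
have Pc' : P c'.
  by apply: (maxP _ J_pi JM); exists 1, 1; rewrite mul1r mulr1 subrr.
have Pab : P (a - l *: b).
  suff /PMul[/PM//|//] : P (d * (a - l *: b)).
  have -> : d * (a - l *: b) = (d * a - c * b) + b * c' by rewrite /c' !LE; ring.
  by apply: PD => //; apply: PMl.
exists ('X - l%:P); split; first by rewrite polyXsubC_eq0.
rewrite /frac_poly_eval_num size_XsubC !big_ord_recl big_ord0 /= !coefB !coefX !coefC /=.
rewrite addr0 sub0r subr0 scaleNr scale1r expr0 mul1r !expr1 mulr1.
by rewrite addrC.
Qed.

End Primitive.

Import generic_quotient.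

(** * Fraction fields, derivations and traces *)

Lemma tofracP (D : idomainType) (x : {fraction D}) :
  exists a b, FracField.tofrac b != 0 /\ x = FracField.tofrac a / FracField.tofrac b.
Proof.
have [a [b [b0 xb]]] : exists a b : D, b != 0 /\ x * FracField.tofrac b = FracField.tofrac a.
  elim/quotW: x => [[[n d] /= d0]]; exists n, d; split=> //.
  unlock FracField.tofrac; rewrite -[LHS]FracField.pi_mul; apply/eqP.
  rewrite FracField.equivf_def /FracField.mulf /= !numden_Ratio ?oner_neq0 ?mulf_neq0 ?oner_neq0 //=.
  by rewrite !mulr1 mulrC.
exists a, b; rewrite tofrac_eq0 -xb mulfK ?tofrac_eq0 //.
Qed.

Section ResidueField.
Variables (K : comNzRingType) (A : comAlgType K).

(** Bundling the proof of primality lets the structures of the quotient ring be inferred from [Q]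
    alone. *)
Record prime_set := PrimeSet { pset : A -> Prop; psetP : prime_ideal pset }.

Definition prime_pred (Q : prime_set) : {pred A} := fun x => `[< pset Q x >].

Lemma prime_pred_idealr Q : idealr_closed (prime_pred Q).
Proof.
have [[Q0 QD QM] Q1 _] := psetP Q; split; first exact/asboolP.
  by apply/asboolP.
move=> a x y /asboolP Qx /asboolP Qy; apply/asboolP.
by apply: QD => //; apply: QM.
Qed.

Lemma prime_pred_prime Q : prime_idealr_closed (prime_pred Q).
Proof.
have [_ _ QM] := psetP Q; move=> x y /asboolP/QM[]/asboolP Qx.
  by apply/orP; left.
by apply/orP; right.
Qed.

HB.instance Definition _ Q := isIdealr.Build A (prime_pred Q) (@prime_pred_idealr Q).
HB.instance Definition _ Q :=
  isPrimeIdealrClosed.Build A (prime_pred Q) (@prime_pred_prime Q).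

Definition residue_ring (Q : prime_set) := {ideal_quot (prime_pred Q)}.

HB.instance Definition _ Q := GRing.ComNzRing.on (residue_ring Q).

Definition residue_unit Q : {pred residue_ring Q} := fun x => `[< exists y, y * x = 1 >].
Definition residue_inv Q (x : residue_ring Q) :=
  if pselect (exists y, y * x = 1) is left e then projT1 (cid e) else x.

Lemma residue_mulVx Q : {in @residue_unit Q, left_inverse 1 (@residue_inv Q) *%R}.
Proof.
move=> x /asboolP ux; rewrite /residue_inv; case: pselect => // e.
by case: cid.
Qed.

Lemma residue_unitPl Q (x y : residue_ring Q) : y * x = 1 -> residue_unit x.
Proof. by move=> yx; apply/asboolP; exists y. Qed.

Lemma residue_invr_out Q : {in [predC @residue_unit Q], @residue_inv Q =1 id}.
Proof.
by move=> x /negP nux; rewrite /residue_inv; case: pselect => // e; case: nux; apply/asboolP.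
Qed.

HB.instance Definition _ Q := GRing.ComNzRing_hasMulInverse.Build (residue_ring Q)
  (@residue_mulVx Q) (@residue_unitPl Q) (@residue_invr_out Q).
HB.instance Definition _ Q := GRing.ComUnitRing_isIntegral.Build (residue_ring Q)
  (@Quotient.rquot_IdomainAxiom _ (prime_pred Q)).

(** Of [Frac (A / P)] only the kernel of [psi] and the representation by fractions will be used. The
    case [P = 0] gives [Frac A]. *)
Lemma residue_field (P : A -> Prop) : prime_ideal P ->
  exists (L : fieldType) (psi : {rmorphism A -> L}), (forall a, psi a = 0 <-> P a) /\
    forall z, exists a b, psi b != 0 /\ z = psi a / psi b.
Proof.
move=> pP; pose Q := PrimeSet pP.
pose piQ : {rmorphism A -> residue_ring Q} := \pi_(residue_ring Q)%qT.
pose psi : {rmorphism A -> {fraction residue_ring Q}} :=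
  @FracField.tofrac (residue_ring Q) \o piQ.
have piE a : (piQ a == 0) = `[< P a >].
  by rewrite -[0](rmorph0 piQ) -Quotient.idealrBE subr0.
exists _, psi; split=> [a|z].
  rewrite /psi /=; split=> [/eqP|Pa].
    by rewrite tofrac_eq0 piE => /asboolP.
  by apply/eqP; rewrite tofrac_eq0 piE; apply/asboolP.
have [a [b [b0 ->]]] := tofracP z.
exists (repr a), (repr b).
have piK (c : residue_ring Q) : piQ (repr c) = c by exact: reprK.
by rewrite /psi /= !piK.
Qed.

End ResidueField.

Lemma mk_rmorphism (R S : nzRingType) (f : R -> S) :
  (forall x y, f (x - y) = f x - f y) -> f 1 = 1 -> (forall x y, f (x * y) = f x * f y) ->
  exists g : {rmorphism R -> S}, forall x, g x = f x.
Proof.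
move=> fB f1 fM.
pose m1 := GRing.isZmodMorphism.Build R S f fB.
pose m2 := GRing.isMonoidMorphism.Build R S f (conj f1 fM).
pose g : {rmorphism R -> S} := HB.pack f m1 m2.
by exists g.
Qed.

Definition fraction_map (D : comNzRingType) (L : fieldType) (psi : D -> L) :=
  forall z, exists a b, psi b != 0 /\ z = psi a / psi b.

Lemma fraction_map_tofrac (D : idomainType) : fraction_map (@FracField.tofrac D).
Proof. exact: tofracP. Qed.

Definition derivation_along (D L : comNzRingType) (psi d : D -> L) :=
  (forall x y, d (x + y) = d x + d y) /\ (forall x y, d (x * y) = d x * psi y + psi x * d y).

Notation derivation d := (derivation_along idfun d).

Section Derivation.
Variables (D L : comNzRingType) (psi : {rmorphism D -> L}) (d : D -> L).
Hypothesis dP : derivation_along psi d.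

Lemma derD x y : d (x + y) = d x + d y. Proof. exact: dP.1. Qed.
Lemma derM x y : d (x * y) = d x * psi y + psi x * d y. Proof. exact: dP.2. Qed.
Lemma der0 : d 0 = 0. Proof. by apply: (addrI (d 0)); rewrite -derD !addr0. Qed.
Lemma derN x : d (- x) = - d x.
Proof. by apply: (addrI (d x)); rewrite -derD !subrr der0. Qed.
Lemma derB x y : d (x - y) = d x - d y. Proof. by rewrite derD derN. Qed.
Lemma der1 : d 1 = 0.
Proof.
have := derM 1 1; rewrite mulr1 rmorph1 mulr1 mul1r => H.
by apply: (addrI (d 1)); rewrite addr0 -H.
Qed.
Lemma der_sum (I : Type) (r : seq I) (p : pred I) (F : I -> D) :
  d (\sum_(i <- r | p i) F i) = \sum_(i <- r | p i) d (F i).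
Proof. by elim/big_rec2: _ => [|i x y _ <-]; rewrite ?der0 ?derD. Qed.

End Derivation.

Section FieldDerivation.
Variables (D : comNzRingType) (F L : fieldType).

Lemma derV (psi : {rmorphism F -> L}) (d : F -> L) x : derivation_along psi d ->
  d x^-1 = - d x / psi x ^+ 2.
Proof.
move=> dP; have [->|x0] := eqVneq x 0; first by rewrite invr0 (der0 dP) oppr0 mul0r.
have px0 : psi x != 0 by rewrite fmorph_eq0.
have := derM dP x x^-1; rewrite divff // (der1 dP) fmorphV => /esym/eqP.
rewrite addrC addr_eq0 => /eqP H; apply: (mulfI px0); rewrite H.
by field.
Qed.

Lemma der_fraction (psi : {rmorphism F -> L}) (d : F -> L) x y : derivation_along psi d ->
  y != 0 -> d (x / y) = (d x * psi y - psi x * d y) / psi y ^+ 2.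
Proof.
move=> dP y0; rewrite (derM dP) (derV _ dP) fmorphV.
by field; rewrite fmorph_eq0.
Qed.

Lemma der_eq_fraction (psi : {rmorphism D -> F}) (chi : {rmorphism F -> L}) (d d' : F -> L) :
  fraction_map psi -> derivation_along chi d -> derivation_along chi d' ->
  (forall a, d (psi a) = d' (psi a)) -> forall z, d z = d' z.
Proof.
move=> psiP dP d'P dd' z; have [a [b [b0 ->]]] := psiP z.
by rewrite (der_fraction _ dP) // (der_fraction _ d'P) // !dd'.
Qed.

Lemma der_fraction_lift (psi : {rmorphism D -> F}) (d : D -> F) :
  fraction_map psi -> derivation_along psi d -> (forall a, psi a = 0 -> d a = 0) ->
  exists d' : F -> F, derivation d' /\ forall a, d' (psi a) = d a.
Proof.
move=> psiP dP d0.
have /choice[nd ndP] : forall z, exists ab : D * D, psi ab.2 != 0 /\ z = psi ab.1 / psi ab.2.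
  by move=> z; have [a [b ab]] := psiP z; exists (a, b).
pose d' z := (d (nd z).1 * psi (nd z).2 - psi (nd z).1 * d (nd z).2) / psi (nd z).2 ^+ 2.
have d'E a b : psi b != 0 -> d' (psi a / psi b) = (d a * psi b - psi a * d b) / psi b ^+ 2.
  move=> b0; rewrite /d'; have [] := ndP (psi a / psi b); move: (nd _) => [a' b'] /= b'0 E.
  have E1 : psi a * psi b' = psi a' * psi b.
    by apply: (mulIf (invr_neq0 b0)); rewrite mulrAC E; field; rewrite b0.
  have : d (a * b' - a' * b) = 0 by apply: d0; rewrite rmorphB !rmorphM /= E1 subrr.
  rewrite (derB dP) !(derM dP) => /eqP; rewrite subr_eq0 => /eqP E2.
  apply/eqP; rewrite eqr_div ?expf_neq0 //; apply/eqP.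
  have -> : (d a' * psi b' - psi a' * d b') * psi b ^+ 2 =
     psi b * psi b' * (d a' * psi b + psi a' * d b) - psi b' * d b * (psi a' * psi b)
     - psi b * d b' * (psi a' * psi b) by ring.
  by rewrite -E1 -E2; ring.
have d'psi a : d' (psi a) = d a.
  have := d'E a 1; rewrite rmorph1 divr1 oner_neq0 => ->//.
  by rewrite (der1 dP) mulr0 subr0 mulr1 expr1n divr1.
exists d'; split=> //; split=> x y; have [a [b [b0 ->]]] := psiP x; have [a' [b' [b'0 ->]]] := psiP y.
  have -> : psi a / psi b + psi a' / psi b' = psi (a * b' + a' * b) / psi (b * b').
    by rewrite rmorphD !rmorphM /=; field; rewrite b0 b'0.
  rewrite !d'E ?rmorphM ?mulf_neq0 //= (derD dP) !(derM dP) ?rmorphD ?rmorphM /=.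
  by field; rewrite b0 b'0.
have -> : psi a / psi b * (psi a' / psi b') = psi (a * a') / psi (b * b').
  by rewrite !rmorphM /=; field; rewrite b0 b'0.
rewrite !d'E ?rmorphM ?mulf_neq0 //= !(derM dP) /=.
by field; rewrite b0 b'0.
Qed.

Lemma fraction_lift (psi : {rmorphism D -> F}) (chi : {rmorphism D -> L}) :
  fraction_map psi -> (forall a, psi a = 0 <-> chi a = 0) ->
  exists chi' : {rmorphism F -> L}, forall a, chi' (psi a) = chi a.
Proof.
move=> psiP ker.
have ker0 a : psi a != 0 -> chi a != 0.
  by move=> /eqP a0; apply/eqP => /ker.
have /choice[nd ndP] : forall z, exists ab : D * D, psi ab.2 != 0 /\ z = psi ab.1 / psi ab.2.
  by move=> z; have [a [b ab]] := psiP z; exists (a, b).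
pose f z := chi (nd z).1 / chi (nd z).2.
have fE a b : psi b != 0 -> f (psi a / psi b) = chi a / chi b.
  move=> b0; rewrite /f; have [] := ndP (psi a / psi b); move: (nd _) => [a' b'] /= b'0 E.
  apply/eqP; rewrite eqr_div ?ker0 // -!rmorphM -subr_eq0 -rmorphB; apply/eqP/ker.
  apply/eqP; rewrite rmorphB !rmorphM subr_eq0 /=.
  by rewrite -eqr_div ?b'0 // -E.
have fpsi a : f (psi a) = chi a.
  by have := fE a 1; rewrite !rmorph1 !divr1 oner_neq0 => ->.
have [||| g gE] := @mk_rmorphism F L f.
- move=> x y; have [a [b [b0 ->]]] := psiP x; have [a' [b' [b'0 ->]]] := psiP y.
  have -> : psi a / psi b - psi a' / psi b' = psi (a * b' - a' * b) / psi (b * b').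
    by rewrite rmorphB !rmorphM /=; field; rewrite b0 b'0.
  rewrite !fE ?rmorphM ?mulf_neq0 //= ?rmorphB ?rmorphM /=.
  by field; rewrite !ker0.
- by rewrite -(rmorph1 psi) fpsi rmorph1.
- move=> x y; have [a [b [b0 ->]]] := psiP x; have [a' [b' [b'0 ->]]] := psiP y.
  have -> : psi a / psi b * (psi a' / psi b') = psi (a * a') / psi (b * b').
    by rewrite !rmorphM /=; field; rewrite b0 b'0.
  rewrite !fE ?rmorphM ?mulf_neq0 //= ?rmorphM /=.
  by field; rewrite !ker0.
by exists g => a; rewrite gE fpsi.
Qed.

End FieldDerivation.

Lemma der_eq_poly (B : comNzRingType) (L : comNzRingType) (psi : {rmorphism {poly B} -> L})
    (d d' : {poly B} -> L) : derivation_along psi d -> derivation_along psi d' ->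
  (forall c, d c%:P = d' c%:P) -> d 'X = d' 'X -> forall p, d p = d' p.
Proof.
move=> dP d'P dC dX; elim/poly_ind => [|p c IHp]; first by rewrite (der0 dP) (der0 d'P).
by rewrite (derD dP) (derD d'P) dC (derM dP) (derM d'P) IHp dX.
Qed.

(** A finite extension given by coordinates alone, so that no module structure on [L] has to be
    attached to each embedding [iota]. *)
Record field_basis (k L : fieldType) (iota : {rmorphism k -> L}) := FieldBasis {
  bdim : nat;
  bvec : 'I_bdim -> L;
  bco : L -> 'rV[k]_bdim;
  bcoK : forall z, z = \sum_i iota (bco z 0 i) * bvec i;
  bcoU : forall c : 'rV[k]_bdim, bco (\sum_i iota (c 0 i) * bvec i) = c }.

Section Trace.
Variables (k L : fieldType) (iota : {rmorphism k -> L}) (B : field_basis iota).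
Hypothesis char0 : forall m, m.+1%:R != 0 :> k.
Local Notation n := (bdim B).
Local Notation b := (@bvec _ _ _ B).
Local Notation co := (bco B).
Implicit Types (x y z w : L) (c : k).

Definition lincomb (v : 'rV[k]_n) := \sum_i iota (v 0 i) * b i.

Lemma coK z : lincomb (co z) = z. Proof. exact: esym (bcoK B z). Qed.
Lemma lincombK v : co (lincomb v) = v. Proof. exact: bcoU. Qed.
Lemma lincomb_inj : injective lincomb. Proof. exact: can_inj lincombK. Qed.

Lemma lincombD u v : lincomb (u + v) = lincomb u + lincomb v.
Proof.
by rewrite -big_split; apply: eq_bigr => i _; rewrite mxE rmorphD mulrDl.
Qed.

Lemma lincombZ c v : lincomb (c *: v) = iota c * lincomb v.
Proof.
by rewrite mulr_sumr; apply: eq_bigr => i _; rewrite mxE rmorphM mulrA.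
Qed.

Lemma lincomb0 : lincomb 0 = 0.
Proof. by rewrite -[0](scale0r (0 : 'rV[k]_n)) lincombZ rmorph0 mul0r. Qed.

Lemma coD x y : co (x + y) = co x + co y.
Proof. by apply: lincomb_inj; rewrite lincombD !coK. Qed.

Lemma coZ c x : co (iota c * x) = c *: co x.
Proof. by apply: lincomb_inj; rewrite lincombZ !coK. Qed.

Lemma co0 : co 0 = 0. Proof. by apply: lincomb_inj; rewrite coK lincomb0. Qed.

Lemma co_sum (I : Type) (r : seq I) (p : pred I) (F : I -> L) :
  co (\sum_(i <- r | p i) F i) = \sum_(i <- r | p i) co (F i).
Proof. by elim/big_rec2: _ => [|i x y _ <-]; rewrite ?co0 ?coD. Qed.

Lemma co_b i : co (b i) = delta_mx 0 i.
Proof.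
apply: lincomb_inj; rewrite coK /lincomb (bigD1 i) //= mxE !eqxx rmorph1 mul1r.
rewrite big1 ?addr0 // => j ji.
by rewrite mxE (negPf ji) andbF rmorph0 mul0r.
Qed.

Definition mulm z : 'M[k]_n := \matrix_(i, j) co (b i * z) 0 j.

Lemma mulmE z i : b i * z = \sum_j iota (mulm z i j) * b j.
Proof. by rewrite [LHS](bcoK B); apply: eq_bigr => j _; rewrite mxE. Qed.

Lemma mulmP z (M : 'M[k]_n) : (forall i, b i * z = \sum_j iota (M i j) * b j) -> mulm z = M.
Proof.
move=> MP; apply/matrixP => i j; rewrite mxE MP.
have := bcoU (row i M : 'rV[k]_n); under eq_bigr do rewrite mxE.
by move=> ->; rewrite mxE.
Qed.

Lemma mulmM z w : mulm (z * w) = mulm z *m mulm w.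
Proof.
apply: mulmP => i; rewrite mulrA mulmE mulr_suml.
under eq_bigr do rewrite -mulrA mulmE mulr_sumr.
rewrite exchange_big /=; apply: eq_bigr => j _; rewrite mxE rmorph_sum mulr_suml.
by apply: eq_bigr => l _; rewrite rmorphM mulrA.
Qed.

Lemma mulmD z w : mulm (z + w) = mulm z + mulm w.
Proof. by apply/matrixP => i j; rewrite !mxE mulrDr coD mxE. Qed.

Lemma mulmZ c : mulm (iota c) = c%:M.
Proof.
apply: mulmP => i; rewrite (bigD1 i) //= big1 ?addr0; last first.
  by move=> j ji; rewrite mxE eq_sym (negPf ji) rmorph0 mul0r.
by rewrite mxE eqxx mulr1n mulrC.
Qed.

Definition ftr z := \tr (mulm z).

Lemma ftrD z w : ftr (z + w) = ftr z + ftr w.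
Proof. by rewrite /ftr mulmD mxtraceD. Qed.

Lemma ftrZ c z : ftr (iota c * z) = c * ftr z.
Proof. by rewrite /ftr mulmM mulmZ mul_scalar_mx mxtraceZ. Qed.

Lemma ftr0 : ftr 0 = 0.
Proof. by rewrite -[0 in LHS](mul0r 0) -[in LHS](rmorph0 iota) ftrZ mul0r. Qed.

Lemma ftrN z : ftr (- z) = - ftr z.
Proof. by rewrite -mulN1r -(rmorph1 iota) -rmorphN ftrZ mulN1r. Qed.

Lemma ftr_sum (I : Type) (r : seq I) (p : pred I) (F : I -> L) :
  ftr (\sum_(i <- r | p i) F i) = \sum_(i <- r | p i) ftr (F i).
Proof. by elim/big_rec2: _ => [|i x y _ <-]; rewrite ?ftr0 ?ftrD. Qed.

Lemma ftr_scalar c : ftr (iota c) = c *+ n.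
Proof. by rewrite /ftr mulmZ mxtrace_scalar. Qed.

Lemma bdim_gt0 : (0 < n)%N.
Proof.
case: (posnP n) => // n0; have := bcoK B 1; rewrite big1 => [/eqP|i _].
  by rewrite oner_eq0.
by have := ltn_ord i; rewrite {2}n0.
Qed.

Lemma ftr1_neq0 : ftr 1 != 0.
Proof.
rewrite -(rmorph1 iota) ftr_scalar; have := bdim_gt0.
by case: n => // m _; apply: char0.
Qed.

Lemma ftr_nondegenerate z : (forall w, ftr (z * w) = 0) -> z = 0.
Proof.
move=> z0; apply/eqP; apply: contraT => zn0.
by have /eqP := z0 z^-1; rewrite divff // (negPf ftr1_neq0).
Qed.

Lemma ftr_eq0 z : (forall i, ftr (z * b i) = 0) -> z = 0.
Proof.
move=> zb; apply: ftr_nondegenerate => w; rewrite [w](bcoK B) mulr_sumr ftr_sum big1 // => i _.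
by rewrite mulrCA ftrZ zb mulr0.
Qed.

(** In the basis, the matrix of [D z] is the derivative of the matrix of [z] plus a commutator with
    the matrix [G] of [D], and commutators have trace zero. *)
Lemma derivation_ftr (d : k -> k) (D : L -> L) : derivation d -> derivation D ->
  (forall c, D (iota c) = iota (d c)) -> forall z, ftr (D z) = d (ftr z).
Proof.
move=> dP DP Dd z.
pose G := \matrix_(i, j) co (D (b i)) 0 j : 'M[k]_n.
have GE i : D (b i) = \sum_j iota (G i j) * b j.
  by rewrite [LHS](bcoK B); apply: eq_bigr => j _; rewrite mxE.
have -> : ftr (D z) = \tr (map_mx d (mulm z) + mulm z *m G - G *m mulm z).
  congr (\tr _); apply: mulmP => i.
  have : D (b i * z) = D (\sum_j iota (mulm z i j) * b j) by rewrite mulmE.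
  rewrite (derM DP) /= => /(canRL (addKr _)) ->.
  rewrite (der_sum DP) GE mulr_suml.
  under [in X in _ + X]eq_bigr do rewrite (derM DP) /= Dd GE mulr_sumr.
  under [in X in - X]eq_bigr do rewrite -mulrA mulmE mulr_sumr.
  rewrite big_split /= [in X in - X]exchange_big [X in _ + (_ + X)]exchange_big /=.
  rewrite -sumrN -!big_split /=; apply: eq_bigr => j _.
  rewrite !mxE rmorphB rmorphD /= !rmorph_sum /= mulrBl mulrDl !mulr_suml addrC.
  congr (_ + _ - _); last by apply: eq_bigr => l _; rewrite rmorphM mulrA.
  by apply: eq_bigr => l _; rewrite rmorphM mulrA.
rewrite linearB /= mxtraceD mxtrace_mulC addrK /ftr /mxtrace (der_sum dP).
by apply: eq_bigr => i _; rewrite mxE.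
Qed.

Lemma dual_basis : exists e : 'I_n -> L,
  (forall i j, ftr (e i * b j) = (i == j)%:R) /\
  forall z, z = \sum_j iota (ftr (z * b j)) * e j.
Proof.
pose G := \matrix_(i, j) ftr (b i * b j) : 'M[k]_n.
have Gu : G \in unitmx.
  rewrite -row_free_unit -kermx_eq0; apply/eqP/row_matrixP => i; rewrite row0.
  have : row i (kermx G) *m G = 0 by apply/sub_kermxP/row_sub.
  move: (row _ _) => v vG; apply: lincomb_inj; rewrite lincomb0; apply: ftr_eq0 => j.
  rewrite mulr_suml ftr_sum; transitivity ((v *m G) 0 j); last by rewrite vG mxE.
  by rewrite mxE; apply: eq_bigr => l _; rewrite -mulrA ftrZ mxE.
pose e i := \sum_j iota (invmx G i j) * b j.
have eb i j : ftr (e i * b j) = (i == j)%:R.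
  rewrite mulr_suml ftr_sum; transitivity ((invmx G *m G) i j).
    by rewrite mxE; apply: eq_bigr => l _; rewrite -mulrA ftrZ mxE.
  by rewrite mulVmx // mxE.
exists e; split=> // z; apply/eqP; rewrite -subr_eq0; apply/eqP/ftr_eq0 => i.
rewrite mulrBl ftrD ftrN mulr_suml ftr_sum (bigD1 i) //= big1 ?addr0.
  by rewrite -mulrA ftrZ eb eqxx mulr1 subrr.
by move=> j ji; rewrite -mulrA ftrZ eb (negPf ji) mulr0.
Qed.

(* Any lift of [d] to [L] fails to be a derivation by a symmetric 2-cocycle; the
   Casimir element [\sum_i b i (x) e i] of the trace form makes it a coboundary. *)
Lemma derivation_extend (d : k -> k) : derivation d ->
  exists D : L -> L, derivation D /\ forall c, D (iota c) = iota (d c).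
Proof.
move=> dP; have [e [eb eE]] := dual_basis.
pose D0 z := \sum_i iota (d (co z 0 i)) * b i.
have D0D x y : D0 (x + y) = D0 x + D0 y.
  rewrite -big_split; apply: eq_bigr => i _.
  by rewrite coD mxE (derD dP) rmorphD mulrDl.
have D0Z c y : D0 (iota c * y) = iota (d c) * y + iota c * D0 y.
  rewrite {2}[y](bcoK B) !mulr_sumr -big_split; apply: eq_bigr => i _ /=.
  by rewrite coZ mxE (derM dP) /= rmorphD !rmorphM mulrDl !mulrA.
have D00 : D0 0 = 0 by apply: (addrI (D0 0)); rewrite -D0D !addr0.
pose beta x y := D0 (x * y) - D0 x * y - x * D0 y.
have betaC x y : beta x y = beta y x by rewrite /beta [x * y]mulrC; ring.
have betaD x y z : beta x (y + z) = beta x y + beta x z.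
  by rewrite /beta mulrDr !D0D; ring.
have betaZ x c y : beta x (iota c * y) = iota c * beta x y.
  by rewrite /beta mulrCA !D0Z; ring.
have beta0 x : beta x 0 = 0 by rewrite /beta mulr0 D00; ring.
have beta_sum x (F : 'I_n -> L) : beta x (\sum_i F i) = \sum_i beta x (F i).
  by elim/big_rec2: _ => [|i u v _ <-]; rewrite ?beta0 ?betaD.
have cocycle x y z : x * beta y z - beta (x * y) z + beta x (y * z) - beta x y * z = 0.
  by rewrite /beta !mulrA; ring.
have casimir x y : \sum_i beta x (y * b i) * e i = \sum_i beta x (b i) * e i * y.
  under eq_bigr do rewrite mulrC [y * _]mulrC mulmE beta_sum mulr_sumr.
  rewrite exchange_big /=; apply: eq_bigr => j _.
  rewrite -mulrA [e j * y]eE mulr_sumr; apply: eq_bigr => i _.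
  rewrite betaZ -mulrA [y * b i]mulrC mulmE mulr_sumr ftr_sum (bigD1 j) //= big1 ?addr0.
    by rewrite [e j * _]mulrCA ftrZ eb eqxx mulr1; ring.
  by move=> l lj; rewrite mulrCA ftrZ eb eq_sym (negPf lj) mulr0.
have sum1 : \sum_i b i * e i = 1.
  apply/eqP; rewrite -subr_eq0; apply/eqP/ftr_nondegenerate => w.
  rewrite mulrBl mul1r ftrD ftrN mulr_suml ftr_sum; apply/eqP; rewrite subr_eq0; apply/eqP.
  apply: eq_bigr => i _; rewrite mulrAC mulmE mulr_suml ftr_sum (bigD1 i) //= big1 ?addr0.
    by rewrite -mulrA ftrZ [b i * _]mulrC eb eqxx mulr1.
  by move=> j ji; rewrite -mulrA ftrZ [b j * _]mulrC eb eq_sym (negPf ji) mulr0.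
pose nu x := \sum_i beta x (b i) * e i.
have nuD x y : nu (x + y) = nu x + nu y.
  by rewrite -big_split; apply: eq_bigr => i _; rewrite betaC betaD !(betaC (b i)) mulrDl.
have nuZ c x : nu (iota c * x) = iota c * nu x.
  by rewrite mulr_sumr; apply: eq_bigr => i _; rewrite betaC betaZ (betaC _ x) mulrA.
have nuM x y : nu (x * y) = x * nu y + nu x * y - beta x y.
  rewrite /nu mulr_sumr mulr_suml -casimir -[beta x y]mulr1 -sum1 mulr_sumr -sumrN -!big_split /=.
  apply: eq_bigr => i _.
  have -> : beta (x * y) (b i) = x * beta y (b i) + beta x (y * b i) - beta x y * b i.
    apply/eqP; rewrite eq_sym -subr_eq0; apply/eqP; rewrite -[RHS](cocycle x y (b i)).
    by ring.
  by ring.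
pose D x := D0 x + nu x.
have DM x y : D (x * y) = D x * y + x * D y by rewrite /D nuM /beta; ring.
have D1 : D 1 = 0.
  have := DM 1 1; rewrite !mulr1 mul1r => H.
  by apply: (addrI (D 1)); rewrite addr0 -H.
exists D; split; first by split=> // x y; rewrite /D D0D nuD addrACA.
move=> c; rewrite -[iota c in LHS]mulr1 /D D0Z nuZ -addrA -mulrDr -/(D 1) D1.
by rewrite mulr1 mulr0 addr0.
Qed.

End Trace.

Section Span.
Variables (k L : fieldType) (iota : {rmorphism k -> L}).

Inductive span (w : seq L) : L -> Prop :=
| span0 : span w 0
| spanD c x z : x \in w -> span w z -> span w (iota c * x + z).

Lemma span_add w x y : span w x -> span w y -> span w (x + y).
Proof.
by elim=> [|c u z uw _ IH] wy; rewrite ?add0r // -addrA; apply: spanD => //; apply: IH.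
Qed.

Lemma span_scale w c x : span w x -> span w (iota c * x).
Proof.
elim=> [|d u z uw _ IH]; first by rewrite mulr0; apply: span0.
by rewrite mulrDr mulrA -rmorphM; apply: spanD.
Qed.

Lemma span_mem w x : x \in w -> span w x.
Proof. by move=> xw; rewrite -[x]addr0 -[x]mul1r -(rmorph1 iota); apply/spanD/span0. Qed.

Lemma span_sum w (I : Type) (r : seq I) (F : I -> L) :
  (forall i, span w (F i)) -> span w (\sum_(i <- r) F i).
Proof. by move=> wF; elim/big_ind: _ => // [|x y]; [apply: span0 | apply: span_add]. Qed.

Lemma span_coord w z : span w z ->
  exists c : 'I_(size w) -> k, z = \sum_i iota (c i) * w`_i.
Proof.
elim=> [|c x u xw _ [d ->]].
  by exists (fun=> 0); rewrite big1 // => i _; rewrite rmorph0 mul0r.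
have lt : (index x w < size w)%N by rewrite index_mem.
exists (fun i => (i == Ordinal lt)%:R * c + d i).
under [RHS]eq_bigr do rewrite rmorphD mulrDl.
rewrite big_split /=; congr (_ + _); rewrite (bigD1 (Ordinal lt)) //= eqxx mul1r nth_index //.
by rewrite big1 ?addr0 // => i /negPf->; rewrite mul0r rmorph0 mul0r.
Qed.

End Span.

Section FiniteBasis.
Variables (K : comNzRingType) (A : comAlgType K) (k L : fieldType).
Variables (iota : {rmorphism k -> L}) (psi : {rmorphism A -> L}).
Hypotheses (fgA : finitely_generated A) (fracA : fraction_map psi).
Hypothesis scalars : forall c : K, exists c', psi c%:A = iota c'.
Hypothesis algA : forall a, exists p : {poly k}, p != 0 /\ root (map_poly iota p) (psi a).
Local Notation sp w := (span iota (map psi w)).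

(** The relation [relb] reduces high powers of [b], so the products of [w] with the powers up to [d]
    again span a ring. *)
Lemma span_adjoin (w : seq A) b : 1 \in w -> (forall x y, sp w x -> sp w y -> sp w (x * y)) ->
  exists w' : seq A, [/\ 1 \in w', forall x y, sp w' x -> sp w' y -> sp w' (x * y),
    sp w' (psi b) & forall x, sp w x -> sp w' x].
Proof.
move=> w1 wM; have [p [p0 pb]] := algA b.
have [d sd] : exists d, size p = d.+2.
  case sp: (size p) => [|[|d]]; last by exists d.
    by move/eqP: sp; rewrite size_poly_eq0 (negPf p0).
  have E : p = (p`_0)%:P by apply: size1_polyC; rewrite sp.
  by move: pb p0; rewrite E map_polyC rootC polyC_eq0 fmorph_eq0 => ->.
have relb : psi b ^+ d.+1 = \sum_(i < d.+1) iota (- p`_i / lead_coef p) * psi b ^+ i.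
  have l0 : iota (lead_coef p) != 0 by rewrite fmorph_eq0 lead_coef_eq0.
  have := pb; rewrite /root (@horner_coef_wide _ d.+2) ?size_map_poly ?sd //.
  rewrite big_ord_recr /= coef_map /= addr_eq0 => /eqP E.
  apply: (mulfI l0); rewrite {1}/lead_coef sd /=.
  apply: (can_inj opprK); rewrite -E mulr_sumr -sumrN; apply: eq_bigr => i _.
  by rewrite coef_map rmorphM rmorphN fmorphV mulrA [iota _ * (_ / _)]mulrC divfK // mulNr opprK.
pose w' := [seq a * b ^+ j | a <- w, j <- seq.iota 0 d.+1].
have memw' a j : a \in w -> sp w' (psi a * psi b ^+ j).
  move=> aw; elim/ltn_ind: j => j IH; have [jd|dj] := ltnP j d.+1.
    apply: span_mem; rewrite -rmorphXn -rmorphM; apply: map_f.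
    by apply: allpairs_f => //; rewrite mem_iota.
  rewrite -(subnK dj) exprD relb mulr_sumr mulr_sumr; apply: span_sum => i.
  rewrite [X in psi a * X]mulrCA [psi a * _]mulrCA -exprD; apply: span_scale; apply: IH.
  by rewrite -[X in (_ < X)%N](subnK dj) ltn_add2l.
have mulw' z j : sp w z -> sp w' (z * psi b ^+ j).
  elim=> [|c x u /mapP[a aw ->] _ IH]; first by rewrite mul0r; apply: span0.
  by rewrite mulrDl -mulrA; apply: span_add => //; apply/span_scale/memw'.
exists w'; split.
- by apply/allpairsP; exists (1, 0%N); rewrite /= expr0 mulr1.
- move=> x y wx wy; elim: wx => [|c _ u /mapP[_ /allpairsP[[a j] /= [aw _ ->]] ->] _ IH].
    by rewrite mul0r; apply: span0.
  rewrite mulrDl; apply: span_add => //; rewrite -mulrA; apply: span_scale.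
  elim: wy => [|c' _ v /mapP[_ /allpairsP[[a' j'] /= [aw' _ ->]] ->] _ IH'].
    by rewrite mulr0; apply: span0.
  rewrite mulrDr; apply: span_add => //; rewrite mulrCA; apply: span_scale.
  have -> : psi (a * b ^+ j) * psi (a' * b ^+ j') = psi a * psi a' * psi b ^+ (j + j').
    by rewrite !rmorphM !rmorphXn exprD /=; ring.
  by apply: mulw'; apply: wM; apply: span_mem; apply: map_f.
- have := memw' 1 1%N w1; by rewrite rmorph1 mul1r.
- by move=> x /(mulw' x 0%N); rewrite expr0 mulr1.
Qed.

Lemma inverse_poly a : psi a != 0 -> exists p : {poly k}, psi a * (map_poly iota p).[psi a] = 1.
Proof.
move=> a0; have [p [p0 pa]] := algA a; elim/poly_ind: p p0 pa => [|p c IHp]; first by rewrite eqxx.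
have [->|c0] := eqVneq c 0.
  rewrite addr0 mulf_eq0 polyX_eq0 orbF rmorphM /= map_polyX rootM rootX (negPf a0) orbF.
  exact: IHp.
move=> _; rewrite /root rmorphD rmorphM /= map_polyX map_polyC hornerD hornerMX hornerC /=.
rewrite addr_eq0 => /eqP E; exists (- c^-1 *: p).
rewrite linearZ /= hornerZ mulrCA [psi a * _]mulrC E rmorphN fmorphV mulNr mulrN opprK.
by rewrite mulVf // fmorph_eq0.
Qed.

(** The ring generated by [A] over [k] is finite over [k], and the inverse of an element of [A] is a
    polynomial in it, so this ring already contains all fractions. *)
Lemma spanning_seq : exists2 w : seq A, 1 \in w & forall z, sp w z.
Proof.
have [s gens] := fgA.
have [w [w1 wM ws]] : exists w : seq A, [/\ 1 \in w,
    forall x y, sp w x -> sp w y -> sp w (x * y) & forall x, x \in s -> sp w (psi x)].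
  elim: s {gens} => [|b s [w [w1 wM ws]]].
    exists [:: 1]; split; [by rewrite inE | move=> x y | by []].
    have sp1 z : sp [:: 1] z -> exists c', z = iota c'.
      elim=> [|c' v z']; first by exists 0; rewrite rmorph0.
      by rewrite /= inE rmorph1 => /eqP-> _ [e ->]; exists (c' + e); rewrite rmorphD mulr1.
    move=> /sp1[c ->] /sp1[c' ->]; rewrite -[_ * _]mulr1 -rmorphM; apply: span_scale.
    by apply: span_mem; rewrite /= rmorph1 inE.
  have [w' [w'1 w'M w'b ww']] := span_adjoin b w1 wM.
  exists w'; split=> // x; rewrite inE => /predU1P[->//|/ws/ww'//].
have wA a : sp w (psi a).
  apply: (gens (fun a => sp w (psi a))) => //.
  - by apply: span_mem; rewrite map_f.
  - by move=> x y; rewrite rmorphD; apply: span_add.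
  - by move=> x y; rewrite rmorphM; apply: wM.
  - move=> c x wx; rewrite -mulr_algl rmorphM /=; have [c' ->] := scalars c.
    exact: span_scale.
exists w => // z; have [a [b [b0 ->]]] := fracA z.
apply: wM => //; have [p pb] := inverse_poly b0.
have -> : (psi b)^-1 = (map_poly iota p).[psi b].
  by apply: (mulfI b0); rewrite pb mulfV.
rewrite horner_coef; apply: span_sum => i; rewrite coef_map -rmorphXn.
exact: span_scale.
Qed.

(** The basis is taken inside [A], where the functionals to be represented are defined, and 1 is
    among its elements. *)
Lemma finite_basis : exists (B : field_basis iota) (y : 'I_(bdim B) -> A),
  (exists i0, y i0 = 1) /\ forall i, bvec i = psi (y i).
Proof.
(* The coefficient of 1 is kept apart from [w], so that a family of minimal size yields a basis
   containing 1. *)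
pose spans n (w : 'I_n -> A) := forall z, exists c0 (c : 'I_n -> k),
  z = iota c0 + \sum_i iota (c i) * psi (w i).
have : exists n, `[< exists w : 'I_n -> A, spans n w >].
  have [w w1 wP] := spanning_seq; exists (size w); apply/asboolP.
  exists (fun i => w`_i) => z; have [c ->] := span_coord (wP z).
  have sz : size (map psi w) = size w by rewrite size_map.
  exists 0, (fun i => c (cast_ord (esym sz) i)); rewrite rmorph0 add0r.
  rewrite (reindex (cast_ord (esym sz))) /=; last first.
    by exists (cast_ord sz) => i _; rewrite ?cast_ordK ?cast_ordKV.
  by apply: eq_bigr => i _; rewrite (nth_map 0).
move=> /ex_minnP[n /asboolP[w wP] nmin].
have indep c0 (c : 'I_n -> k) : iota c0 + \sum_i iota (c i) * psi (w i) = 0 ->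
    c0 = 0 /\ forall i, c i = 0.
  move=> rel; have c_0 i : c i = 0.
    apply/eqP; apply: contraT => ci0; have i0 : iota (c i) != 0 by rewrite fmorph_eq0.
    case: n w wP nmin c rel i ci0 i0 => [|n] w wP nmin c rel i ci0 i0; first by case: i {ci0 i0}.
    suff /nmin : `[< exists w : 'I_n -> A, spans n w >] by rewrite ltnn.
    apply/asboolP; exists (w \o lift i) => z; have [e0 [e ->]] := wP z.
    exists (e0 - e i / c i * c0), (fun j => e (lift i j) - e i / c i * c (lift i j)).
    move: rel; rewrite !(bigD1_ord i) //= => rel.
    have wi : psi (w i) = - (iota c0 + \sum_(j < n) iota (c (lift i j)) * psi (w (lift i j))) / iota (c i).
      apply: (mulIf i0); rewrite divfK //; apply/eqP; rewrite -subr_eq0 opprK; apply/eqP.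
      by rewrite -[RHS]rel; ring.
    rewrite wi; under [in RHS]eq_bigr do rewrite rmorphB mulrBl !rmorphM -!mulrA.
    rewrite sumrB /= -!mulr_sumr rmorphB !rmorphM fmorphV /=.
    by field.
  split=> //; move: rel; rewrite big1 ?addr0 => [/eqP|i _]; last by rewrite c_0 rmorph0 mul0r.
  by rewrite fmorph_eq0 => /eqP.
have [c0 c0P] := choice wP; have [c cP] := choice c0P.
pose b (i : 'I_n.+1) := if unlift ord0 i is Some j then w j else 1.
have bE (v : 'rV[k]_n.+1) : \sum_i iota (v 0 i) * psi (b i) =
    iota (v 0 ord0) + \sum_i iota (v 0 (lift ord0 i)) * psi (w i).
  rewrite big_ord_recl /b unlift_none rmorph1 mulr1; congr (_ + _).
  by apply: eq_bigr => i _; rewrite liftK.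
pose co z : 'rV[k]_n.+1 := \row_i if unlift ord0 i is Some j then c z j else c0 z.
have coK' z : z = \sum_i iota (co z 0 i) * psi (b i).
  rewrite bE {1}[z]cP !mxE unlift_none; congr (_ + _).
  by apply: eq_bigr => i _; rewrite !mxE liftK.
have coU (v : 'rV[k]_n.+1) : co (\sum_i iota (v 0 i) * psi (b i)) = v.
  apply/eqP; rewrite -subr_eq0; set z := \sum_i _; set u := co z - v.
  have : \sum_i iota (u 0 i) * psi (b i) = 0.
    rewrite -[RHS](subrr z) {1}[z]coK' /z -sumrB; apply: eq_bigr => i _.
    by rewrite !mxE rmorphB mulrBl.
  rewrite bE => /indep[u0 uP]; apply/eqP/rowP => i; rewrite [RHS]mxE.
  by case: (unliftP ord0 i) => [j|] ->.
exists (FieldBasis coK' coU), b; split=> //; exists ord0; by rewrite /b unlift_none.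
Qed.

End FiniteBasis.

(** * Total degree and integrality *)

Section TotalDegree.
Variable K : fieldType.
Local Notation T := {poly {poly K}}.
Implicit Types (p q : T).

(* [homog] is the substitution X1 := Y, X2 := C Y (Y the outer variable), so that
   the degree in Y is the total degree. *)
Definition homog : {rmorphism T -> T} := evalp (map_poly polyC) ('X%:P * 'X).

Lemma homog_coef p n j : (homog p)`_n`_j = if (j <= n)%N then p`_j`_(n - j) else 0.
Proof.
rewrite /= (evalp_sum _ _ (leqnn _)) !coef_sum.
have E (i : 'I_(size p)) : (map_poly polyC p`_i * ('X%:P * 'X) ^+ i : T)`_n`_j =
    if (i == j :> nat) && (j <= n)%N then p`_j`_(n - j) else 0.
  rewrite exprMn -rmorphXn mulrA coefMXn; case: ltnP => [ni|ni].
    by rewrite coef0; have [<-|_] := eqVneq (i : nat) j; rewrite ?(leqNgt i n) ?ni.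
  rewrite coefMC coef_map coefCM coefXn [j == i :> nat]eq_sym.
  by have [<-|_] := eqVneq (i : nat) j; rewrite ?ni ?mulr1 ?mulr0.
rewrite (eq_bigr _ (fun i _ => E i)).
have [jn|_] := leqP j n; last by rewrite big1 // => i _; rewrite andbF.
have [jp|pj] := ltnP j (size p); last first.
  rewrite big1 => [|i _]; first by rewrite (nth_default 0 pj) coef0.
  by rewrite (ltn_eqF (leq_trans (ltn_ord i) pj)).
rewrite (bigD1 (Ordinal jp)) //= eqxx big1 ?addr0 // => i.
by rewrite -val_eqE /= => /negPf->.
Qed.

Lemma homog_inj : injective homog.
Proof.
apply: raddf_inj => p p0; apply/polyP => j; apply/polyP => i.
have := homog_coef p (i + j) j; rewrite p0 !coef0 leq_addl addnK => <-.
by [].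
Qed.

Lemma homog_eq0 p : (homog p == 0) = (p == 0).
Proof. by rewrite -[RHS](inj_eq homog_inj) rmorph0. Qed.

Definition tdeg_le n p := forall i j, (n < i + j)%N -> p`_j`_i = 0.

Lemma tdeg_leP n p : tdeg_le n p <-> (size (homog p) <= n.+1)%N.
Proof.
split=> [pn|sp i j nij].
  apply/leq_sizeP => m nm; apply/polyP => j; rewrite homog_coef coef0; case: leqP => // jm.
  by apply: pn; rewrite subnK.
have := homog_coef p (i + j) j; rewrite leq_addl addnK => <-.
by rewrite (nth_default 0 (leq_trans sp nij)) coef0.
Qed.

Lemma tdeg_le_mono m n p : (m <= n)%N -> tdeg_le m p -> tdeg_le n p.
Proof. by move=> mn pm i j nij; apply/pm/(leq_ltn_trans mn). Qed.

Lemma tdeg_le0 n : tdeg_le n 0. Proof. by move=> i j _; rewrite !coef0. Qed.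

Lemma tdeg_leD n p q : tdeg_le n p -> tdeg_le n q -> tdeg_le n (p + q).
Proof. by move=> pn qn i j nij; rewrite !coefD pn // qn // addr0. Qed.

Lemma tdeg_leN n p : tdeg_le n p -> tdeg_le n (- p).
Proof. by move=> pn i j nij; rewrite !coefN pn // oppr0. Qed.

Lemma tdeg_leM m n p q : tdeg_le m p -> tdeg_le n q -> tdeg_le (m + n) (p * q).
Proof.
move=> /tdeg_leP pm /tdeg_leP qn; apply/tdeg_leP; rewrite rmorphM.
apply: (leq_trans (size_polyMleq _ _)).
by rewrite -subn1 leq_subLR add1n -addSn -addnS leq_add.
Qed.

Lemma tdeg_le_const c : tdeg_le 0 c%:P%:P.
Proof. by move=> i [|j] ij; rewrite !coefC /= ?coefC ?addn0 //=; case: i ij. Qed.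

Definition tdeg p := (size (homog p)).-1.

Lemma tdegM p q : p != 0 -> q != 0 -> tdeg (p * q) = (tdeg p + tdeg q)%N.
Proof.
move=> p0 q0; rewrite /tdeg rmorphM size_mul ?homog_eq0 //.
have : (0 < size (homog p))%N by rewrite size_poly_gt0 homog_eq0.
have : (0 < size (homog q))%N by rewrite size_poly_gt0 homog_eq0.
by case: (size _) => // a _; case: (size _) => // b _; rewrite addSn addnS.
Qed.

Lemma tdeg_eq0 p : tdeg p = 0%N -> p = (p`_0`_0)%:P%:P.
Proof.
move=> p0; have pP : tdeg_le 0 p.
  by apply/tdeg_leP; rewrite -[X in (_ <= X.+1)%N]p0; apply: leqSpred.
apply/polyP => j; apply/polyP => i; rewrite coefC; case: j => [|j] /=.
  by rewrite coefC; case: i => [|i] //=; apply: pP; rewrite addn0.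
by rewrite coef0; apply: pP; rewrite addnS.
Qed.

End TotalDegree.

Section Factorial.
Variable K : closedFieldType.
Local Notation T := {poly {poly K}}.
Implicit Types (p q a b : T).

(** For a nonzero polynomial, total degree zero means being a unit. *)
Definition irreducible2 p :=
  (0 < tdeg p)%N /\ forall a b, p = a * b -> tdeg a = 0%N \/ tdeg b = 0%N.

Lemma irreducible2_neq0 p : irreducible2 p -> p != 0.
Proof. by case=> + _; apply: contraTneq => ->; rewrite /tdeg rmorph0 size_poly0. Qed.

Lemma irreducible2_factor p : (0 < tdeg p)%N -> exists q c, irreducible2 q /\ p = q * c.
Proof.
have [n] := ubnP (tdeg p); elim: n p => // n IHn p pn p0.
have [irp|] := pselect (irreducible2 p); first by exists p, 1; rewrite mulr1.
move=> /not_andP[//|/existsNP[a /existsNP[b /not_implyP[pab /not_orP[a0 b0]]]]].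
have pn0 : p != 0 by apply: contraTneq p0 => ->; rewrite /tdeg rmorph0 size_poly0.
move: pn0; rewrite pab mulf_eq0 => /norP[an0 bn0].
have pE : tdeg p = (tdeg a + tdeg b)%N by rewrite pab tdegM.
have /eqP := a0; rewrite -lt0n => a_gt0; have /eqP := b0; rewrite -lt0n => b_gt0.
have [|//|q [c [irq ->]]] := IHn a.
  by move: pn; rewrite pE ltnS; apply: leq_trans; rewrite -[X in (X < _)%N]addn0 ltn_add2l.
by exists q, (c * b); rewrite mulrA.
Qed.

Definition evx (l : K) : {rmorphism T -> {poly K}} := map_poly (horner_eval l).

Lemma evx_eq0 l p : evx l p = 0 -> exists q, p = ('X - l%:P)%:P * q.
Proof.
move=> p0; exists (map_poly (fun r => r %/ ('X - l%:P)) p).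
apply/polyP => i; rewrite coefCM coef_map_id0 ?div0p // mulrC divpK //.
rewrite dvdp_XsubCl; apply/rootP; transitivity ((evx l p)`_i); last by rewrite p0 coef0.
by rewrite coef_map.
Qed.

Lemma closed_root (r : {poly K}) : (1 < size r)%N -> exists l r', r = ('X - l%:P) * r'.
Proof.
move=> r1; have [l /factor_theorem[r' rE]] := closed_rootP r (negbT (gtn_eqF r1)).
by exists l, r'; rewrite rE mulrC.
Qed.

Lemma size_XsubCM l (r : {poly K}) : r != 0 -> size (('X - l%:P) * r) = (size r).+1.
Proof. by move=> r0; rewrite size_mul ?polyXsubC_eq0 // size_XsubC. Qed.

Lemma tdegXsubC l : tdeg (('X - l%:P)%:P : T) = 1%N.
Proof.
rewrite /tdeg /= evalpC /=.
by rewrite rmorphB /= map_polyX map_polyC size_XsubC.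
Qed.

Lemma const_poly2_unit p : p != 0 -> tdeg p = 0%N -> exists2 u : K, u != 0 & p = u%:P%:P.
Proof.
move=> p0 /tdeg_eq0 pE; exists p`_0`_0 => //.
by apply: contra_neq p0 => u0; rewrite pE u0.
Qed.

Lemma const_poly_size1 (r : {poly K}) : r != 0 -> (size r <= 1)%N -> exists2 u : K, u != 0 & r = u%:P.
Proof.
move=> r0 /size1_polyC rE; exists r`_0 => //.
by apply: contra_neq r0 => u0; rewrite rE u0.
Qed.

Lemma irreducible2_size p l q : irreducible2 p -> p = ('X - l%:P)%:P * q -> (size p <= 1)%N.
Proof.
move=> irp pE; have p0 := irreducible2_neq0 irp; case: irp => _ /(_ _ _ pE).
rewrite tdegXsubC => -[//|q0].
have [|u _ qE] := const_poly2_unit _ q0; first by apply: contraNneq p0 => q00; rewrite pE q00 mulr0.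
by rewrite pE qE -rmorphM size_polyC_leq1.
Qed.

(** Gauss's lemma for multiples: a linear factor [X1 - l] of [r] divides [p * c] but not [p], which
    has positive degree in the outer variable, so it can be removed from [c]. *)
Lemma irreducible2_cancel p (r : {poly K}) b c : irreducible2 p -> (1 < size p)%N -> r != 0 ->
  r%:P * b = p * c -> exists c', b = p * c'.
Proof.
move=> irp p1; have [n] := ubnP (size r); elim: n r c => // n IHn r c rn r0 E.
have [r1|r1] := leqP (size r) 1.
  have [u u0 rE] := const_poly_size1 r0 r1; exists ((u^-1)%:P%:P * c).
  by rewrite mulrCA -E mulrA -polyCM rE -polyCM mulVf // mul1r.
have [l [r' rE]] := closed_root r1.
have Xl0 : (('X - l%:P)%:P : T) != 0 by rewrite polyC_eq0 polyXsubC_eq0.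
have r'0 : r' != 0 by apply: contraNneq r0 => r'0; rewrite rE r'0 mulr0.
have : evx l p * evx l c = 0.
  rewrite -rmorphM -E rmorphM /= map_polyC rE /= /horner_eval hornerM hornerXsubC subrr mul0r.
  by rewrite polyC0 mul0r.
move=> /eqP; rewrite mulf_eq0 => /orP[/eqP/evx_eq0[q /(irreducible2_size irp)]|].
  by rewrite leqNgt p1.
move=> /eqP/evx_eq0[c' cE]; apply: (IHn r' c') => //.
  by move: rn; rewrite rE size_XsubCM // ltnS.
by apply: (mulfI Xl0); rewrite mulrA -rmorphM -rE E cE mulrCA.
Qed.

(** Gauss's lemma for factorizations: the linear factors of [r] are divided out of [h] or [g],
    without changing degrees in the outer variable, until [p] itself is factored. *)
Lemma irreducible2_gcd p (r : {poly K}) g h : irreducible2 p -> (1 < size p)%N -> r != 0 ->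
  r%:P * p = h * g -> (1 < size g)%N -> (size h <= 1)%N.
Proof.
move=> irp p1; have [n] := ubnP (size r); elim: n r g h => // n IHn r g h rn r0 E g1.
have p0 := irreducible2_neq0 irp.
have hg0 : h * g != 0 by rewrite -E mulf_neq0 // polyC_eq0.
have /norP[h0 g0] : ~~ ((h == 0) || (g == 0)) by rewrite -mulf_eq0.
have [r1|r1] := leqP (size r) 1.
  have [u u0 rE] := const_poly_size1 r0 r1.
  have pE : p = h * ((u^-1)%:P%:P * g).
    by rewrite mulrCA -E rE mulrA -!polyCM mulVf // mul1r.
  have [_ /(_ _ _ pE)[h_0|g_0]] := irp.
    by have [v _ ->] := const_poly2_unit h0 h_0; rewrite size_polyC_leq1.
  have ug0 : (u^-1)%:P%:P * g != 0 by rewrite mulf_neq0 // !polyC_eq0 invr_eq0.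
  have [v v0 gE] := const_poly2_unit ug0 g_0.
  have : g = (u%:P * v%:P)%:P by rewrite polyCM -gE mulrA -!polyCM mulfV // mul1r.
  by move=> gE'; move: g1; rewrite gE' ltnNge size_polyC_leq1.
have [l [r' rE]] := closed_root r1.
have Xl0 : (('X - l%:P)%:P : T) != 0 by rewrite polyC_eq0 polyXsubC_eq0.
have r'0 : r' != 0 by apply: contraNneq r0 => r'0; rewrite rE r'0 mulr0.
have r'n : (size r' < n)%N by move: rn; rewrite rE size_XsubCM // ltnS.
have : evx l h * evx l g = 0.
  rewrite -rmorphM -E rmorphM /= map_polyC rE /= /horner_eval hornerM hornerXsubC subrr mul0r.
  by rewrite polyC0 mul0r.
have sX q : size (('X - l%:P)%:P * q) = size q.
  by rewrite mul_polyC size_scale // polyXsubC_eq0.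
move=> /eqP; rewrite mulf_eq0 => /orP[|] /eqP/evx_eq0[q qE].
  rewrite qE sX; apply: (IHn r' g q) => //.
  by apply: (mulfI Xl0); rewrite !mulrA -rmorphM -rE E qE.
apply: (IHn r' q h) => //; last by move: g1; rewrite qE sX.
by apply: (mulfI Xl0); rewrite mulrA -rmorphM -rE E qE mulrCA.
Qed.

(** If [p] involves only the inner variable, it is linear up to a scalar, and substituting its root
    decides divisibility. Otherwise Euclid's lemma holds over [K(X1)], and the two forms of Gauss's
    lemma bring divisibility back to [K[X1, X2]]. *)
Lemma irreducible2_prime p a b c : irreducible2 p -> a * b = p * c ->
  (exists d, a = p * d) \/ exists d, b = p * d.
Proof.
move=> irp E; have p0 := irreducible2_neq0 irp.
have [p1|p1] := leqP (size p) 1.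
  have [r pE] : exists r, p = r%:P by exists p`_0; apply: size1_polyC.
  have [l [r' rE]] : exists l r', r = ('X - l%:P) * r'.
    apply: closed_root; rewrite ltnNge; apply/negP => r1.
    have r0 : r != 0 by move: p0; rewrite pE polyC_eq0.
    have [u _ rE] := const_poly_size1 r0 r1.
    case: irp; rewrite pE rE => /lt0n_neq0/eqP nz _; apply: nz.
    by have /tdeg_leP := @tdeg_le_const K u; rewrite /tdeg; case: size => [|[]].
  have pE' : p = ('X - l%:P)%:P * r'%:P by rewrite pE rE rmorphM.
  have [v v0 r'E] : exists2 v : K, v != 0 & r'%:P = v%:P%:P.
    have [_ /(_ _ _ pE')] := irp; rewrite tdegXsubC => -[//|r'0].
    by apply: const_poly2_unit => //; apply: contraNneq p0; rewrite pE' => ->; rewrite mulr0.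
  have pX q : ('X - l%:P)%:P * q = p * ((v^-1)%:P%:P * q).
    have vv : (v%:P%:P : T) * (v^-1)%:P%:P = 1 by rewrite -!polyCM mulfV.
    by rewrite pE' r'E mulrA -[_ * _ * (v^-1)%:P%:P]mulrA vv mulr1.
  have : evx l a * evx l b = 0.
    rewrite -rmorphM E rmorphM pE' rmorphM /= map_polyC /= /horner_eval hornerXsubC.
    by rewrite subrr polyC0 !mul0r.
  move=> /eqP; rewrite mulf_eq0 => /orP[|] /eqP/evx_eq0[q ->]; rewrite pX; [left|right];
    by eexists.
have pab : p %| a * b by rewrite E dvdp_mulr.
have cancel q : p %| q -> exists d, q = p * d.
  move=> /Pdiv.Idomain.dvdpP[[r d] /= r0]; rewrite -mul_polyC [d * p]mulrC.
  exact: irreducible2_cancel.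
have [cop|ncop] := boolP (coprimep p a).
  by right; apply: cancel; rewrite Gauss_dvdpr in pab.
left; apply: cancel; set g := gcdp p a.
have g1 : (1 < size g)%N.
  have g0 : g != 0 by rewrite gcdp_eq0 negb_and p0.
  by rewrite ltn_neqAle eq_sym ncop size_poly_gt0.
have /Pdiv.Idomain.dvdpP[[r h] /= r0] := dvdp_gcdl p a; rewrite -mul_polyC -/g => rp.
have h1 := irreducible2_gcd irp p1 r0 rp g1.
apply: (dvdp_trans _ (dvdp_gcdr p a)); rewrite -/g.
have h0 : h != 0.
  by apply: contraNneq p0 => h0; move/eqP: rp; rewrite h0 mul0r mulf_eq0 polyC_eq0 (negPf r0).
have hE : h = (h`_0)%:P by apply: size1_polyC.
rewrite -(@Pdiv.Idomain.dvdpZr _ h`_0) -?mul_polyC -?hE -?rp ?dvdp_mull //.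
by move: h0; rewrite {1}hE polyC_eq0.
Qed.

End Factorial.

(** * Valuation rings and the integrality of traces *)

Section Valuation.
Variable k : fieldType.

Definition valuation_ring (V : k -> Prop) :=
  [/\ V 1, forall x y, V x -> V y -> V (x - y), forall x y, V x -> V y -> V (x * y)
    & forall x, x != 0 -> V x \/ V x^-1].

Variable V : k -> Prop.
Hypothesis VP : valuation_ring V.

Lemma val1 : V 1. Proof. by case: VP. Qed.
Lemma valB x y : V x -> V y -> V (x - y). Proof. by case: VP => _ H _ _; apply: H. Qed.
Lemma valM x y : V x -> V y -> V (x * y). Proof. by case: VP => _ _ H _; apply: H. Qed.
Lemma val0 : V 0. Proof. by rewrite -(subrr 1); apply: valB; apply: val1. Qed.
Lemma valN x : V x -> V (- x). Proof. by rewrite -sub0r; apply/valB/val0. Qed.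
Lemma valD x y : V x -> V y -> V (x + y).
Proof. by move=> Vx Vy; rewrite -[y]opprK; apply/valB/valN. Qed.
Lemma val_sum (I : Type) (r : seq I) (F : I -> k) : (forall i, V (F i)) ->
  V (\sum_(i <- r) F i).
Proof. by move=> VF; elim/big_ind: _ => // [|x y]; [apply: val0 | apply: valD]. Qed.

Lemma val_max (s : seq k) : (exists2 x, x \in s & x != 0) ->
  exists x, [/\ x \in s, x != 0 & forall y, y \in s -> V (y / x)].
Proof.
elim: s => [[]//|y s IHs] ex.
have [exs|nexs] := pselect (exists2 x, x \in s & x != 0).
  have [x [xs x0 xmax]] := IHs exs.
  have [y0|y0] := eqVneq y 0.
    exists x; split; rewrite ?inE ?xs ?orbT // => z; rewrite inE => /predU1P[->|/xmax//].
    by rewrite y0 mul0r; apply: val0.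
  case: (VP) => _ _ _ /(_ (y / x))[|Vyx|Vxy]; first by rewrite mulf_neq0 ?invr_eq0.
    by exists x; split; rewrite ?inE ?xs ?orbT // => z; rewrite inE => /predU1P[->|/xmax].
  exists y; split; rewrite ?inE ?eqxx // => z; rewrite inE => /predU1P[->|zs].
    by rewrite divff //; apply: val1.
  have -> : z / y = (z / x) * (y / x)^-1 by field; rewrite x0 y0.
  by apply: valM => //; apply: xmax.
exists y; have y0 : y != 0.
  by case: ex => x; rewrite inE => /predU1P[->//|xs x0]; case: nexs; exists x.
split; rewrite ?inE ?eqxx // => z; rewrite inE => /predU1P[->|zs].
  by rewrite divff //; apply: val1.
have -> : z = 0 by apply/eqP; apply: contrapT => /negP z0; apply: nexs; exists z.
by rewrite mul0r; apply: val0.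
Qed.

(* Over a valuation ring the maximal minors of a generating family of a lattice are
   all multiples of one of them; by Cramer's rule this one gives a basis. *)
Lemma trace_lattice n (I : finType) (u : I -> 'rV[k]_n) (M : 'M[k]_n) :
  (exists f : 'I_n -> I, \det (\matrix_i u (f i)) != 0) ->
  (forall i, exists c : I -> k, (forall j, V (c j)) /\ u i *m M = \sum_j c j *: u j) ->
  V (\tr M).
Proof.
pose D (f : {ffun 'I_n -> I}) := \det (\matrix_i u (f i)).
move=> [f0 f00] stab.
have [|_ [/mapP[f _ ->] Df0 Dmax]] := @val_max [seq D f | f <- enum {ffun 'I_n -> I}].
  exists (D (finfun f0)); first by rewrite map_f // mem_enum.
  suff -> : D (finfun f0) = \det (\matrix_i u (f0 i)) by [].
  by congr (\det _); apply/matrixP => i j; rewrite !mxE ffunE.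
pose W := \matrix_i u (f i).
have Wu : W \in unitmx by rewrite unitmxE unitfE.
have coordV j i : V ((u j *m invmx W) 0 i).
  pose g := [ffun l => if l == i then j else f l].
  suff -> : (u j *m invmx W) 0 i = D g / D f by apply: Dmax; rewrite map_f // mem_enum.
  rewrite /invmx Wu -scalemxAr mxE mulrC; congr (_ / _).
  rewrite mxE /D (expand_det_row _ i); apply: eq_bigr => l _; rewrite !mxE ffunE eqxx.
  congr (_ * _); rewrite /cofactor; congr (_ * \det _).
  by apply/matrixP => a b; rewrite !mxE ffunE eq_sym (negPf (neq_lift _ _)).
have -> : \tr M = \tr (W *m M *m invmx W).
  by rewrite -mulmxA mxtrace_mulC -mulmxA mulVmx // mulmx1.
apply: val_sum => i; have [c [Vc uM]] := stab (f i).
have -> : (W *m M *m invmx W) i i = \sum_j c j * (u j *m invmx W) 0 i.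
  transitivity ((u (f i) *m M *m invmx W) 0 i).
    by rewrite -[u (f i)](_ : row i W = _) -?row_mul ?mxE // rowK.
  rewrite uM mulmx_suml summxE; apply: eq_bigr => j _.
  by rewrite -scalemxAl mxE.
by apply: val_sum => j; apply: valM.
Qed.

Variables (L : fieldType) (iota : {rmorphism k -> L}) (B : field_basis iota).

Definition vspan (I : finType) (w : I -> L) z :=
  exists c : I -> k, (forall j, V (c j)) /\ z = \sum_j iota (c j) * w j.

Lemma vspanD (I : finType) (w : I -> L) x y : vspan w x -> vspan w y -> vspan w (x + y).
Proof.
move=> [c [Vc ->]] [d [Vd ->]]; exists (fun j => c j + d j); split.
  by move=> j; apply: valD.
by rewrite -big_split; apply: eq_bigr => j _; rewrite rmorphD mulrDl.
Qed.

Lemma vspanZ (I : finType) (w : I -> L) c x : V c -> vspan w x -> vspan w (iota c * x).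
Proof.
move=> Vc [d [Vd ->]]; exists (fun j => c * d j); split.
  by move=> j; apply: valM.
by rewrite mulr_sumr; apply: eq_bigr => j _; rewrite rmorphM mulrA.
Qed.

Lemma vspan_mem (I : finType) (w : I -> L) i : vspan w (w i).
Proof.
exists (fun j => (j == i)%:R); split.
  by move=> j; case: eqP => _; [apply: val1 | apply: val0].
rewrite (bigD1 i) //= eqxx rmorph1 mul1r big1 ?addr0 // => j /negPf->.
by rewrite rmorph0 mul0r.
Qed.

Lemma vspan_sum (I : finType) (w : I -> L) (J : Type) (r : seq J) (F : J -> L) :
  (forall j, vspan w (F j)) -> vspan w (\sum_(j <- r) F j).
Proof.
move=> wF; elim/big_ind: _ => // [|x y]; last exact: vspanD.
exists (fun=> 0); split=> [_|]; first exact: val0.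
by rewrite big1 // => j _; rewrite rmorph0 mul0r.
Qed.

(** The products of [w] with a basis generate a lattice, of full rank because 1 is among [w], and
    multiplication by [z] preserves it. *)
Lemma ftr_lattice (I : finType) (w : I -> L) i0 z : w i0 = 1 ->
  (forall i, vspan w (z * w i)) -> V (ftr B z).
Proof.
move=> wi0 stab.
apply: (@trace_lattice _ _ (fun p : I * 'I_(bdim B) => bco B (w p.1 * bvec p.2))).
  exists (fun i => (i0, i)); rewrite (_ : \matrix_i _ = 1%:M) ?det1 ?oner_neq0 //.
  by apply/matrixP => i j; rewrite !mxE wi0 mul1r co_b mxE eqxx eq_sym.
have coM x : bco B x *m mulm B z = bco B (x * z).
  rewrite [in RHS](bcoK B x) mulr_suml co_sum mulmx_sum_row; apply: eq_bigr => i _.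
  rewrite -mulrA coZ; congr (_ *: _); apply/rowP => j.
  by rewrite mxE mxE.
move=> [i l] /=; have [c [Vc zw]] := stab i.
exists (fun p => if p.2 == l then c p.1 else 0); split.
  by move=> p; case: eqP => _ //; apply: val0.
rewrite coM mulrAC [_ * z]mulrC zw mulr_suml co_sum.
rewrite (eq_bigr (fun j => \sum_(l' : 'I_(bdim B)) (if l' == l then c j else 0) *: bco B (w j * bvec l'))).
  by rewrite pair_bigA.
move=> j _; rewrite (bigD1 l) //= eqxx -mulrA coZ big1 ?addr0 // => l' /negPf->.
by rewrite scale0r.
Qed.

(** The finitely many [alpha ^ a * beta ^ b] with [a <= d] and [b <= m] span over [V] a module
    stable under [alpha] and [beta]. *)
Lemma ftr_integral d m (alpha beta : L) (q : 'I_d.+1 -> k) (P : 'I_m.+1 -> nat -> k) r i j :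
  alpha ^+ d.+1 = \sum_(a < d.+1) iota (q a) * alpha ^+ a -> (forall a, V (q a)) ->
  beta ^+ m.+1 = \sum_(b < m.+1) (\sum_(c < r) iota (P b c) * alpha ^+ c) * beta ^+ b ->
  (forall b c, V (P b c)) -> V (ftr B (alpha ^+ i * beta ^+ j)).
Proof.
move=> alphaE Vq betaE VPc.
pose w (p : 'I_d.+1 * 'I_m.+1) := alpha ^+ p.1 * beta ^+ p.2.
have wab a b : vspan w (alpha ^+ a * beta ^+ b).
  elim/ltn_ind: b a => b IHb; have [bm|mb] := ltnP b m.+1.
    elim/ltn_ind => a IHa; have [ad|da] := ltnP a d.+1.
      exact: (vspan_mem w (Ordinal ad, Ordinal bm)).
    rewrite -(subnK da) exprD alphaE mulr_sumr mulr_suml; apply: vspan_sum => a'.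
    rewrite mulrCA -mulrA -exprD; apply: vspanZ => //; apply: IHa.
    by rewrite -[X in (_ < X)%N](subnK da) ltn_add2l.
  move=> a; rewrite -(subnK mb) exprD betaE !mulr_sumr; apply: vspan_sum => b'.
  rewrite mulr_suml !mulr_sumr; apply: vspan_sum => c.
  have -> : alpha ^+ a * (beta ^+ (b - m.+1) * (iota (P b' c) * alpha ^+ c * beta ^+ b')) =
      iota (P b' c) * (alpha ^+ (a + c) * beta ^+ (b - m.+1 + b')) by rewrite !exprD; ring.
  apply: vspanZ => //; apply: IHb.
  by rewrite -[X in (_ < X)%N](subnK mb) ltn_add2l.
apply: (@ftr_lattice _ w (ord0, ord0)); first by rewrite /w !expr0 mulr1.
move=> p; have -> : alpha ^+ i * beta ^+ j * w p = alpha ^+ (i + p.1) * beta ^+ (j + p.2).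
  by rewrite /w !exprD; ring.
exact: wab.
Qed.

End Valuation.

Lemma fsub_div (F : fieldType) (a b c d : F) : b != 0 -> d != 0 ->
  a / b - c / d = (a * d - c * b) / (b * d).
Proof. by move=> b0 d0; field; rewrite b0 d0. Qed.

Section Normality.
Variable K : closedFieldType.
Local Notation T := {poly {poly K}}.
Local Notation k := {fraction T}.
Local Notation "x %:F" := (@FracField.tofrac T x).
Local Notation homog := (homog K).
Implicit Types (p q a b : T) (r : k).

(** The localization of [K[X1, X2]] at the prime ideal generated by [q]. *)
Definition val_irr (q : T) (r : k) := exists a b,
  [/\ b != 0, r = a%:F / b%:F & forall c, b <> q * c].

Lemma irreducible2_ndvd1 q c : irreducible2 q -> 1 <> q * c.
Proof.
move=> irq qc; have q0 := irreducible2_neq0 irq; have c0 : c != 0.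
  by apply: contra_eq_neq qc => ->; rewrite mulr0 oner_neq0.
case: irq => + _; have := tdegM q0 c0; rewrite -qc => /esym/eqP.
have -> : tdeg (1 : T) = 0%N.
  by have /tdeg_leP := @tdeg_le_const K 1; rewrite /tdeg !polyC1; case: size => [|[]].
by rewrite addn_eq0 => /andP[/eqP->].
Qed.

Lemma val_irrP q : irreducible2 q -> valuation_ring (val_irr q).
Proof.
move=> irq; have q0 := irreducible2_neq0 irq.
have nd1 := irreducible2_ndvd1 irq.
have ndM b b' : (forall c, b <> q * c) -> (forall c, b' <> q * c) -> forall c, b * b' <> q * c.
  by move=> nb nb' c /(irreducible2_prime irq)[[d /nb]|[d /nb']].
split.
- by exists 1, 1; rewrite oner_neq0 tofrac1 divr1; split.
- move=> _ _ [a [b [b0 -> nb]]] [a' [b' [b'0 -> nb']]].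
  exists (a * b' - a' * b), (b * b'); split; [by rewrite mulf_neq0 | | exact: ndM].
  by rewrite fsub_div ?tofrac_eq0 // rmorphB !rmorphM.
- move=> _ _ [a [b [b0 -> nb]]] [a' [b' [b'0 -> nb']]].
  exists (a * a'), (b * b'); split; [by rewrite mulf_neq0 | | exact: ndM].
  by rewrite mulf_div !rmorphM.
move=> r; have [a [b [b0 ->]]] := tofracP r.
rewrite mulf_eq0 invr_eq0 (negPf b0) orbF !tofrac_eq0 => a0.
rewrite tofrac_eq0 in b0.
have [n] := ubnP (tdeg b); elim: n a b a0 b0 => // n IHn a b a0 b0 bn.
have [[b' bE]|nb] := pselect (exists c, b = q * c); last first.
  by left; exists a, b; split=> // c bc; apply: nb; exists c.
have [[a' aE]|na] := pselect (exists c, a = q * c); last first.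
  by right; exists b, a; rewrite invf_div; split=> // c ac; apply: na; exists c.
move: a0 b0; rewrite aE bE !mulf_eq0 (negPf q0) /= => a'0 b'0.
have -> : (q * a')%:F / (q * b')%:F = a'%:F / b'%:F.
  by rewrite !rmorphM -mulf_div divff ?tofrac_eq0 // mul1r.
apply: IHn => //; move: bn; rewrite bE tdegM // ltnS; apply: leq_trans.
by case: irq => q1 _; rewrite -[X in (X < _)%N]add0n ltn_add2r.
Qed.

Lemma val_irr_poly q p : irreducible2 q -> val_irr q p%:F.
Proof.
move=> irq; exists p, 1; rewrite oner_neq0 tofrac1 divr1; split=> // c.
exact: irreducible2_ndvd1.
Qed.

(** The localizations at irreducible polynomials suffice: each of them cancels an irreducible factor
    of the denominator. *)
Lemma poly2_normal r : (forall V, valuation_ring V -> (forall p, V p%:F) -> V r) ->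
  exists p, r = p%:F.
Proof.
have [a [b [b0 ->]]] := tofracP r; rewrite tofrac_eq0 in b0 => rV.
have [n] := ubnP (tdeg b); elim: n a b b0 rV => // n IHn a b b0 rV bn.
have [b_0|b_gt0] := posnP (tdeg b).
  have [u u0 bE] := const_poly2_unit b0 b_0; exists (a * (u^-1)%:P%:P).
  have vu : (u^-1)%:P%:P * b = 1 by rewrite bE -!polyCM mulVf.
  have -> : a%:F = (a * (u^-1)%:P%:P)%:F * b%:F by rewrite -tofracM -mulrA vu mulr1.
  by rewrite mulfK // tofrac_eq0.
have [q [b' [irq bE]]] := irreducible2_factor b_gt0.
have q0 := irreducible2_neq0 irq.
move: b0; rewrite bE mulf_eq0 (negPf q0) /= => b'0.
have [c [d [d0 E nd]]] := rV _ (val_irrP irq) (fun p => val_irr_poly p irq).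
have [a' aE] : exists a', a = q * a'.
  have : a * d = q * (b' * c).
    move/eqP: E; rewrite eqr_div ?tofrac_eq0 // ?bE ?mulf_neq0 // -!rmorphM tofrac_eq => /eqP->.
    by ring.
  by move=> /(irreducible2_prime irq)[//|[c' /nd]].
have E' : a%:F / b%:F = a'%:F / b'%:F.
  by rewrite aE bE !rmorphM -mulf_div divff ?tofrac_eq0 // mul1r.
rewrite -bE E'; apply: IHn => //; first by rewrite -E'.
move: bn; rewrite bE tdegM // ltnS; apply: leq_trans.
by case: irq => q1 _; rewrite -[X in (X < _)%N]add0n ltn_add2r.
Qed.

(** The ring of the valuation given by minus the total degree; [val_inf_tdeg] turns degree bounds
    into integrality for it. *)
Definition val_inf (r : k) := exists a b,
  [/\ b != 0, r = a%:F / b%:F & (size (homog a) <= size (homog b))%N].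

Lemma val_infP : valuation_ring val_inf.
Proof.
have szM a b : size (homog (a * b)) = if (a == 0) || (b == 0) then 0%N
    else (size (homog a) + size (homog b)).-1.
  rewrite rmorphM; have [->|a0] := eqVneq a 0; first by rewrite rmorph0 mul0r size_poly0.
  have [->|b0] := eqVneq b 0; first by rewrite rmorph0 mulr0 size_poly0.
  by rewrite size_mul ?homog_eq0.
have szMle a b a' b' : b != 0 -> b' != 0 -> (size (homog a) <= size (homog b))%N ->
    (size (homog a') <= size (homog b'))%N -> (size (homog (a * a')%R) <= size (homog (b * b')%R))%N.
  move=> b0 b'0 ab ab'; rewrite !szM (negPf b0) (negPf b'0) /=; case: ifP => // _.
  by rewrite -!subn1 leq_sub2r // leq_add.
split.
- by exists 1, 1; rewrite oner_neq0 tofrac1 divr1; split.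
- move=> _ _ [a [b [b0 -> ab]]] [a' [b' [b'0 -> ab']]].
  exists (a * b' - a' * b), (b * b'); split; first by rewrite mulf_neq0.
    by rewrite fsub_div ?tofrac_eq0 // rmorphB !rmorphM.
  rewrite rmorphB; apply: (leq_trans (size_polyD _ _)); rewrite size_polyN geq_max.
  by rewrite szMle //= [b * b']mulrC szMle.
- move=> _ _ [a [b [b0 -> ab]]] [a' [b' [b'0 -> ab']]].
  exists (a * a'), (b * b'); split; [by rewrite mulf_neq0 | | exact: szMle].
  by rewrite mulf_div !rmorphM.
move=> r; have [a [b [b0 ->]]] := tofracP r.
rewrite mulf_eq0 invr_eq0 (negPf b0) orbF !tofrac_eq0 => a0.
rewrite tofrac_eq0 in b0.
have [ab|/ltnW ba] := leqP (size (homog a)) (size (homog b)).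
  by left; exists a, b.
by right; exists b, a; rewrite invf_div.
Qed.

Lemma homogX1 n : homog (('X%:P : T) ^+ n) = 'X^n.
Proof. by rewrite rmorphXn /= evalpC /= map_polyX. Qed.

Lemma val_inf_tdeg n p : val_inf (p%:F / ('X%:P)%:F ^+ n) <-> tdeg_le n p.
Proof.
have X0 : ('X%:P : T) != 0 by rewrite polyC_eq0 polyX_eq0.
split=> [[a [b [b0 E ab]]]|pn]; last first.
  exists p, ('X%:P ^+ n); rewrite expf_neq0 // rmorphXn; split=> //.
  by rewrite homogX1 size_polyXn; apply/tdeg_leP.
apply/tdeg_leP; have [->|p0] := eqVneq p 0; first by rewrite rmorph0 size_poly0.
have : p * b = a * 'X%:P ^+ n.
  apply/eqP; move/eqP: E; rewrite -rmorphXn eqr_div ?tofrac_eq0 ?expf_neq0 //.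
  by rewrite -!rmorphM tofrac_eq.
move/(congr1 (fun x => size (homog x))); rewrite !rmorphM homogX1 size_mul ?homog_eq0 //.
rewrite size_mulXn => [E'|]; last first.
  rewrite homog_eq0; apply: contraNneq p0 => a0; move/eqP: E.
  by rewrite a0 rmorph0 mul0r mulf_eq0 invr_eq0 expf_eq0 !tofrac_eq0 (negPf X0) andbF orbF.
have b_gt0 : (0 < size (homog b))%N by rewrite size_poly_gt0 homog_eq0.
move: E' ab b_gt0; case: (size (homog b)) => // sb; rewrite addnS /= => E' ab _.
by rewrite -(leq_add2r sb) E' addSn -addnS leq_add2l.
Qed.

Definition tdeg3_le n (p : {poly T}) := forall l i j, (n < i + j + l)%N -> p`_l`_j`_i = 0.

Lemma tdeg3_coef n (p : {poly T}) l : tdeg3_le n p -> (l <= n)%N -> tdeg_le (n - l) p`_l.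
Proof. by move=> pn ln i j nij; apply: pn; rewrite -(subnK ln) ltn_add2r. Qed.

Lemma tdeg3_coef_gt n (p : {poly T}) l : tdeg3_le n p -> (n < l)%N -> p`_l = 0.
Proof.
move=> pn nl; apply/polyP => j; apply/polyP => i; rewrite !coef0; apply: pn.
exact: leq_trans nl (leq_addl _ _).
Qed.

Lemma tdeg3P n (p : {poly T}) : (forall l, (l <= n)%N -> tdeg_le (n - l) p`_l) ->
  (forall l, (n < l)%N -> p`_l = 0) -> tdeg3_le n p.
Proof.
move=> p1 p2 l i j nijl; have [ln|nl] := leqP l n; last by rewrite p2 // !coef0.
by apply: (p1 l) => //; rewrite -(ltn_add2r l) subnK.
Qed.

Section TraceBound.
Variables (L : fieldType) (iota : {rmorphism k -> L}) (B : field_basis iota).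
Local Notation iotaT := (iota \o @FracField.tofrac T).

(** One scaling gives both claims. Dividing [alpha] by [x] and [beta] by [x ^ e] makes them integral
    over any valuation ring that contains every [p / x ^ n] with [p] of degree at most [n]. With
    [x = 1] this shows that the trace is a polynomial; with [x = X1] and the valuation at infinity
    it bounds the degree. *)
Lemma trace_poly_bound d m e (alpha beta : L) (q : 'I_d.+1 -> T) (P : 'I_m.+1 -> {poly T}) i :
  alpha ^+ d.+1 = \sum_(a < d.+1) iota (q a)%:F * alpha ^+ a ->
  (forall a : 'I_d.+1, tdeg_le (d.+1 - a) (q a)) ->
  beta ^+ m.+1 = \sum_(b < m.+1) evalp iotaT alpha (P b) * beta ^+ b ->
  (forall b : 'I_m.+1, tdeg3_le ((m.+1 - b) * e) (P b)) ->
  exists p, ftr B (alpha ^+ i * beta) = p%:F /\ tdeg_le (i + e) p.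
Proof.
move=> alphaE qd betaE Pd.
pose r := (\max_b size (P b))%N.
have scaled V (x : k) : valuation_ring V -> x != 0 ->
    (forall n p, tdeg_le n p -> V (p%:F / x ^+ n)) -> V (ftr B (alpha ^+ i * beta) / x ^+ (i + e)).
  move=> VP x0 Vx; have ix0 : iota x != 0 by rewrite fmorph_eq0.
  have -> : ftr B (alpha ^+ i * beta) / x ^+ (i + e) =
      ftr B ((alpha / iota x) ^+ i * (beta / iota x ^+ e) ^+ 1).
    rewrite mulrC -ftrZ; congr (ftr _ _); rewrite fmorphV rmorphXn expr1 exprD expr_div_n.
    by field; rewrite !expf_neq0.
  refine (@ftr_integral _ _ VP _ _ B d m (alpha / iota x) (beta / iota x ^+ e)
     (fun a : 'I_d.+1 => (q a)%:F / x ^+ (d.+1 - a))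
     (fun (b : 'I_m.+1) c =>
        if (c <= (m.+1 - b) * e)%N then ((P b)`_c)%:F / x ^+ ((m.+1 - b) * e - c) else 0) r i 1 _ _ _ _).
  - rewrite expr_div_n alphaE mulr_suml; apply: eq_bigr => a _.
    have -> : iota x ^+ d.+1 = iota x ^+ (d.+1 - a) * iota x ^+ a.
      by rewrite -exprD subnK // ltnW.
    rewrite rmorphM fmorphV rmorphXn expr_div_n /=.
    by field; rewrite !expf_neq0.
  - by move=> a; apply: Vx.
  - rewrite expr_div_n betaE mulr_suml; apply: eq_bigr => b _.
    have sP : (size (P b) <= r)%N by apply: leq_bigmax.
    rewrite (evalp_sum _ _ sP) !mulr_suml; apply: eq_bigr => c _ /=.
    rewrite -exprM; case: leqP => [cm|mc]; last first.
      by rewrite (tdeg3_coef_gt (Pd b)) // !rmorph0 !mul0r.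
    rewrite rmorphM fmorphV rmorphXn !expr_div_n -exprM.
    have -> : iota x ^+ (e * m.+1) = iota x ^+ ((m.+1 - b) * e - c) * iota x ^+ c * iota x ^+ (e * b).
      rewrite -!exprD; congr (_ ^+ _).
      by rewrite subnK // [((m.+1 - b) * e)%N]mulnC -mulnDr subnK // ltnW.
    by field; rewrite !expf_neq0.
  - move=> b c; case: leqP => [cm|_]; last exact: val0.
    by apply: Vx; apply: tdeg3_coef.
have [|p pE] := poly2_normal (r := ftr B (alpha ^+ i * beta)).
  move=> V VP Vp; have := scaled V 1 VP (oner_neq0 _); rewrite expr1n divr1; apply.
  by move=> n p _; rewrite expr1n divr1.
exists p; split=> //; apply/val_inf_tdeg; rewrite -pE; apply: scaled; first exact: val_infP.
  by rewrite tofrac_eq0 polyC_eq0 polyX_eq0.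
by move=> n p' /val_inf_tdeg.
Qed.

End TraceBound.
End Normality.

(** * Residues at infinity *)

Ltac size_lia :=
  repeat match goal with H : is_true (leq _ _) |- _ => revert H end;
  do ?(move: (size _) => ?); lia.

(** The polynomial part of [q * \sum_j t j / X ^ (j + 1)]. If [t] satisfies the linear recurrence
    with characteristic polynomial [q], this is the whole product, and dividing by [q] recovers the
    series. *)
Definition moment_num (B : comNzRingType) (q : {poly B}) (t : nat -> B) : {poly B} :=
  \sum_(l < size q) \sum_(j < l) (q`_l * t j) *: 'X^(l.-1 - j).

Section Residue.
Variable k : fieldType.
Local Notation E := {fraction {poly k}}.
Local Notation "x %:F" := (@FracField.tofrac {poly k} x).
Implicit Types (p q a b c : {poly k}) (r : E).

Lemma coefM_top p q m n : (size p <= m.+1)%N -> (size q <= n.+1)%N ->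
  (p * q)`_(m + n) = p`_m * q`_n.
Proof.
move=> pm qn; have lt : (m < (m + n).+1)%N by rewrite ltnS leq_addr.
rewrite coefM (bigD1 (Ordinal lt)) //= addKn big1 ?addr0 // => i.
rewrite -val_eqE /= neq_ltn => /orP[im|mi].
  by rewrite [q`__]nth_default ?mulr0 // (leq_trans qn) //; clear -im; lia.
by rewrite [p`_i]nth_default ?mul0r // (leq_trans pm).
Qed.

Lemma frac_monic r : exists a b, b \is monic /\ r = a%:F / b%:F.
Proof.
have [a [b [b0 ->]]] := tofracP r; rewrite tofrac_eq0 in b0.
have l0 : lead_coef b != 0 by rewrite lead_coef_eq0.
exists ((lead_coef b)^-1 *: a), ((lead_coef b)^-1 *: b); split.
  by rewrite monicE lead_coefZ mulVf.
rewrite -!mul_polyC !tofracM -mulf_div divff ?mul1r //.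
by rewrite tofrac_eq0 polyC_eq0 invr_eq0.
Qed.

Lemma residue_wd a b a' b' : b \is monic -> b' \is monic -> a%:F / b%:F = a'%:F / b'%:F ->
  (a %% b)`_(size b).-2 = (a' %% b')`_(size b').-2.
Proof.
have expand c d e : d \is monic -> e \is monic ->
    (c %% d)`_(size d).-2 = ((c * e) %% (d * e))`_(size (d * e)).-2.
  move=> md me; have d0 := monic_neq0 md; have e0 := monic_neq0 me.
  have -> : (c * e) %% (d * e) = (c %% d) * e.
    have E0 : c * e = (c %/ d) * (d * e) + (c %% d) * e by rewrite mulrA -mulrDl -divp_eq.
    rewrite {1}E0; apply: modp_addl_mul_small.
    have [->|cd0] := eqVneq (c %% d) 0; first by rewrite mul0r size_poly0 size_poly_gt0 mulf_neq0.
    have := ltn_modp c d; rewrite d0 !size_mul //.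
    have : (0 < size e)%N by rewrite size_poly_gt0.
    by size_lia.
  (* For [d = 1] the truncated index [(size d).-2] is not one below the degree, but the remainder is
     zero. *)
  have [sd|] := leqP (size d) 1.
    have -> : d = 1.
      have dE := size1_polyC sd; have := monicP md; rewrite dE lead_coefC => d1.
      by rewrite d1.
    by rewrite modp1 mul0r !coef0.
  have : (0 < size e)%N by rewrite size_poly_gt0.
  rewrite size_mul //; have := ltn_modp c d; rewrite d0.
  have := lead_coefE e; rewrite (monicP me).
  case: (size d) => [|[|sd]] //; case seE: (size e) => [//|se] /= e1 cd _ _.
  rewrite [X in _ = _`_X](_ : _ = (sd + se)%N); last by lia.
  by rewrite coefM_top -?e1 ?mulr1 // seE.
move=> mb mb' E; rewrite (expand a b b') // (expand a' b' b) // [b' * b]mulrC.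
congr ((_ %% _)`__); apply/eqP; rewrite -(tofrac_eq (a * b')) !tofracM.
by rewrite -eqr_div ?tofrac_eq0 ?monic_neq0 // E.
Qed.

(** The coefficient of [1 / X] in the expansion at infinity, without the customary sign: for a
    proper fraction with monic denominator of degree [m], the coefficient of [X ^ (m - 1)] in the
    numerator. By [frac_monic] the default of [xget] never occurs. *)
Definition residue r : k :=
  let ab := xget (0, 1) [set ab : {poly k} * {poly k} | ab.2 \is monic /\ r = ab.1%:F / ab.2%:F]%classic in
  (ab.1 %% ab.2)`_(size ab.2).-2.

Lemma residueE a b : b \is monic -> residue (a%:F / b%:F) = (a %% b)`_(size b).-2.
Proof.
move=> mb; rewrite /residue; case: xgetP => [[a' b'] _ [/= mb' E]|/(_ (a, b)) no].
  by apply: residue_wd; rewrite // -E.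
by case: no.
Qed.

Lemma frac_monic2 r r' : exists a a' b, [/\ b \is monic, r = a%:F / b%:F & r' = a'%:F / b%:F].
Proof.
have [a [b [mb ->]]] := frac_monic r; have [a' [b' [mb' ->]]] := frac_monic r'.
exists (a * b'), (a' * b), (b * b'); rewrite monicMl //; split=> //.
  by rewrite !tofracM -mulf_div divff ?mulr1 // tofrac_eq0 monic_neq0.
rewrite !tofracM [b%:F * _]mulrC -mulf_div divff ?mulr1 // tofrac_eq0 monic_neq0 //.
Qed.

Lemma residueD r r' : residue (r + r') = residue r + residue r'.
Proof.
have [a [a' [b [mb -> ->]]]] := frac_monic2 r r'.
by rewrite -mulrDl -tofracD !residueE // modpD coefD.
Qed.

Lemma residueZ (c : k) r : residue (c%:P%:F * r) = c * residue r.
Proof.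
have [a [b [mb ->]]] := frac_monic r.
by rewrite mulrA -tofracM mul_polyC !residueE // modpZl coefZ.
Qed.

Lemma residue_poly p : residue p%:F = 0.
Proof.
rewrite -[p%:F]divr1 -(tofrac1 {poly k}) residueE ?monic1 //.
by rewrite modp1 coef0.
Qed.

Lemma residue_proper r : exists p c b, [/\ b \is monic, (size c < size b)%N &
  r = p%:F + c%:F / b%:F].
Proof.
have [a [b [mb ->]]] := frac_monic r; have b0 := monic_neq0 mb.
exists (a %/ b), (a %% b), b; split=> //; first by rewrite ltn_modp.
by rewrite {1}(divp_eq a b) tofracD tofracM mulrDl mulfK // tofrac_eq0.
Qed.

Lemma residue_detect r : (forall i, residue (('X^i)%:F * r) = 0) -> exists p, r = p%:F.
Proof.
have [p [c [b [mb cb ->]]]] := residue_proper r => res.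
have [c0|c0] := eqVneq c 0; first by exists p; rewrite c0 tofrac0 mul0r addr0.
(* This power of [X] brings the proper part [c / b] to degree exactly -1, where its residue is the
   leading coefficient of [c]. *)
have := res ((size b).-1 - size c)%N; rewrite mulrDr residueD -tofracM residue_poly add0r.
rewrite mulrA -tofracM residueE // modp_small; last first.
  rewrite size_monicM ?monicXn // size_polyXn addSn /=.
  by case: (size b) cb => // sb cb; rewrite subnK.
have c_gt0 : (0 < size c)%N by rewrite size_poly_gt0.
rewrite coefXnM; case: ltnP => [|_]; first by move: cb c_gt0; size_lia.
move=> /eqP; have -> : ((size b).-2 - ((size b).-1 - size c))%N = (size c).-1.
  by move: cb c_gt0; size_lia.
by rewrite -lead_coefE lead_coef_eq0 (negPf c0).
Qed.

(** The derivative of a proper fraction has degree at most -2. *)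
Lemma residue_deriv (d : E -> E) : derivation d -> (forall p, d p%:F = (p^`())%:F) ->
  forall r, residue (d r) = 0.
Proof.
move=> dP dE r; have [p [c [b [mb cb ->]]]] := residue_proper r.
have b0 := monic_neq0 mb; have bF0 : b%:F != 0 by rewrite tofrac_eq0.
rewrite (derD dP) residueD dE residue_poly add0r (der_fraction _ dP) //= !dE.
rewrite -!tofracM -tofracB -tofracXn residueE ?monic_exp //.
have sb2 : size (b ^+ 2)%R = (size b + size b).-1 by rewrite expr2 size_mul.
have sc : (size c^`() <= (size c).-1)%N by exact: size_poly.
have sb : (size b^`() <= (size b).-1)%N by exact: size_poly.
have sN : (size (c^`() * b - c * b^`())%R <= (size b + size b).-1.-2)%N.
  rewrite (leq_trans (size_polyD _ _)) // size_polyN geq_max.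
  have := size_polyMleq c^`() b; have := size_polyMleq c b^`(); size_lia.
have b_gt0 : (0 < size b)%N by rewrite size_poly_gt0.
rewrite modp_small; last by rewrite sb2; size_lia.
by rewrite nth_default // sb2.
Qed.

(** As [b] is monic, [dk] lowers its degree, so the term of the quotient rule containing the
    derivative of [b] has degree at most -2 and no residue. *)
Lemma residue_coef (dk : k -> k) (d : E -> E) : derivation dk -> derivation d ->
  (forall p, d p%:F = (map_poly dk p)%:F) -> forall r, residue (d r) = dk (residue r).
Proof.
move=> dkP dP dE r; have [p [c [b [mb cb ->]]]] := residue_proper r.
have dk0 : dk 0 = 0 := der0 dkP.
have b0 := monic_neq0 mb; have bF0 : b%:F != 0 by rewrite tofrac_eq0.
rewrite (derD dP) !residueD dE !residue_poly !add0r (der_fraction _ dP) //= !dE.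
rewrite -!tofracM -tofracB -tofracXn !residueE ?monic_exp // [in RHS]modp_small //.
have sb2 : size (b ^+ 2)%R = (size b + size b).-1 by rewrite expr2 size_mul.
have sc : (size (map_poly dk c) <= size c)%N by exact: size_poly.
have sb : (size (map_poly dk b) <= (size b).-1)%N.
  apply/leq_sizeP => j bj; rewrite coef_map_id0 //.
  have := monicP mb; rewrite lead_coefE; move: bj; rewrite leq_eqVlt => /predU1P[<- ->|bj _].
    by rewrite (der1 dkP).
  by rewrite nth_default ?dk0 //; size_lia.
have sN : (size (c * map_poly dk b)%R <= (size b + size b).-1.-2)%N.
  have := size_polyMleq c (map_poly dk b); size_lia.
have b_gt0 : (0 < size b)%N by rewrite size_poly_gt0.
rewrite modp_small; last first.
  rewrite sb2 (leq_ltn_trans (size_polyD _ _)) // size_polyN gtn_max.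
  have := size_polyMleq (map_poly dk c) b; size_lia.
rewrite coefB [X in _ - X]nth_default ?sb2 // subr0.
have [sb1|sb2'] := leqP (size b) 1.
  have -> : c = 0 by apply/eqP; rewrite -size_poly_leq0; size_lia.
  by rewrite map_poly0 mul0r !coef0 dk0.
have -> : (size b + size b).-1.-2 = ((size b).-2 + (size b).-1)%N by lia.
rewrite coefM_top; [|by move: cb sc; size_lia|size_lia].
by rewrite -lead_coefE (monicP mb) mulr1 coef_map_id0.
Qed.

(** The hypothesis says that [q] times the series of [t] has no term in [1 / X], which
    multiplication by [X] would move into the polynomial part. *)
Lemma moment_num_shift q (t : nat -> k) : \sum_(l < size q) q`_l * t l = 0 ->
  'X * moment_num q t = t 0%N *: q + moment_num q (fun i => t i.+1).
Proof.
move=> rec0; rewrite -[LHS]addr0 -[X in _ + X = _](polyC0 k) -rec0 rmorph_sum /=.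
rewrite [in t 0%N *: q](_ : q = \sum_(l < size q) q`_l *: 'X^l); last first.
  by rewrite -[LHS]coefK poly_def.
rewrite mulr_sumr scaler_sumr -!big_split /=; apply: eq_bigr => l _.
transitivity (\sum_(j < l.+1) (q`_l * t j) *: 'X^(l - j)).
  rewrite big_ord_recr /= subnn expr0 -mul_polyC mulr1; congr (_ + _).
  rewrite mulr_sumr; apply: eq_bigr => j _; rewrite -scalerAr -exprS; congr (_ *: 'X^_).
  by have := ltn_ord j; size_lia.
rewrite big_ord_recl /= subn0 scalerA [t 0%N * _]mulrC; congr (_ + _).
by apply: eq_bigr => j _; congr (_ *: 'X^_); rewrite /bump /=; size_lia.
Qed.

Lemma size_moment_num q (t : nat -> k) : (size (moment_num q t) <= (size q).-1)%N.
Proof.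
apply: (leq_trans (size_sum _ _ _)); apply/bigmax_leqP => l _.
apply: (leq_trans (size_sum _ _ _)); apply/bigmax_leqP => j _.
apply: (leq_trans (size_scale_leq _ _)); rewrite size_polyXn.
have jl := ltn_ord j; have lq := ltn_ord l.
apply: (@leq_trans l); first lia.
by rewrite -ltnS prednK // (leq_ltn_trans _ lq).
Qed.

Lemma residue_moments q (t : nat -> k) : q \is monic -> (1 < size q)%N ->
  (forall i, \sum_(l < size q) q`_l * t (i + l)%N = 0) ->
  forall i, residue (('X^i)%:F * ((moment_num q t)%:F / q%:F)) = t i.
Proof.
move=> mq q1 rect i; elim: i t rect => [|i IHi] t rect.
  rewrite expr0 tofrac1 mul1r residueE // modp_small; last first.
    by have := size_moment_num q t; size_lia.
  have := monicP mq; rewrite lead_coefE /moment_num.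
  case: (size q) q1 => [|[|d]] //= _ qd; rewrite coef_sum big_ord_recr /= big1 ?add0r.
    rewrite coef_sum big_ord_recl /= subn0 coefZ coefXn eqxx mulr1 qd mul1r.
    rewrite big1 ?addr0 // => j _; rewrite coefZ coefXn (_ : (d == _) = false) ?mulr0 //.
    by have := ltn_ord j; rewrite /bump /=; size_lia.
  move=> l _; rewrite coef_sum big1 // => j _; rewrite coefZ coefXn (_ : (d == _) = false) ?mulr0 //.
  by have := ltn_ord j; have := ltn_ord l; rewrite /=; size_lia.
have q0 : q%:F != 0 by rewrite tofrac_eq0 monic_neq0.
rewrite exprSr mulrA -tofracM -mulrA moment_num_shift; last exact: (rect 0%N).
rewrite mulrDr tofracD mulrDl residueD -scalerAr -mul_polyC !tofracM -!mulrA divff //.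
rewrite mulr1 -tofracM residue_poly add0r mulrA -tofracM tofracM -mulrA IHi //.
by move=> i'; rewrite -[RHS](rect i'.+1); apply: eq_bigr => l _; rewrite addSn.
Qed.

End Residue.

Lemma deriv_derivation (B : comNzRingType) : derivation (@deriv B).
Proof. by split=> x y; rewrite ?derivD ?derivM. Qed.

Lemma map_poly_derivation (B : comNzRingType) (d : B -> B) : derivation d ->
  derivation (map_poly d).
Proof.
move=> dP; have d0 := der0 dP; split=> p q; apply/polyP => n.
  by rewrite coefD !coef_map_id0 // coefD (derD dP).
rewrite coefD !coefM coef_map_id0 // coefM (der_sum dP) -big_split; apply: eq_bigr => i _ /=.
by rewrite (derM dP) !coef_map_id0.
Qed.

Lemma frac_derivation (D : idomainType) (d : D -> D) : derivation d ->
  exists d' : {fraction D} -> {fraction D}, derivation d' /\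
    forall p, d' (FracField.tofrac p) = FracField.tofrac (d p).
Proof.
move=> dP; apply: (@der_fraction_lift _ _ (@FracField.tofrac D) (fun p => FracField.tofrac (d p))).
- exact: fraction_map_tofrac.
- by split=> x y; rewrite ?(derD dP) ?(derM dP) ?tofracD ?tofracM.
- by move=> a /eqP; rewrite tofrac_eq0 => /eqP->; rewrite (der0 dP) tofrac0.
Qed.

Section Degrees.
Variable K : closedFieldType.
Local Notation T := {poly {poly K}}.
Implicit Types (s u : {poly T}).

Lemma tdeg3_le_mono m n s : (m <= n)%N -> tdeg3_le m s -> tdeg3_le n s.
Proof. by move=> mn sm l i j nij; apply/sm/(leq_ltn_trans mn). Qed.

Lemma tdeg3_le0 n : tdeg3_le n (0 : {poly T}). Proof. by move=> l i j _; rewrite !coef0. Qed.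

Lemma tdeg3_leD n s u : tdeg3_le n s -> tdeg3_le n u -> tdeg3_le n (s + u).
Proof. by move=> sn un l i j nij; rewrite !coefD sn // un // addr0. Qed.

Lemma tdeg3_leN n s : tdeg3_le n s -> tdeg3_le n (- s).
Proof. by move=> sn l i j nij; rewrite !coefN sn // oppr0. Qed.

Lemma tdeg3_leB n s u : tdeg3_le n s -> tdeg3_le n u -> tdeg3_le n (s - u).
Proof. by move=> sn un; apply/tdeg3_leD/tdeg3_leN. Qed.

Lemma tdeg3_le_sum n (I : Type) (r : seq I) (p : pred I) (F : I -> {poly T}) :
  (forall i, p i -> tdeg3_le n (F i)) -> tdeg3_le n (\sum_(i <- r | p i) F i).
Proof. by move=> Fn; elim/big_ind: _ => // [|x y]; [apply: tdeg3_le0 | apply: tdeg3_leD]. Qed.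

Lemma tdeg_le_sum n (I : Type) (r : seq I) (p : pred I) (F : I -> T) :
  (forall i, p i -> tdeg_le n (F i)) -> tdeg_le n (\sum_(i <- r | p i) F i).
Proof. by move=> Fn; elim/big_ind: _ => // [|x y]; [apply: tdeg_le0 | apply: tdeg_leD]. Qed.

Lemma tdeg3_leM m n s u : tdeg3_le m s -> tdeg3_le n u -> tdeg3_le (m + n) (s * u).
Proof.
move=> sm un; apply: tdeg3P => l lmn; rewrite coefM; last first.
  apply: big1 => a _; have [am|ma] := leqP a m; last by rewrite (tdeg3_coef_gt sm ma) mul0r.
  by rewrite [u`__](tdeg3_coef_gt un) ?mulr0 //; have := ltn_ord a; lia.
apply: tdeg_le_sum => a _; have [am|ma] := leqP a m; last first.
  by rewrite (tdeg3_coef_gt sm ma) mul0r; apply: tdeg_le0.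
have [an|na] := leqP (l - a) n; last first.
  by rewrite [u`__](tdeg3_coef_gt un na) mulr0; apply: tdeg_le0.
have -> : (m + n - l = (m - a) + (n - (l - a)))%N by have := ltn_ord a; lia.
by apply: tdeg_leM; apply: tdeg3_coef.
Qed.

Lemma tdeg3_leXn n : tdeg3_le n ('X^n : {poly T}).
Proof.
move=> l i j nij; rewrite coefXn; case: eqP => [ln|_]; last by rewrite !coef0.
by rewrite coef1; case: j nij => [|j] nij; rewrite ?coef0 // coef1; case: i nij => // nij; lia.
Qed.

Lemma tdeg3_leC n (p : T) : tdeg_le n p -> tdeg3_le n p%:P.
Proof.
by move=> pn [|l] i j nij; rewrite coefC /= ?coef0 //; apply: pn; rewrite addn0 in nij.
Qed.

Lemma tdeg_le_exists (p : T) : exists n, tdeg_le n p.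
Proof. by exists (size (homog K p)); apply/tdeg_leP/leqnSn. Qed.

Lemma tdeg3_le_exists s : exists n, tdeg3_le n s.
Proof.
elim/poly_ind: s => [|s c [n sn]]; first by exists 0%N; apply: tdeg3_le0.
have [m cm] := tdeg_le_exists c; exists (n + 1 + m)%N; apply: tdeg3_leD.
  apply: (@tdeg3_le_mono (n + 1)); first exact: leq_addr.
  by apply: tdeg3_leM; rewrite // -['X]expr1; apply: tdeg3_leXn.
by apply/tdeg3_leC/(tdeg_le_mono _ cm)/leq_addl.
Qed.

Lemma tdeg_le_deriv2 n (p : T) : tdeg_le n p -> tdeg_le n (p^`()).
Proof. by move=> pn i j nij; rewrite coef_deriv coefMn pn ?mul0rn //; lia. Qed.

Lemma tdeg_le_deriv1 n (p : T) : tdeg_le n p -> tdeg_le n (map_poly (@deriv K) p).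
Proof.
by move=> pn i j nij; rewrite coef_map_id0 ?deriv0 // coef_deriv pn ?mul0rn //; lia.
Qed.

Lemma tdeg3_le_deriv n s : tdeg3_le n s -> tdeg3_le n (s^`()).
Proof. by move=> sn l i j nij; rewrite coef_deriv !coefMn sn ?mul0rn //; lia. Qed.

Lemma tdeg3_le_map n (d : T -> T) s : d 0 = 0 -> (forall m p, tdeg_le m p -> tdeg_le m (d p)) ->
  tdeg3_le n s -> tdeg3_le n (map_poly d s).
Proof.
move=> d0 dd sn; apply: tdeg3P => l ln; rewrite coef_map_id0 //.
  by apply/dd/tdeg3_coef.
by rewrite (tdeg3_coef_gt sn).
Qed.

(* Monic of degree [d] in the outer variable, with the coefficient of [X ^ i] of total
   degree at most [d - i]. *)
Definition wmonic d s := [/\ s \is monic, size s = d.+1 & tdeg3_le d s].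

Lemma wmonicM m n s u : wmonic m s -> wmonic n u -> wmonic (m + n) (s * u).
Proof.
move=> [ms ss sm] [mu su un]; split; [by rewrite monicMl | | exact: tdeg3_leM].
by rewrite size_monicM ?monic_neq0 // ss su addSn /= addnS.
Qed.

Lemma wmonic_quotient d n s u : wmonic d s -> tdeg3_le (d + n) (s * u) -> tdeg3_le n u.
Proof.
move=> [ms ss sd] sun.
suff H m l : (size u <= l + m)%N ->
    ((l <= n)%N -> tdeg_le (n - l) u`_l) /\ ((n < l)%N -> u`_l = 0).
  by apply: tdeg3P => l; have [] := H (size u) l (leq_addl _ _).
elim: m l => [|m IHm] l ulm.
  by rewrite addn0 in ulm; rewrite nth_default //; split=> // _; apply: tdeg_le0.
have lm a : (l < a)%N -> ((a <= n)%N -> tdeg_le (n - a) u`_a) /\ ((n < a)%N -> u`_a = 0).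
  by move=> la; apply: IHm; rewrite (leq_trans ulm) // addnS -addSn leq_add2r.
have key : u`_l = (s * u)`_(l + d) - \sum_(i < d) s`_i * u`_(l + d - i).
  pose F i := s`_i * u`_(l + d - i).
  rewrite coefM -(big_mkord xpredT F) -(big_mkord xpredT F) (big_cat_nat (n := d)) //=; last lia.
  rewrite [RHS]addrC addKr big_ltn; last lia.
  rewrite big_nat big1 => [|i /andP[di _]]; last by rewrite /F nth_default ?mul0r // ss.
  rewrite addr0 /F addnK; have := monicP ms.
  by rewrite lead_coefE ss /= => ->; rewrite mul1r.
split=> [ln|nl]; rewrite key.
  apply: tdeg_leD; last apply/tdeg_leN/tdeg_le_sum => i _.
    have -> : (n - l = d + n - (l + d))%N by lia.
    by apply: tdeg3_coef => //; lia.
  have il := ltn_ord i; have la : (l < l + d - i)%N by lia.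
  have [/(_ _)l1 l2] := lm _ la; have [an|na] := leqP (l + d - i) n; last first.
    by rewrite l2 // mulr0; apply: tdeg_le0.
  have -> : (n - l = (d - i) + (n - (l + d - i)))%N by lia.
  by apply: tdeg_leM; [apply: tdeg3_coef => //; lia | apply: l1].
rewrite (tdeg3_coef_gt sun); last lia.
rewrite big1 ?subr0 // => i _; have il := ltn_ord i.
have la : (l < l + d - i)%N by lia.
by have [_ ->] := lm _ la; rewrite ?mulr0 //; lia.
Qed.

End Degrees.

(** * Traces of Poisson primes *)

Section Core.
Variable R : realType.
Local Notation K := R[i].
Local Notation T := {poly {poly K}}.
Local Notation S := {poly T}.
Local Notation k := {fraction T}.
Local Notation "p %:F" := (@FracField.tofrac T p).
Variables (A : comAlgType K) (br : A -> A -> A).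
Hypotheses (fgA : finitely_generated A) (hbr : poisson_bracket br).
Variables (x1 x2 : A).
Local Notation h := (br x1 x2).
Local Notation ev2 := (ev2 x1 x2).
Local Notation ev3 := (ev3 x1 x2).

(* [{-, w} / h] acts on the subalgebra generated by [x1] and [x2] as the derivation [d]. *)
Definition direction (w : A) (d : T -> T) := [/\ derivation d,
  forall n p, tdeg_le n p -> tdeg_le n (d p) & forall p, br (ev2 p) w = h * ev2 (d p)].

Lemma br_derivation (B : comNzRingType) (phi : {rmorphism B -> A}) w :
  derivation_along phi (fun p => br (phi p) w).
Proof. by split=> x y; rewrite ?rmorphD ?rmorphM /= ?(brDl hbr) // (brMl hbr) addrC. Qed.

Lemma scale_derivation (B : comNzRingType) (phi : {rmorphism B -> A}) (c : A) (d : B -> B) :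
  derivation d -> derivation_along phi (fun p => c * phi (d p)).
Proof.
move=> dP; split=> x y; first by rewrite (derD dP) rmorphD mulrDr.
by rewrite (derM dP) rmorphD !rmorphM /= mulrDr mulrA mulrCA.
Qed.

Lemma ev1X : ev1 x1 'X = x1. Proof. exact: evalpX. Qed.
Lemma ev2X : ev2 'X = x2. Proof. exact: evalpX. Qed.

Lemma ev3E z (p : S) : ev3 z p = evalp ev2 z p. Proof. by []. Qed.

Lemma direction1 : direction x2 (map_poly (@deriv K)).
Proof.
have dP := map_poly_derivation (@deriv_derivation K).
split; [exact: dP | exact: tdeg_le_deriv1 |].
apply: (der_eq_poly (br_derivation ev2 x2) (scale_derivation ev2 h dP)).
  move=> p; rewrite map_polyC !ev2C /=; move: p.
  apply: (der_eq_poly (br_derivation (ev1 x1) x2)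
    (scale_derivation (ev1 x1) h (@deriv_derivation K))).
    by move=> c; rewrite derivC rmorph0 mulr0 ev1C (br_alg hbr).
  by rewrite derivX rmorph1 mulr1 ev1X.
have -> : map_poly (@deriv K) 'X = 0.
  by apply/polyP => i; rewrite coef_map_id0 ?deriv0 // coefX coef0 -polyC_natr derivC.
by rewrite ev2X rmorph0 mulr0; case: hbr => _ _ ->.
Qed.

(** The sign turns the bracket of [x2] with [- x1] into [h]. *)
Lemma direction2 : direction (- x1) (@deriv {poly K}).
Proof.
have dP := @deriv_derivation {poly K}.
split; [exact: dP | exact: tdeg_le_deriv2 |].
apply: (der_eq_poly (br_derivation ev2 (- x1)) (scale_derivation ev2 h dP)).
  move=> p; rewrite derivC rmorph0 mulr0 ev2C; move: p.
  have zP : derivation_along (ev1 x1) (fun _ : {poly K} => 0 : A).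
    by split=> x y; rewrite ?addr0 // mul0r mulr0 addr0.
  apply: (der_eq_poly (br_derivation (ev1 x1) (- x1)) zP).
    by move=> c; rewrite ev1C (br_alg hbr).
  by rewrite ev1X (brC hbr) (brNl hbr) opprK; case: hbr => _ _ ->.
by rewrite derivX rmorph1 mulr1 ev2X (brC hbr) (brNl hbr) opprK.
Qed.

Variable Q : A -> Prop.
Hypotheses (pQ : poisson_prime br Q) (Qh : ~ Q h).

Lemma poisson_prime_ev2 p : Q (ev2 p) -> p = 0.
Proof.
have [[idQ Q1 QM] Qbr] := pQ.
have down w d p' : direction w d -> Q (ev2 p') -> Q (ev2 (d p')).
  by move=> [_ _ E] /(Qbr _ w); rewrite E => /QM[].
have const p' : tdeg_le 0 p' -> Q (ev2 p') -> p' = 0.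
  move=> p0; have -> : p' = (p'`_0`_0)%:P%:P.
    apply: tdeg_eq0; move/tdeg_leP: p0; rewrite /tdeg; by case: size => [|[]].
  by rewrite ev2C ev1C => /(alg_neq0 pQ.1) ->.
(* Induction on the total degree: both partial derivatives vanish, so in characteristic zero [p] is
   constant, and a prime contains no nonzero constant. *)
have [n] := tdeg_le_exists p; elim: n p => [|n IHn] p pn Qp; first exact: const.
have d2 : p^`() = 0.
  apply: IHn (down _ _ _ direction2 Qp) => i j nij.
  by rewrite coef_deriv coefMn pn ?mul0rn //; lia.
have d1 : map_poly (@deriv K) p = 0.
  apply: IHn (down _ _ _ direction1 Qp) => i j nij.
  by rewrite coef_map_id0 ?deriv0 // coef_deriv pn ?mul0rn //; lia.
apply: const => // i j; rewrite lt0n addn_eq0 negb_and => /orP[i0|j0].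
  have /(congr1 (fun q : T => q`_j`_i.-1)) := d1.
  rewrite coef_map_id0 ?deriv0 // coef_deriv prednK ?lt0n // !coef0 => /eqP.
  by rewrite mulrn_eq0 (negPf i0) => /eqP.
have /(congr1 (fun q : T => q`_j.-1`_i)) := d2.
rewrite coef_deriv prednK ?lt0n // coefMn !coef0 => /eqP.
by rewrite mulrn_eq0 (negPf j0) => /eqP.
Qed.

(** A monic equation for [beta] whose coefficients have the degrees to be expected if [beta] has
    weight [e]. *)
Definition integral_bound x3 e (beta : A) := exists P : {poly S}, [/\ P \is monic, (1 < size P)%N,
  forall b, (b < (size P).-1)%N -> tdeg3_le (((size P).-1 - b) * e) P`_b &
  evalp (ev3 x3) beta P = 0].

(** The functional is the trace of [Frac (A / Q)] over [k]. Its values lie in the rational function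
    field in [x1] and [x2], which does not depend on [Q], so functionals of different primes can be
    compared. *)
Lemma exists_trace : (forall z, exists p : S, p != 0 /\ Q (ev3 z p)) ->
  exists t : A -> k, [/\ forall a b, t (a + b) = t a + t b,
    forall p a, t (ev2 p * a) = p%:F * t a,
    forall a, Q a -> t a = 0,
    t 1 != 0 &
    (forall w d dk a a', direction w d -> derivation dk -> (forall p, dk p%:F = (d p)%:F) ->
      h * a' = br a w -> t a' = dk (t a)) /\
    forall x3 d q e beta, wmonic d.+1 q -> Q (ev3 x3 q) -> integral_bound x3 e beta ->
      forall i, exists p, t (x3 ^+ i * beta) = p%:F /\ tdeg_le (i + e) p].
Proof.
move=> algQ; have [[idQ Q1 QM] Qbr] := pQ.
have [L [psi [ker fracL]]] := residue_field pQ.1.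
have psih : psi h != 0 by apply/eqP => /ker.
have [iota iotaE] : exists iota : {rmorphism k -> L}, forall p, iota p%:F = psi (ev2 p).
  apply: (@fraction_lift _ _ _ (@FracField.tofrac T) (psi \o ev2)).
    exact: fraction_map_tofrac.
  move=> p; split=> [/eqP|/ker/poisson_prime_ev2->]; last exact: tofrac0.
  by rewrite tofrac_eq0 => /eqP->; rewrite rmorph0.
have evL z (p : S) : psi (ev3 z p) = evalp (iota \o @FracField.tofrac T) (psi z) p.
  rewrite ev3E (evalp_sum _ _ (leqnn _)) (evalp_sum _ _ (leqnn _)) rmorph_sum /=.
  by apply: eq_bigr => i _; rewrite rmorphM rmorphXn /= iotaE.
have [B _] : exists (B : field_basis iota) (y : 'I_(bdim B) -> A),
  (exists i0, y i0 = 1) /\ forall i, bvec i = psi (y i).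
  apply: (finite_basis fgA fracL).
    by move=> c; exists (c%:P%:P)%:F; rewrite iotaE ev2C ev1C.
  move=> a; have [p [p0 /ker]] := algQ a; rewrite evL => pa.
  exists (map_poly (@FracField.tofrac T) p); rewrite map_poly_eq0_id0 ?tofrac_eq0 ?lead_coef_eq0 //.
  by split=> //; rewrite /root -map_poly_comp; apply/eqP.
have char0 m : m.+1%:R != 0 :> k.
  by rewrite -(rmorph_nat (@FracField.tofrac T)) tofrac_eq0 -!polyC_natr !polyC_eq0 pnatr_eq0.
exists (fun a => ftr B (psi a)); split.
- by move=> a b; rewrite rmorphD ftrD.
- by move=> p a; rewrite rmorphM /= -iotaE ftrZ.
- by move=> a /ker ->; rewrite ftr0.
- by rewrite rmorph1; apply: ftr1_neq0.
split=> [w d dk a a' [dP _ dE] dkP dkE E|x3 d q e beta [mq sq qd] Qq [P [mP sP Pd P0]] i].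
  have derpsi : derivation_along psi (fun a => psi (br a w) / psi h).
    split=> x y; first by rewrite (brDl hbr) rmorphD mulrDl.
    by rewrite (brMl hbr) rmorphD !rmorphM /= mulrDl mulrC; ring.
  have [|D [DP DE]] := der_fraction_lift fracL derpsi.
    by move=> c /ker/(Qbr _ w)/ker ->; rewrite mul0r.
  have -> : psi a' = D (psi a) by rewrite DE -E rmorphM mulrC mulKf.
  apply: derivation_ftr => //.
  apply: (@der_eq_fraction _ _ _ (@FracField.tofrac T) iota (D \o iota) (iota \o dk)).
  - exact: fraction_map_tofrac.
  - by split=> x y /=; rewrite ?rmorphD ?rmorphM ?(derD DP) ?(derM DP).
  - by split=> x y /=; rewrite ?(derD dkP) ?(derM dkP) ?rmorphD ?rmorphM.
  by move=> p /=; rewrite iotaE DE dE rmorphM mulrC mulKf // dkE iotaE.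
case sPE: (size P) sP Pd => [|[|m]] // _ /= Pd.
have {P0} betaE : psi beta ^+ m.+1 = \sum_(b < m.+1)
    evalp (iota \o @FracField.tofrac T) (psi x3) (- P`_b) * psi beta ^+ b.
  have := congr1 psi P0; rewrite (@evalp_sum _ _ _ _ _ m.+2) ?sPE // rmorph0 rmorph_sum /=.
  rewrite big_ord_recr /=; have := monicP mP; rewrite lead_coefE sPE /= => ->.
  rewrite rmorph1 mul1r rmorphXn addrC => /eqP; rewrite addr_eq0 => /eqP->.
  by rewrite -sumrN; apply: eq_bigr => b _; rewrite -evL rmorphM !rmorphN mulNr rmorphXn.
have alphaE : psi x3 ^+ d.+1 = \sum_(a < d.+1) iota (- q`_a)%:F * psi x3 ^+ a.
  have /ker := Qq; rewrite ev3E (@evalp_sum _ _ _ _ _ d.+2) ?sq // rmorph_sum /=.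
  rewrite big_ord_recr /=; have := monicP mq; rewrite lead_coefE sq /= => ->.
  rewrite rmorph1 mul1r rmorphXn addrC => /eqP; rewrite addr_eq0 => /eqP->.
  by rewrite -sumrN; apply: eq_bigr => a _; rewrite rmorphM rmorphXn iotaE !rmorphN mulNr.
have [||p [pE pd]] := @trace_poly_bound _ _ _ B d m e _ _
    (fun a : 'I_d.+1 => - q`_a) (fun b : 'I_m.+1 => - P`_b) i alphaE _ betaE.
- by move=> a; apply/tdeg_leN/tdeg3_coef => //; apply/ltnW.
- by move=> b; apply/tdeg3_leN/Pd.
by exists p; rewrite rmorphM rmorphXn.
Qed.

End Core.

Lemma map_moment_num (B C : comNzRingType) (phi : {rmorphism B -> C}) (q : {poly B}) t :
  size (map_poly phi q) = size q ->
  map_poly phi (moment_num q t) = moment_num (map_poly phi q) (phi \o t).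
Proof.
move=> sq; rewrite /moment_num sq rmorph_sum; apply: eq_bigr => l _.
rewrite rmorph_sum; apply: eq_bigr => j _.
by rewrite /= map_polyZ map_polyXn rmorphM coef_map.
Qed.

Lemma tdeg3_le_moment_num (K : closedFieldType) d e (q : {poly {poly {poly K}}}) t :
  wmonic d.+1 q -> (forall i, tdeg_le (i + e) (t i)) -> tdeg3_le (d + e) (moment_num q t).
Proof.
move=> [_ sq qd] te; apply: tdeg3_le_sum => l _; apply: tdeg3_le_sum => j _.
have jl := ltn_ord j; have := ltn_ord l; rewrite [X in (_ < X)%N]sq => ld.
rewrite -mul_polyC; apply: (@tdeg3_le_mono _ ((d.+1 - l) + (j + e) + (l.-1 - j))); first lia.
apply: tdeg3_leM; last exact: tdeg3_leXn.
by apply/tdeg3_leC/tdeg_leM => //; apply: tdeg3_coef.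
Qed.

Lemma fraction_sum (F : fieldType) (s c x a b : F) : c != 0 -> b != 0 ->
  s / c * x + a / b = (s * x * b + a * c) / (c * b).
Proof. by move=> c0 b0; field; rewrite c0 b0. Qed.

Lemma fraction_den_aux (F : fieldType) (u c d s : F) : u != 0 -> c != 0 -> d != 0 ->
  c * u * (s / c / (u / d)) = s * d.
Proof. by move=> u0 c0 d0; field; rewrite u0 c0 d0. Qed.

Lemma mulACA_aux (F : fieldType) (a b c : F) : a * b * c = b * (a * c).
Proof. by ring. Qed.

(** * Leaf forms *)

Section Inclusion.
Variables (T : idomainType) (k : fieldType) (tT : {rmorphism T -> k}).
Hypotheses (tT_inj : injective tT) (tT_frac : fraction_map tT).
Local Notation S := {poly T}.
Local Notation E := {fraction {poly k}}.
Local Notation tE := (@FracField.tofrac {poly k}).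

Definition inc : {rmorphism S -> E} := tE \o map_poly tT.

Arguments inc : simpl never.

Lemma incE s : inc s = tE (map_poly tT s). Proof. by []. Qed.

Lemma inc_eq0 s : (inc s == 0) = (s == 0).
Proof.
have mI := map_inj_poly tT_inj (rmorph0 tT).
by rewrite incE tofrac_eq0 -(inj_eq mI) rmorph0.
Qed.

Lemma incC p : inc p%:P = tE (tT p)%:P.
Proof. by rewrite incE map_polyC. Qed.

Lemma incXn i : inc 'X^i = tE 'X^i.
Proof. by rewrite incE map_polyXn. Qed.

Lemma poly_den (p : {poly k}) : exists (c : T) (s : S), c != 0 /\ tE p = inc s / inc c%:P.
Proof.
elim/poly_ind: p => [|p c [c1 [s1 [c10 E1]]]].
  by exists 1, 0; rewrite oner_neq0 (rmorph0 inc) mul0r tofrac0.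
have tT0 b : (tT b == 0) = (b == 0) by rewrite -(inj_eq tT_inj) rmorph0.
have [a [b [b0 ->]]] := tT_frac c; rewrite tT0 in b0.
have i0 (c' : T) : c' != 0 -> inc c'%:P != 0 by rewrite inc_eq0 polyC_eq0.
exists (c1 * b), (s1 * 'X * b%:P + a%:P * c1%:P); split; first by rewrite mulf_neq0.
rewrite tofracD tofracM E1 (polyCM c1 b) !(rmorphD inc) !(rmorphM inc).
have -> : tE 'X = inc 'X by rewrite incE map_polyX.
have -> : tE (tT a / tT b)%:P = inc a%:P / inc b%:P.
  rewrite polyCM tofracM -incC; congr (_ * _).
  apply: (mulIf (i0 _ b0)); rewrite mulVf ?i0 // incC -tofracM -polyCM mulVf ?tT0 //.
by rewrite fraction_sum ?i0.
Qed.

Lemma fraction_den (r : E) : exists G s : S, G != 0 /\ inc G * r = inc s.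
Proof.
have [a [b [b0 ->]]] := tofracP r.
have [c [s [c0 Ea]]] := poly_den a; have [d [u [d0 Eb]]] := poly_den b.
have i0 (c' : T) : c' != 0 -> inc c'%:P != 0 by rewrite inc_eq0 polyC_eq0.
have u0 : u != 0.
  by rewrite -inc_eq0; apply: contraNneq b0 => u0; apply/eqP; rewrite Eb u0; apply: mul0r.
exists (c%:P * u), (s * d%:P); rewrite mulf_neq0 ?polyC_eq0 //; split=> //.
rewrite Ea Eb !(rmorphM inc); move: (i0 _ c0) (i0 _ d0).
have : inc u != 0 by rewrite inc_eq0.
move: (inc u) (inc c%:P) (inc d%:P) (inc s) => u' c' d' s'.
exact: fraction_den_aux.
Qed.

Lemma common_den (I : finType) (r : I -> E) :
  exists G : S, G != 0 /\ forall i, exists s, inc G * r i = inc s.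
Proof.
have /choice[G] : forall i, exists G : S, exists s, G != 0 /\ inc G * r i = inc s.
  by move=> i; apply: fraction_den.
move=> /choice[s GsP]; exists (\prod_i G i); split.
  by apply/prodf_neq0 => i _; case: (GsP i).
move=> i; exists ((\prod_(j | j != i) G j) * s i).
have [_ E1] := GsP i; by rewrite (bigD1 i) // !(rmorphM inc) -E1 mulACA_aux.
Qed.

End Inclusion.

Lemma leaf_aux (F : fieldType) (q a b : F) : q != 0 -> a / q * b = b * (a * q) / q ^+ 2.
Proof. by move=> q0; field. Qed.

Lemma leaf_aux2 (F : fieldType) (q g g' x N : F) :
  q != 0 -> g' * x = N / q -> g * N = q * (g' * (g * x)).
Proof. by move=> q0; rewrite (mulrCA g') => ->; rewrite [RHS]mulrCA [q * _]mulrC divfK. Qed.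

Lemma leaf_aux3 (F : fieldType) (q g g' x N M : F) :
  q != 0 -> g' * x = N / q -> g * N = q * M -> g * g' * x = M.
Proof. by move=> q0 gx gN; rewrite -mulrA gx mulrA gN mulrAC mulfV ?mul1r. Qed.

Arguments inc : simpl never.

Section Leaf.
Variable R : realType.
Local Notation K := R[i].
Local Notation T := {poly {poly K}}.
Local Notation S := {poly T}.
Variables (k : fieldType) (tT : {rmorphism T -> k}).
Hypothesis tT_inj : injective tT.
Local Notation E := {fraction {poly k}}.
Local Notation tE := (@FracField.tofrac {poly k}).
Local Notation inc := (inc tT).
Variables (A : comAlgType K) (br : A -> A -> A).
Variables (x1 x2 x3 : A).
Local Notation h := (br x1 x2).
Local Notation ev2 := (ev2 x1 x2).
Local Notation ev3 := (ev3 x1 x2 x3).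
Variables (F : fieldType) (psi : {rmorphism A -> F}) (iE : {rmorphism E -> F}).
Variables (B : field_basis iE) (y : 'I_(bdim B) -> A) (e : 'I_(bdim B) -> F).
Local Notation n := (bdim B).
Hypotheses (psi_inj : injective psi) (h0 : h != 0).
Hypothesis iE_inc : forall s, iE (inc s) = psi (ev3 s).
Hypothesis yE : forall j, bvec j = psi (y j).
Hypothesis eb : forall i j, ftr B (e i * bvec j) = (i == j)%:R.
Variables (D3 : F -> F) (d3 : E -> E).
Hypotheses (d3P : derivation d3) (d3E : forall p, d3 (tE p) = tE (p^`())).
Hypotheses (D3P : derivation D3) (D3E : forall r, D3 (iE r) = iE (d3 r)).

Implicit Types (s u : S) (f g : F) (a : A).

Definition pairing f : k := residue (ftr B f).

Lemma pairingD f g : pairing (f + g) = pairing f + pairing g.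
Proof. by rewrite /pairing ftrD residueD. Qed.

Lemma pairing0 : pairing 0 = 0.
Proof. by apply: (addrI (pairing 0)); rewrite -pairingD !addr0. Qed.

Lemma pairing_sum (I : Type) (r : seq I) (p : pred I) (G : I -> F) :
  pairing (\sum_(i <- r | p i) G i) = \sum_(i <- r | p i) pairing (G i).
Proof. by elim/big_rec2: _ => [|i u v _ <-]; rewrite ?pairing0 ?pairingD. Qed.

Lemma pairingZ p f : pairing (psi (ev2 p) * f) = tT p * pairing f.
Proof.
have -> : psi (ev2 p) = iE (tE (tT p)%:P) by rewrite -incC iE_inc ev3C.
by rewrite /pairing ftrZ residueZ.
Qed.

Lemma ev3_sum s : ev3 s = \sum_(i < size s) ev2 s`_i * x3 ^+ i.
Proof. exact: (evalp_sum _ _ (leqnn _)). Qed.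

Section Functional.
Variable t : A -> k.
Hypotheses (tD : forall a b, t (a + b) = t a + t b) (tZ : forall p a, t (ev2 p * a) = tT p * t a).
Variables (d : nat) (q : S) (tau : nat -> 'I_n -> T).
Hypotheses (mq : wmonic d.+1 q) (qt : forall a, t (ev3 q * a) = 0).
Hypothesis tauE : forall i j, t (x3 ^+ i * y j) = tT (tau i j).

Definition moment j := moment_num q (tau^~ j).
(* The element of [F] representing [t] under the residue pairing: by Cauchy's formula at
   infinity, [moment j / q] has residues [t (x3 ^ i * y j)] against [X ^ i]. *)
Definition leaf_form : F := \sum_j iE (inc (moment j) / inc q) * e j.

Lemma t_sum (I : Type) (r : seq I) (p : pred I) (G : I -> A) :
  t (\sum_(i <- r | p i) G i) = \sum_(i <- r | p i) t (G i).
Proof.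
have t0 : t 0 = 0 by apply: (addrI (t 0)); rewrite -tD !addr0.
by elim/big_rec2: _ => [|i u v _ <-]; rewrite ?t0 ?tD.
Qed.

Lemma ftr_leaf_form j : ftr B (leaf_form * psi (y j)) = inc (moment j) / inc q.
Proof.
rewrite mulr_suml ftr_sum (bigD1 j) //= big1 ?addr0 => [|l lj].
  by rewrite -mulrA ftrZ -yE eb eqxx mulr1.
by rewrite -mulrA ftrZ -yE eb (negPf lj) mulr0.
Qed.

Lemma size_tT s : size (map_poly tT s) = size s.
Proof. by rewrite (size_map_inj_poly tT_inj) ?rmorph0. Qed.

Lemma pairing_monomial i j : pairing (leaf_form * psi (x3 ^+ i * y j)) = t (x3 ^+ i * y j).
Proof.
have [monq sq _] := mq.
have -> : leaf_form * psi (x3 ^+ i * y j) = iE (tE 'X^i) * (leaf_form * psi (y j)).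
  rewrite -(incXn tT) iE_inc rmorphXn (_ : ev3 'X = x3); last exact: evalpX.
  by rewrite rmorphM mulrCA mulrA.
rewrite /pairing ftrZ ftr_leaf_form !incE (map_moment_num _ (size_tT q)).
rewrite residue_moments ?size_tT ?sq // ?tauE //; first exact: monic_map.
(* The recurrence required by [residue_moments] is the vanishing of [t] on the multiples of
   [ev3 q]. *)
move=> i'; rewrite -[RHS](qt (x3 ^+ i' * y j)) ev3_sum mulr_suml t_sum sq.
apply: eq_bigr => l _; rewrite coef_map /= -mulrA tZ mulrA -exprD addnC tauE //.
Qed.

(** Only the combinations of the [y j] over [S] are reached. They need not exhaust [A], whence the
    denominators [G] below. *)
Lemma pairing_leaf_form (s : 'I_n -> S) :
  pairing (leaf_form * psi (\sum_j ev3 (s j) * y j)) = t (\sum_j ev3 (s j) * y j).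
Proof.
rewrite (rmorph_sum psi) mulr_sumr pairing_sum t_sum; apply: eq_bigr => j _.
have -> : ev3 (s j) * y j = \sum_(i < size (s j)) ev2 (s j)`_i * x3 ^+ i * y j.
  by rewrite ev3_sum mulr_suml.
rewrite (rmorph_sum psi) mulr_sumr pairing_sum t_sum; apply: eq_bigr => i _.
by rewrite -mulrA rmorphM mulrCA pairingZ tZ pairing_monomial.
Qed.

End Functional.

Section Direction.
Variables (w : A) (dl : T -> T) (dk : k -> k) (dE : E -> E) (V Dt : F -> F).
Hypotheses (dirP : direction br x1 x2 w dl) (dkP : derivation dk).
Hypothesis dkE : forall p, dk (tT p) = tT (dl p).
Hypotheses (dEP : derivation dE) (dEE : forall p, dE (tE p) = tE (map_poly dk p)).
Hypotheses (VP : derivation V) (VE : forall a, V (psi a) = psi (br a w) / psi h).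
Hypotheses (DtP : derivation Dt) (DtE : forall r, Dt (iE r) = iE (dE r)).
Local Notation pw := (V (psi x3)).
Hypothesis Vdecomp : forall f, V f = Dt f + pw * D3 f.

(* The adjoint of [V] for the residue pairing, i.e. the Lie derivative of the density [f]. *)
Definition lie f := V f + D3 pw * f.

Lemma lieD f g : lie (f + g) = lie f + lie g.
Proof. by rewrite /lie (derD VP) mulrDr addrACA. Qed.

Lemma lieM f g : lie (f * g) = lie f * g + f * V g.
Proof. by rewrite /lie (derM VP) /= mulrDl -!mulrA addrAC. Qed.

Lemma pairing_lie f : pairing (lie f) = dk (pairing f).
Proof.
(* The first part commutes with trace and residue; the second is an exact derivative in the variable
   of the residue and contributes nothing. *)
have -> : lie f = Dt f + D3 (pw * f).
  by rewrite /lie Vdecomp (derM D3P) /= -addrA; congr (_ + _); rewrite addrC.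
rewrite pairingD /pairing (derivation_ftr _ dEP DtP) // (derivation_ftr _ d3P D3P) //.
by rewrite (residue_deriv d3P d3E) addr0 (residue_coef dkP dEP dEE).
Qed.

Lemma dE_inc s : dE (inc s) = inc (map_poly dl s).
Proof.
have [dlP _ _] := dirP; rewrite !incE dEE; congr (tE _); apply/polyP => i.
by rewrite !coef_map_id0 ?(der0 dkP) ?(der0 dlP) ?rmorph0.
Qed.

Lemma d3_inc s : d3 (inc s) = inc (s^`()).
Proof. by rewrite !incE d3E deriv_map. Qed.

Lemma V_iE r : V (iE r) = iE (dE r) + pw * iE (d3 r).
Proof. by rewrite Vdecomp DtE D3E. Qed.

Variables (G : S) (s1 s2 : 'I_n -> 'I_n -> S).
Hypothesis s1E : forall j l, inc G * bco B (pw * psi (y j)) 0 l = inc (s1 j l).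
Hypothesis s2E : forall j l, inc G * bco B (V (psi (y j))) 0 l = inc (s2 j l).

(** Differentiation may consume one factor of [G ^ 2]; the other clears the denominators of
    [pw * psi (y j)] and [V (psi (y j))]. *)
Lemma V_monomial i j : exists s : 'I_n -> S,
  V (psi (ev3 (G ^+ 2 * 'X^i) * y j)) = psi (\sum_l ev3 (s l) * y l).
Proof.
have [dlP _ _] := dirP.
pose g := G ^+ 2 * 'X^i.
pose g3 := (G^`() *+ 2) * 'X^i + G * ('X^i)^`().
have g3E : g^`() = G * g3.
  by rewrite /g /g3 derivM expr2 derivM; ring.
exists (fun l => (if l == j then map_poly dl g else 0) + g3 * s1 j l + (G * 'X^i) * s2 j l).
have sumE f (s' : 'I_n -> S) : (forall l, inc G * bco B f 0 l = inc (s' l)) ->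
    iE (inc G) * f = \sum_l iE (inc (s' l)) * psi (y l).
  move=> fE; rewrite {1}[f](bcoK B) mulr_sumr; apply: eq_bigr => l _.
  by rewrite mulrA -rmorphM fE yE.
have E1 := sumE _ _ (s1E j); have E2 := sumE _ _ (s2E j).
have evM u v : iE (inc (u * v)) = iE (inc u) * iE (inc v) by rewrite !rmorphM.
have evD u v : iE (inc (u + v)) = iE (inc u) + iE (inc v) by rewrite !rmorphD.
have i0 : iE (inc 0) = 0 by rewrite !rmorph0.
have split3 u1 u2 u3 l : psi (ev3 (u1 + u2 + u3) * y l) =
    iE (inc u1) * psi (y l) + iE (inc u2) * psi (y l) + iE (inc u3) * psi (y l).
  by rewrite (rmorphM psi) -iE_inc (evD (u1 + u2) u3) (evD u1 u2) !mulrDl.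
have -> : psi (\sum_l ev3 ((if l == j then map_poly dl g else 0) + g3 * s1 j l + G * 'X^i * s2 j l) * y l) =
    \sum_l (iE (inc ((if l == j then map_poly dl g else 0))) * psi (y l)
      + iE (inc g3) * (iE (inc (s1 j l)) * psi (y l))
      + iE (inc (G * 'X^i)) * (iE (inc (s2 j l)) * psi (y l))).
  rewrite (rmorph_sum psi); apply: eq_bigr => l _.
  rewrite split3 (evM g3 (s1 j l)) (evM (G * 'X^i) (s2 j l)).
  by congr (_ + _ + _); apply: esym; apply: mulrA.
rewrite !big_split /= -!mulr_sumr -E1 -E2 (bigD1 j) //= eqxx big1 ?addr0; last first.
  by move=> l /negPf->; rewrite i0 mul0r.
rewrite (rmorphM psi) -iE_inc (derM VP) /= V_iE dE_inc d3_inc g3E /g expr2 -mulrA !(evM G).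
by move: (iE _) (iE _) (iE _) (iE _) (psi _) (V _) (V _) => a1 a2 a3 a4 a5 a6 a7; ring.
Qed.

Section Apply.
Variable t : A -> k.
Hypotheses (tD : forall a b, t (a + b) = t a + t b) (tZ : forall p a, t (ev2 p * a) = tT p * t a).
Hypothesis tV : forall a a', h * a' = br a w -> t a' = dk (t a).
Variables (d : nat) (q : S) (tau : nat -> 'I_n -> T).
Hypotheses (mq : wmonic d.+1 q) (qt : forall a, t (ev3 q * a) = 0).
Hypothesis tauE : forall i j, t (x3 ^+ i * y j) = tT (tau i j).
Local Notation la := (leaf_form q tau).

(** Integration by parts: the pairing of [lie la] with [g] is [dk (t g)] minus the value of [t] at
    the image of [g] under [V], and this is zero as [t] commutes with the derivation. A function
    without residue against any power of [X] is a polynomial. *)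
Lemma lie_leaf_form_poly l :
  exists p : {poly k}, inc (G ^+ 2) * ftr B (lie la * psi (y l)) = tE p.
Proof.
have rep := pairing_leaf_form tD tZ mq qt tauE.
apply: residue_detect => i; rewrite -(incXn tT) mulrA -rmorphM -ftrZ -/(pairing _).
set g := ev3 (G ^+ 2 * 'X^i) * y l.
have -> : iE (inc ('X^i * G ^+ 2)) * (lie la * psi (y l)) = lie la * psi g.
  by rewrite iE_inc /g ['X^i * G ^+ 2]mulrC (rmorphM psi) mulrCA.
have -> : pairing (lie la * psi g) = pairing (lie (la * psi g)) - pairing (la * V (psi g)).
  by rewrite lieM pairingD addrK.
have [s Vg] := V_monomial i l; rewrite -/g in Vg.
have gE : g = \sum_j ev3 (if j == l then G ^+ 2 * 'X^i else 0) * y j.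
  rewrite (bigD1 l) //= eqxx big1 ?addr0 // => j /negPf->.
  by rewrite rmorph0 mul0r.
rewrite pairing_lie Vg rep {1}gE rep -gE; apply/eqP; rewrite subr_eq0; apply/eqP/esym/tV.
by apply: psi_inj; rewrite rmorphM -Vg VE mulrC divfK // -(rmorph0 psi) (inj_eq psi_inj).
Qed.

Variables (G' : S) (c1 c2 : 'I_n -> 'I_n -> S) (D ee : nat).
Hypothesis c1E : forall j l, inc G' * ftr B (pw * e j * psi (y l)) = inc (c1 j l).
Hypothesis c2E : forall j l, inc G' * ftr B (lie (e j) * psi (y l)) = inc (c2 j l).
Hypotheses (GD : tdeg3_le D G) (G'D : tdeg3_le D G').
Hypotheses (c1D : forall j l, tdeg3_le D (c1 j l)) (c2D : forall j l, tdeg3_le D (c2 j l)).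
Hypothesis tauD : forall i j, tdeg_le (i + ee) (tau i j).

(** The numerator over [q ^ 2] of the Lie derivative of the fractions [moment / q], after [G'] has
    cleared the denominators coming from the dual basis. *)
Definition lie_num l : S :=
  G' * (map_poly dl (moment q tau l) * q - moment q tau l * map_poly dl q)
  + \sum_j (c1 j l * ((moment q tau j)^`() * q - moment q tau j * q^`())
            + c2 j l * (moment q tau j * q)).

Lemma inc_q0 : inc q != 0.
Proof. by case: mq => monq _ _; rewrite inc_eq0 ?monic_neq0. Qed.

Lemma ftr_lie_leaf_form l :
  inc G' * ftr B (lie la * psi (y l)) = inc (lie_num l) / inc q ^+ 2.
Proof.
have q0 := inc_q0.
pose tj j := inc (moment q tau j) / inc q.
have lie_sum (f : 'I_n -> F) : lie (\sum_j f j) = \sum_j lie (f j).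
  have lie0 : lie 0 = 0 by apply: (addrI (lie 0)); rewrite -lieD !addr0.
  by elim/big_rec2: _ => [|j u v _ <-]; rewrite ?lie0 ?lieD.
have lie_term j : lie (iE (tj j) * e j) = iE (dE (tj j)) * e j + iE (d3 (tj j)) * (pw * e j)
    + iE (tj j) * lie (e j).
  rewrite [X in lie X]mulrC lieM V_iE.
  by move: (iE (tj j)) (iE (dE _)) (iE (d3 _)) (e j) (lie _) (V _) => a1 a2 a3 a4 a5 a6; ring.
have dtj (d0 : E -> E) (d0' : S -> S) : derivation d0 -> (forall s, d0 (inc s) = inc (d0' s)) ->
    forall j, d0 (tj j) =
      inc (d0' (moment q tau j) * q - moment q tau j * d0' q) / inc q ^+ 2.
  move=> d0P d0E j; rewrite (der_fraction _ d0P) //= !d0E.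
  by rewrite -!(rmorphM inc) -(rmorphB inc).
have E3 := dtj _ _ d3P d3_inc; have E1 := dtj _ _ dEP dE_inc.
have ftr_term j : ftr B (lie (iE (tj j) * e j) * psi (y l)) =
    dE (tj j) * (j == l)%:R + d3 (tj j) * ftr B (pw * e j * psi (y l))
    + tj j * ftr B (lie (e j) * psi (y l)).
  rewrite lie_term (mulrDl _ _ (psi (y l))) (mulrDl _ _ (psi (y l))) !ftrD.
  rewrite -(mulrA (iE (dE _))) -(mulrA (iE (d3 _))) -(mulrA (iE (tj j)) (lie _)).
  by rewrite !ftrZ -yE eb.
rewrite /leaf_form lie_sum mulr_suml ftr_sum mulr_sumr.
rewrite (eq_bigr _ (fun j _ => congr1 (fun z => inc G' * z) (ftr_term j))).
pose N1 j := c1 j l * ((moment q tau j)^`() * q - moment q tau j * q^`()).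
pose N2 j := c2 j l * (moment q tau j * q).
have -> : inc (lie_num l) / inc q ^+ 2 = inc G' * dE (tj l) +
    \sum_j (inc (N1 j) / inc q ^+ 2 + inc (N2 j) / inc q ^+ 2).
  rewrite E1 mulrA -(rmorphM inc) /lie_num (rmorphD inc) [LHS]mulrDl; congr (_ + _).
  rewrite (rmorph_sum inc) mulr_suml; apply: eq_bigr => j _.
  by rewrite (rmorphD inc) [LHS]mulrDl.
under eq_bigr do rewrite -addrA mulrDr.
rewrite big_split; congr (_ + _).
  by rewrite (bigD1 l) //= eqxx mulr1 big1 ?addr0 // => j /negPf->; rewrite !mulr0.
apply: eq_bigr => j _.
rewrite mulrDr !(mulrCA (inc G')) c1E c2E E3; congr (_ + _).
  have -> : inc (N1 j) = inc (c1 j l) * inc ((moment q tau j)^`() * q - moment q tau j * q^`()).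
    exact: rmorphM.
  by rewrite mulrC mulrA.
have -> : inc (N2 j) = inc (c2 j l) * (inc (moment q tau j) * inc q).
  by rewrite -!(rmorphM inc).
rewrite /tj.
apply: (leaf_aux (inc (moment q tau j)) (inc (c2 j l)) q0).
Qed.

(** By [lie_leaf_form_poly], [q ^ 2] divides [G ^ 2 * N] over [k], and as [q] is monic it does so
    over [T]. The degree of [N] is at most [D + (d + ee) + d.+1], and division by [q ^ 2] takes away
    twice [d.+1], so [d] drops out of the bound. *)
Lemma lie_leaf_form_bounded l : exists M : S,
  inc (G ^+ 2 * G') * ftr B (lie la * psi (y l)) = inc M /\ tdeg3_le (D + D + D + ee) M.
Proof.
have q0 := inc_q0; have [monq sq qd] := mq; have [dlP dlD _] := dirP.
have dl0 : dl 0 = 0 := der0 dlP.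
have [p pE] := lie_leaf_form_poly l; have nE := ftr_lie_leaf_form l.
set X := ftr B _ in pE nE *; set N := lie_num l in nE.
have mq2 : wmonic (d.+1 + d.+1) (q ^+ 2) by rewrite expr2; apply: wmonicM.
have [monq2 sq2 _] := mq2.
have polE : map_poly tT (G ^+ 2 * N) = map_poly tT (q ^+ 2) * (map_poly tT G' * p).
  have incI : injective tE by move=> u v uv; apply/eqP; rewrite -tofrac_eq uv.
  apply: incI; rewrite !tofracM -pE -!incE (rmorphM inc (G ^+ 2)) (rmorphXn inc 2 q).
  exact: (leaf_aux2 _ (expf_neq0 2 q0) nE).
have Neq : G ^+ 2 * N = q ^+ 2 * Pdiv.CommonRing.rdivp (G ^+ 2 * N) (q ^+ 2).
  rewrite {1}(Pdiv.RingMonic.rdivp_eq monq2 (G ^+ 2 * N)).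
  set r := Pdiv.CommonRing.rmodp _ _; suff -> : r = 0 by rewrite addr0 mulrC.
  have sr : (size r < size (q ^+ 2)%R)%N by rewrite Pdiv.CommonRing.ltn_rmodpN0 // monic_neq0.
  set u := Pdiv.CommonRing.rdivp (G ^+ 2 * N) (q ^+ 2).
  have rE : map_poly tT r = map_poly tT (q ^+ 2) * (map_poly tT G' * p - map_poly tT u).
    rewrite mulrBr -polE -rmorphM -rmorphB; congr (map_poly tT _).
    by rewrite (Pdiv.RingMonic.rdivp_eq monq2 (G ^+ 2 * N)) -/r -/u [u * _]mulrC addrAC subrr add0r.
  have [w0|w0] := eqVneq (map_poly tT G' * p - map_poly tT u) 0.
    apply: (map_inj_poly tT_inj (rmorph0 tT)); rewrite rE w0 mulr0.
    by rewrite rmorph0.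
  have := sr; rewrite -(size_tT r) rE size_monicM ?monic_map // size_tT.
  have : (0 < size (map_poly tT G' * p - map_poly tT u)%R)%N by rewrite size_poly_gt0.
  by case: (size (map_poly tT G' * p - _)%R) => // m _; rewrite addnS /= ltnNge leq_addr.
exists (Pdiv.CommonRing.rdivp (G ^+ 2 * N) (q ^+ 2)); set M := Pdiv.CommonRing.rdivp _ _ in Neq *.
split.
  rewrite (rmorphM inc); apply: (leaf_aux3 (expf_neq0 2 q0) nE).
  by rewrite -(rmorphXn inc 2 q) -!(rmorphM inc) -Neq.
apply: (wmonic_quotient mq2); rewrite -Neq.
have mom j : tdeg3_le (d + ee) (moment q tau j) by apply: tdeg3_le_moment_num.
have mapd s m : tdeg3_le m s -> tdeg3_le m (map_poly dl s) by apply: tdeg3_le_map.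
apply: (@tdeg3_le_mono _ ((D + D) + (D + (d + ee + d.+1)))); first lia.
apply: tdeg3_leM; first by rewrite expr2; apply: tdeg3_leM.
apply: tdeg3_leD.
  apply: tdeg3_leM => //; apply: tdeg3_leB; apply: tdeg3_leM => //.
    exact: mapd.
  exact: mapd.
apply: tdeg3_le_sum => j _; apply: tdeg3_leD; apply: tdeg3_leM => //.
  apply: tdeg3_leB; apply: tdeg3_leM => //; exact: tdeg3_le_deriv.
exact: tdeg3_leM.
Qed.

End Apply.
End Direction.
End Leaf.

Lemma field_basis_algebraic (k L : fieldType) (iota : {rmorphism k -> L}) :
  field_basis iota -> forall z, exists2 p : {poly k}, p != 0 & root (map_poly iota p) z.
Proof.
move=> B z; pose n := bdim B.
have [v v0 vM] := wide_dependent (\matrix_(i < n.+1) bco B (z ^+ i)).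
exists (\poly_(i < n.+1) v 0 (inord i)).
  apply: contra_neq v0 => p0; apply/rowP => i; rewrite mxE -(coef0 _ (i : nat)) -p0.
  by rewrite coef_poly ltn_ord inord_val.
rewrite rootE -evalpE (evalp_sum _ _ (size_poly _ _)); apply/eqP.
under eq_bigr => i _ do rewrite coef_poly ltn_ord inord_val [z ^+ i](bcoK B) mulr_sumr.
rewrite exchange_big big1 //= => j _; under eq_bigr do rewrite mulrA -rmorphM.
rewrite -mulr_suml -rmorph_sum; transitivity (iota ((v *m \matrix_i bco B (z ^+ i)) 0 j) * bvec j).
  by congr (iota _ * _); rewrite mxE; apply: eq_bigr => i _; rewrite mxE.
by rewrite vM mxE rmorph0 mul0r.
Qed.

(* [D p(z) = p'(z) D z] for a derivation [D] killing the coefficients, so a nonzero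
   relation either kills [D z] or can be differentiated. *)
Lemma derivation_algebraic (k L : fieldType) (iota : {rmorphism k -> L}) (D : L -> L) z :
  (forall m, m.+1%:R != 0 :> k) -> derivation D -> (forall c, D (iota c) = 0) ->
  (exists2 p : {poly k}, p != 0 & root (map_poly iota p) z) -> D z = 0.
Proof.
move=> char0 DP D0 [p]; have [n] := ubnP (size p); elim: n p => // n IHn p pn p0 pz.
have Dp (q : {poly k}) : D (map_poly iota q).[z] = (map_poly iota q^`()).[z] * D z.
  elim/poly_ind: q => [|q c IHq]; first by rewrite deriv0 !rmorph0 horner0 (der0 DP) mul0r.
  rewrite derivMXaddC !rmorphD !rmorphM /= !map_polyX map_polyC !hornerE /=.
  by rewrite (derD DP) (derM DP) /= IHq D0 addr0 mulrDl addrC mulrAC.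
have /eqP := Dp p; rewrite (eqP pz) (der0 DP) eq_sym mulf_eq0 => /orP[pz'|/eqP//].
apply: (IHn p^`()) => //; first by rewrite ltnS in pn; apply: leq_trans (lt_size_deriv p0) pn.
have : (1 < size p)%N.
  rewrite ltnNge; apply: contraNN p0 => /size1_polyC; move: (p`_0) => c pC; move: pz.
  by rewrite pC map_polyC rootC fmorph_eq0 => /eqP->.
case sp : (size p) => [|[|m]] // _; apply/negP => /eqP/(congr1 (fun q : {poly k} => q`_m)).
rewrite coef0 coef_deriv => /eqP; rewrite -mulr_natr mulf_eq0 (negPf (char0 m)) orbF => /eqP c0.
by move: p0; rewrite -lead_coef_eq0 lead_coefE sp c0 eqxx.
Qed.

(** The coefficients of one [M i] fill a space whose dimension depends on [I] and [D] only; [N] is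
    one more than that. *)
Lemma bounded_relation (K : closedFieldType) (I : finType) D :
  exists N, forall M : 'I_N -> I -> {poly {poly {poly K}}}, (forall i c, tdeg3_le D (M i c)) ->
  exists2 v : 'I_N -> K, (exists i, v i != 0) &
    forall c, \sum_i (v i)%:P%:P%:P * M i c = 0.
Proof.
pose J : finType := (I * 'I_D.+1 * 'I_D.+1 * 'I_D.+1)%type.
exists #|J|.+1 => M MD.
have [v v0 vM] := wide_dependent (\matrix_(i < #|J|.+1, j < #|J|)
  let: (c, a1, a2, a3) := enum_val j in (M i c)`_a1`_a2`_a3).
exists (v 0).
  apply/existsP; apply: contraR v0 => /existsPn v0; apply/eqP/rowP => i.
  by rewrite mxE; have /negPn/eqP := v0 i.
move=> c; apply/polyP => a1; apply/polyP => a2; apply/polyP => a3; rewrite !coef0 !coef_sum.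
have [le|gt] := leqP (a3 + a2 + a1) D; last first.
  by rewrite big1 // => i _; rewrite !coefCM MD ?mulr0.
have l1 : (a1 < D.+1)%N by lia.
have l2 : (a2 < D.+1)%N by lia.
have l3 : (a3 < D.+1)%N by lia.
have := congr1 (fun u : 'rV_ _ => u 0 (enum_rank ((c, Ordinal l1, Ordinal l2, Ordinal l3) : J))) vM.
rewrite !mxE => vE; rewrite -[RHS]vE; apply: eq_bigr => i _.
by rewrite mxE enum_rankK !coefCM.
Qed.

Lemma derivation_comp (C D L : comNzRingType) (psi : {rmorphism D -> L}) (f : {rmorphism C -> D}) d :
  derivation_along psi d -> derivation_along (psi \o f) (d \o f).
Proof. by move=> dP; split=> a b /=; rewrite ?rmorphD ?rmorphM ?(derD dP) ?(derM dP). Qed.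

(** * Bounds uniform in the leaf *)

Section Frame.
Variable R : realType.
Local Notation K := R[i].
Local Notation T := {poly {poly K}}.
Local Notation S := {poly T}.
Variables (k : fieldType) (tT : {rmorphism T -> k}).
Hypotheses (tT_inj : injective tT) (tT_frac : fraction_map tT).
Local Notation E := {fraction {poly k}}.
Local Notation tE := (@FracField.tofrac {poly k}).
Local Notation inc := (inc tT).
Variables (A : comAlgType K) (br : A -> A -> A).
Hypothesis hbr : poisson_bracket br.
Variables (x1 x2 x3 : A).
Local Notation h := (br x1 x2).
Local Notation ev2 := (ev2 x1 x2).
Local Notation ev3 := (ev3 x1 x2 x3).
Variables (F : fieldType) (psi : {rmorphism A -> F}) (iE : {rmorphism E -> F}).
Variables (B : field_basis iE) (y : 'I_(bdim B) -> A) (e : 'I_(bdim B) -> F).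
Local Notation n := (bdim B).
Hypotheses (psi_inj : injective psi) (psi_frac : fraction_map psi) (h0 : h != 0).
Hypothesis iE_inc : forall s, iE (inc s) = psi (ev3 s).
Hypothesis yE : forall j, bvec j = psi (y j).
Hypothesis eb : forall i j, ftr B (e i * bvec j) = (i == j)%:R.

Lemma char0E m : m.+1%:R != 0 :> E.
Proof.
have := inc_eq0 tT_inj m.+1%:R; rewrite (rmorph_nat inc) => ->.
by do 3![rewrite -polyC_natr polyC_eq0]; rewrite pnatr_eq0.
Qed.

Lemma psi_eq0 a : (psi a == 0) = (a == 0).
Proof. by rewrite -(inj_eq psi_inj) rmorph0. Qed.

(** The difference of the two derivations kills [k(x3)], over which [F] is algebraic. *)
Lemma derivation_frame_eq (D D' : F -> F) : derivation D -> derivation D' ->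
  (forall p, D (psi (ev2 p)) = D' (psi (ev2 p))) -> D (psi x3) = D' (psi x3) ->
  forall f, D f = D' f.
Proof.
move=> DP D'P Dp D3 f; apply/eqP; rewrite -subr_eq0; apply/eqP.
have DDP : derivation (fun f => D f - D' f).
  split=> a b; first by rewrite (derD DP) (derD D'P) opprD addrACA.
  by rewrite (derM DP) (derM D'P) /= mulrBl mulrBr opprD addrACA.
apply: (derivation_algebraic char0E DDP) (field_basis_algebraic B f) => r.
apply/eqP; rewrite subr_eq0; apply/eqP; move: r.
have DE := derivation_comp (iE : {rmorphism E -> F}) (DP : derivation_along idfun D).
have D'E := derivation_comp (iE : {rmorphism E -> F}) (D'P : derivation_along idfun D').
apply: (der_eq_fraction (@fraction_map_tofrac {poly k}) DE D'E) => p.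
have Dt := derivation_comp (tE : {rmorphism _ -> _}) DE.
have D't := derivation_comp (tE : {rmorphism _ -> _}) D'E.
apply: (der_eq_poly Dt D't) p => [c|/=]; last first.
  by rewrite -(map_polyX tT) -incE iE_inc (_ : ev3 'X = x3) //; apply: evalpX.
have Dc := derivation_comp (polyC : {rmorphism k -> _}) Dt.
have D'c := derivation_comp (polyC : {rmorphism k -> _}) D't.
apply: (der_eq_fraction tT_frac Dc D'c) => p /=.
by rewrite -incC iE_inc ev3C.
Qed.

(** [a'] plays the role of [br a w / h], a quotient that need not exist in [A]. *)
Definition compatible w (dl : T -> T) (t : A -> k) := forall dk : k -> k,
  derivation dk -> (forall p, dk (tT p) = tT (dl p)) ->
  forall a a', h * a' = br a w -> t a' = dk (t a).

(** [ee] controls the moments of all leaves at once, whereas [d] and [q] vary with the leaf. *)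
Definition leaf_functional ee (t : A -> k) d q (tau : nat -> 'I_n -> T) :=
  [/\ (forall a b, t (a + b) = t a + t b) /\ (forall p a, t (ev2 p * a) = tT p * t a),
      wmonic d.+1 q, forall a, t (ev3 q * a) = 0,
      forall i j, t (x3 ^+ i * y j) = tT (tau i j) & forall i j, tdeg_le (i + ee) (tau i j)].

Lemma common_den_bounded (I : finType) (r : I -> E) : exists (G : S) (s : I -> S) D,
  [/\ G != 0, forall i, inc G * r i = inc (s i), tdeg3_le D G & forall i, tdeg3_le D (s i)].
Proof.
have [G [G0 /choice[s sE]]] := common_den tT_inj tT_frac r.
have [D0 GD] := tdeg3_le_exists G.
have /choice[Ds sD] : forall i, exists n, tdeg3_le n (s i) by move=> i; apply: tdeg3_le_exists.
exists G, s, (D0 + \sum_i Ds i)%N; split=> // [|i]; first exact: tdeg3_le_mono (leq_addr _ _) GD.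
apply: tdeg3_le_mono (sD i); apply: leq_trans (leq_addl _ _).
by rewrite (bigD1 i) //= leq_addr.
Qed.

Lemma bracket_derivation w : exists V : F -> F,
  derivation V /\ forall a, V (psi a) = psi (br a w) / psi h.
Proof.
apply: (@der_fraction_lift _ _ psi (fun a => psi (br a w) / psi h)) => //; last first.
  by move=> a /eqP; rewrite psi_eq0 => /eqP->; rewrite (br0l hbr) rmorph0 mul0r.
split=> a b; first by rewrite (brDl hbr) rmorphD mulrDl.
rewrite (brMl hbr) rmorphD !rmorphM mulrDl addrC; congr (_ + _); first by rewrite mulrAC.
by rewrite -!mulrA.
Qed.

(** The order of the quantifiers is the point: [V], [c], [G] and [D] come from the action on the
    basis and on its dual, before any leaf is considered. *)
Lemma direction_bounded w dl ee : direction br x1 x2 w dl ->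
  exists (V : F -> F) (c : F), [/\ derivation V, forall a, V (psi a) = psi (br a w) / psi h &
  exists (G : S) D, G != 0 /\ forall t d q tau, compatible w dl t -> leaf_functional ee t d q tau ->
    forall l, exists M, tdeg3_le D M /\
      inc G * ftr B ((V (leaf_form tT e q tau) + c * leaf_form tT e q tau) * psi (y l)) = inc M].
Proof.
move=> dirP; have [dlP _ brdl] := dirP.
have hn0 : psi h != 0 by rewrite psi_eq0.
have [V [VP VE]] := bracket_derivation w.
have [dk [dkP dkE]] : exists dk : k -> k, derivation dk /\ forall p, dk (tT p) = tT (dl p).
  apply: (@der_fraction_lift _ _ tT (tT \o dl)) => //.
    by split=> p q /=; rewrite ?(derD dlP) ?(derM dlP) /= ?rmorphD ?rmorphM.
  by move=> p; rewrite -(rmorph0 tT) => /tT_inj->; rewrite /= (der0 dlP) rmorph0.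
have [dE [dEP dEE]] := frac_derivation (map_poly_derivation dkP).
have [d3 [d3P d3E]] := frac_derivation (@deriv_derivation k).
have [D3 [D3P D3E]] := derivation_extend B char0E d3P.
have [Dt [DtP DtE]] := derivation_extend B char0E dEP.
have x3E : psi x3 = iE (tE 'X).
  by rewrite -(map_polyX tT) -incE iE_inc; congr (psi _); apply/esym/evalpX.
have ev2E p : psi (ev2 p) = iE (tE (tT p)%:P) by rewrite -incC iE_inc ev3C.
(* [V] splits into the lift of [dk] for which [x3] is constant and a multiple of the derivation in
   [x3]; the residue treats the two differently. *)
have Vdecomp f : V f = Dt f + V (psi x3) * D3 f.
  move: f; apply: (@derivation_frame_eq V (fun f => Dt f + V (psi x3) * D3 f)) => //.
  - split=> a b; first by rewrite (derD DtP) (derD D3P) mulrDr addrACA.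
    by rewrite (derM DtP) (derM D3P) /=; move: (Dt a) (Dt b) (D3 a) (D3 b) (V _) => *; ring.
  - move=> p; rewrite VE brdl rmorphM mulrC mulKf //.
    rewrite !ev2E DtE D3E dEE d3E derivC tofrac0 rmorph0 mulr0 addr0 -dkE.
    congr (iE (tE _)); apply/polyP => i; rewrite coef_map_id0 ?(der0 dkP) // !coefC.
    by case: (i == 0)%N; rewrite ?(der0 dkP).
  rewrite {2 4}x3E DtE D3E dEE d3E derivX tofrac1 rmorph1 mulr1.
  rewrite (_ : map_poly dk 'X = 0) ?tofrac0 ?rmorph0 ?add0r //.
  apply/polyP => i; rewrite coef_map_id0 ?(der0 dkP) // coefX coef0.
  by case: (i == 1)%N; rewrite ?(der0 dkP) ?(der1 dkP).
pose r1 (jl : 'I_n * 'I_n) := bco B (V (psi x3) * psi (y jl.1)) 0 jl.2.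
pose r2 (jl : 'I_n * 'I_n) := bco B (V (psi (y jl.1))) 0 jl.2.
have [G [s [D0 [G0 sE GD _]]]] := common_den_bounded (fun bjl => if bjl.1 then r1 bjl.2 else r2 bjl.2).
pose c := D3 (V (psi x3)).
pose u1 (jl : 'I_n * 'I_n) := ftr B (V (psi x3) * e jl.1 * psi (y jl.2)).
pose u2 (jl : 'I_n * 'I_n) := ftr B ((V (e jl.1) + c * e jl.1) * psi (y jl.2)).
have [G' [s' [D1 [G'0 s'E G'D s'D]]]] :=
  common_den_bounded (fun bjl => if bjl.1 then u1 bjl.2 else u2 bjl.2).
exists V, c; split=> //; pose D := (D0 + D1)%N.
exists (G ^+ 2 * G'), (D + D + D + ee)%N; split; first by rewrite mulf_neq0 ?expf_neq0.
move=> t d q tau tV [[tD tZ] mq qt tauE tauD] l.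
have D1D : (D1 <= D)%N by apply: leq_addl.
have D0D : (D0 <= D)%N by apply: leq_addr.
have [M [ME MD]] := lie_leaf_form_bounded (c1 := fun j l => s' (true, (j, l)))
  (c2 := fun j l => s' (false, (j, l))) (s1 := fun j l => s (true, (j, l)))
  (s2 := fun j l => s (false, (j, l)))
  tT_inj psi_inj h0 iE_inc yE eb d3P d3E D3P D3E dirP dkP dkE dEP dEE VP VE DtP DtE Vdecomp
  (fun j l => sE (true, (j, l))) (fun j l => sE (false, (j, l))) tD tZ (tV dk dkP dkE)
  mq qt tauE (fun j l => s'E (true, (j, l))) (fun j l => s'E (false, (j, l)))
  (tdeg3_le_mono D0D GD) (tdeg3_le_mono D1D G'D) (fun j l => tdeg3_le_mono D1D (s'D _))
  (fun j l => tdeg3_le_mono D1D (s'D _)) tauD l.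
by exists M.
Qed.

End Frame.

Section Family.
Variable R : realType.
Local Notation K := R[i].
Local Notation T := {poly {poly K}}.
Local Notation S := {poly T}.
Variables (k : fieldType) (tT : {rmorphism T -> k}).
Hypotheses (tT_inj : injective tT) (tT_frac : fraction_map tT).
Local Notation E := {fraction {poly k}}.
Local Notation inc := (inc tT).
Variables (A : comAlgType K) (br : A -> A -> A).
Hypothesis hbr : poisson_bracket br.
Variables (x1 x2 x3 : A).
Local Notation h := (br x1 x2).
Local Notation ev2 := (ev2 x1 x2).
Local Notation ev := (ev3 x1 x2 x3).
Variables (F : fieldType) (psi : {rmorphism A -> F}) (iE : {rmorphism E -> F}).
Variables (B : field_basis iE) (y : 'I_(bdim B) -> A) (e : 'I_(bdim B) -> F).
Local Notation n := (bdim B).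
Hypotheses (psi_inj : injective psi) (psi_frac : fraction_map psi) (h0 : h != 0).
Hypothesis iE_inc : forall s, iE (inc s) = psi (ev s).
Hypothesis yE : forall j, bvec j = psi (y j).
Hypothesis eb : forall i j, ftr B (e i * bvec j) = (i == j)%:R.
Variables (j0 : 'I_n) (yj0 : y j0 = 1).

(** In a relation for [ev f0] modulo [Q], powers of [ev f0] can be cancelled until the constant term
    is nonzero; that term is then congruent to a multiple of [ev f0]. *)
Lemma algebraic_multiple (Q : A -> Prop) f0 p : prime_ideal Q -> ~ Q (ev f0) -> p != 0 ->
  Q (ev3 x1 x2 (ev f0) p) -> exists u c, c != 0 /\ Q (ev (f0 * u) - ev2 c).
Proof.
move=> pQ zQ; have [iQ _ Qp] := pQ.
have evE q : ev (evalp (polyC : {rmorphism T -> S}) f0 q) = ev3 x1 x2 (ev f0) q.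
  elim/poly_ind: q => [|q c IHq]; first by rewrite !rmorph0.
  rewrite !rmorphD !rmorphM /= IHq; congr (_ * _ + _).
    by rewrite [X in ev X]evalpX; apply/esym/evalpX.
  by rewrite [X in ev X]evalpC !ev3C.
elim/poly_ind: p => [|p c IHp]; first by rewrite eqxx.
have evX : ev3 x1 x2 (ev f0) (p * 'X + c%:P) = ev3 x1 x2 (ev f0) p * ev f0 + ev2 c.
  by rewrite rmorphD rmorphM ev3C; congr (_ * _ + _); apply: evalpX.
have [->|c0] := eqVneq c 0.
  rewrite addr0 mulf_eq0 polyX_eq0 orbF => p0 Qz; apply: IHp => //.
  move: Qz; rewrite rmorphM => /Qp[//|]; rewrite (_ : ev3 _ _ _ 'X = ev f0) //.
  exact: evalpX.
move=> _; rewrite evX => Qz; exists (- evalp (polyC : {rmorphism T -> S}) f0 p), c; split=> //.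
by rewrite rmorphM rmorphN evE mulrN -opprD mulrC; apply: (idealN iQ).
Qed.

Variables (ee : nat) (t : nat -> A -> k) (d : nat -> nat) (q : nat -> S) (tau : nat -> nat -> 'I_n -> T).
Hypothesis tL : forall i, leaf_functional tT x1 x2 x3 y ee (t i) (d i) (q i) (tau i).
Variable Q : nat -> A -> Prop.
Hypothesis pQ : forall i, prime_ideal (Q i).
Hypothesis Qt : forall i a, Q i a -> t i a = 0.
Hypothesis t1 : forall i, t i 1 != 0.
Hypothesis Qq : forall i j, (i < j)%N -> ~ Q j (ev (q i)).
Hypothesis Qalg : forall i z, exists p : S, p != 0 /\ Q i (ev3 x1 x2 z p).

Local Notation la i := (leaf_form tT e (q i) (tau i)).

Lemma pairing_la i f : pairing B (la i * psi (ev f)) = t i (ev f).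
Proof.
have [[tD tZ] mq qt tauE _] := tL i.
have := pairing_leaf_form tT_inj iE_inc yE eb tD tZ mq qt tauE (fun j => if j == j0 then f else 0).
rewrite (bigD1 j0) //= eqxx yj0 mulr1 big1 ?addr0 // => j /negPf->.
by rewrite rmorph0 mul0r.
Qed.

(** The functionals are triangular: some [f] divisible by all [q i] with [i < j] is killed by the
    earlier [t i], while [t j] sends it to a nonzero multiple of [t j 1]. So the coefficients vanish
    from the last one downwards. *)
Lemma leaf_comb_eq0 m (lam : 'I_m -> K) :
  \sum_i psi (lam i)%:A * la i = 0 -> forall i, lam i = 0.
Proof.
move=> lam0.
have tsum f : \sum_i tT (lam i)%:P%:P * t i (ev f) = 0.
  transitivity (pairing B ((\sum_i psi (lam i)%:A * la i) * psi (ev f))); last first.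
    by rewrite lam0 mul0r pairing0.
  rewrite mulr_suml pairing_sum; apply: eq_bigr => i _.
  have -> : (lam i)%:A = ev2 (lam i)%:P%:P by rewrite ev2C ev1C.
  by rewrite -mulrA (pairingZ _ iE_inc) pairing_la.
have Qprod j (m' : nat) : (m' <= j)%N -> ~ Q j (ev (\prod_(i < m') q i)).
  have [iQ Q1 Qp] := pQ j.
  elim: m' => [|m' IH] m'j; first by rewrite big_ord0 rmorph1.
  by rewrite big_ord_recr rmorphM => /Qp[|]; [apply/IH/ltnW | apply: Qq].
suff H (m' : nat) : forall i : 'I_m, (m - m' <= i)%N -> lam i = 0.
  by move=> i; apply: (H m); rewrite subnn.
elim: m' => [|m' IHm] j; first by rewrite subn0 leqNgt ltn_ord.
move=> mj; have [[tD tZ] mq qt tauE _] := tL j.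
have [p [p0 Qp]] := Qalg j (ev (\prod_(i < j) q i)).
have [u [c [c0 Qc]]] := algebraic_multiple (pQ j) (Qprod j j (leqnn _)) p0 Qp.
pose f := (\prod_(i < j) q i) * u.
have tj : tT (lam j)%:P%:P * t j (ev f) = 0; last first.
  have tjE : t j (ev f) = tT c * t j 1.
    by rewrite -[ev f](subrK (ev2 c)) tD (Qt Qc) add0r -tZ mulr1.
  have tT0 p' : (tT p' == 0) = (p' == 0) by rewrite -(inj_eq tT_inj) rmorph0.
  move/eqP: tj; rewrite tjE !mulf_eq0 (negPf (t1 j)) orbF !tT0 (negPf c0) orbF.
  by rewrite !polyC_eq0 => /eqP.
rewrite -[RHS](tsum f) [RHS](bigD1 j) //= [X in _ = _ + X]big1 ?addr0 // => i ij.
have [lij|lij|lij] := ltngtP i j; last by rewrite (val_inj lij) eqxx in ij.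
  have [[_ iZ] _ iqt _ _] := tL i.
  rewrite /f (bigD1 (Ordinal lij)) //= -mulrA (rmorphM ev).
  by rewrite iqt mulr0.
rewrite IHm ?mul0r ?polyC0 ?rmorph0 ?mul0r //; lia.
Qed.

(** [off] selects a block of leaves, so that combinations with disjoint supports can be formed. *)
Definition leaf_comb N off (v : 'I_N -> K) : F := \sum_i psi (v i)%:A * la (off + i)%N.

Lemma leaf_comb_solution (V : F -> F) c G (M : nat -> 'I_n -> S) N off (v : 'I_N -> K) :
  derivation V -> (forall r : K, V (psi r%:A) = 0) -> G != 0 ->
  (forall i l, inc G * ftr B ((V (la i) + c * la i) * psi (y l)) = inc (M i l)) ->
  (forall l, \sum_i (v i)%:P%:P%:P * M (off + i)%N l = 0) ->
  V (leaf_comb off v) + c * leaf_comb off v = 0.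
Proof.
move=> VP VK G0 ME vM; apply: (ftr_eq0 (B := B) (char0E tT_inj)) => l; rewrite yE.
have iG : inc G != 0 by rewrite inc_eq0.
have -> : V (leaf_comb off v) + c * leaf_comb off v =
    \sum_i iE (inc (v i)%:P%:P%:P) * (V (la (off + i)%N) + c * la (off + i)%N).
  have term i : iE (inc (v i)%:P%:P%:P) * (V (la (off + i)%N) + c * la (off + i)%N) =
      V (psi (v i)%:A * la (off + i)%N) + c * (psi (v i)%:A * la (off + i)%N).
    rewrite (derM VP) /= VK mul0r add0r iE_inc ev3C ev2C ev1C mulrDr; congr (_ + _).
    exact: mulrCA.
  rewrite (eq_bigr _ (fun i _ => term i)) big_split /leaf_comb (der_sum VP).
  by congr (_ + _); apply: mulr_sumr.
apply: (mulfI iG); rewrite mulr0 [X in ftr B X]mulr_suml ftr_sum [LHS]mulr_sumr.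
rewrite -[RHS](rmorph0 inc) -[in RHS](vM l) (rmorph_sum inc); apply: eq_bigr => i _.
by rewrite -mulrA ftrZ mulrCA ME (rmorphM inc).
Qed.

(** Combinations of the first [N] leaves and of the next [N] solve the same equations
    [V f + c * f = 0], so [V] kills their quotient. A scalar quotient, or a zero denominator, would
    be a linear relation between distinct leaves. *)
Lemma leaf_quotient (w : bool -> A) (dl : bool -> T -> T) :
  (forall b, direction br x1 x2 (w b) (dl b)) ->
  (forall b i, compatible tT br x1 x2 (w b) (dl b) (t i)) ->
  exists g : F, (forall c : K, g <> psi c%:A) /\ forall b (V : F -> F), derivation V ->
    (forall a, V (psi a) = psi (br a (w b)) / psi h) -> V g = 0.
Proof.
move=> dirP tV.
have bound b : exists (V : F -> F) (c : F) (G : S) D (M : nat -> 'I_n -> S),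
    [/\ derivation V, forall a, V (psi a) = psi (br a (w b)) / psi h, G != 0,
        forall i l, tdeg3_le D (M i l) &
        forall i l, inc G * ftr B ((V (la i) + c * la i) * psi (y l)) = inc (M i l)].
  have [V [c [VP VE [G [D [G0 MP]]]]]] :=
    direction_bounded tT_inj tT_frac hbr psi_inj psi_frac h0 iE_inc yE eb ee (dirP b).
  have /choice[M ME] : forall il : nat * 'I_n, exists M, tdeg3_le D M /\
      inc G * ftr B ((V (la il.1) + c * la il.1) * psi (y il.2)) = inc M.
    by move=> [i l]; apply: MP (tV b i) (tL i) l.
  by exists V, c, G, D, (fun i l => M (i, l)); split=> // i l; have [] := ME (i, l).
have [V1 [c1 [G1 [D1 [M1 [V1P V1E G10 M1D M1E]]]]]] := bound true.
have [V2 [c2 [G2 [D2 [M2 [V2P V2E G20 M2D M2E]]]]]] := bound false.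
have VK b (V : F -> F) : (forall a, V (psi a) = psi (br a (w b)) / psi h) ->
    forall r : K, V (psi r%:A) = 0.
  by move=> VE r; rewrite VE (br_alg hbr) rmorph0 mul0r.
(* The boolean in the index imposes the equations of both directions by a single relation. *)
have [N rel] := @bounded_relation R[i] (bool * 'I_n)%type (D1 + D2).
have sol off : exists2 v : 'I_N -> K, (exists i, v i != 0) &
    V1 (leaf_comb off v) + c1 * leaf_comb off v = 0 /\
    V2 (leaf_comb off v) + c2 * leaf_comb off v = 0.
  have [|v v0 vM] := rel (fun i bl => if bl.1 then M1 (off + i)%N bl.2 else M2 (off + i)%N bl.2).
    move=> i [[] l] /=; first exact: tdeg3_le_mono (leq_addr _ _) (M1D _ _).
    exact: tdeg3_le_mono (leq_addl _ _) (M2D _ _).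
  exists v => //; split.
    apply: (leaf_comb_solution V1P (VK _ _ V1E) G10 M1E) => l.
    exact: (vM (true, l)).
  apply: (leaf_comb_solution V2P (VK _ _ V2E) G20 M2E) => l.
  exact: (vM (false, l)).
have [v [i vi] [v1 v2]] := sol 0%N; have [u [j uj] [u1 u2]] := sol N.
have algM (r s : K) : psi (r * s)%:A = psi r%:A * psi s%:A.
  by rewrite -rmorphM -scalerAl mul1r scalerA.
have indep (r s : K) : psi r%:A * leaf_comb 0 v + psi s%:A * leaf_comb N u = 0 ->
    r = 0 /\ s = 0.
  move=> rs; pose lam i := match split i with inl i => r * v i | inr i => s * u i end.
  have lam0 : forall i, lam i = 0.
    apply: leaf_comb_eq0; rewrite big_split_ord -[RHS]rs.
    rewrite [X in _ = X + _]mulr_sumr [X in _ = _ + X]mulr_sumr.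
    congr (_ + _); apply: eq_bigr => l _; rewrite /lam.
      by rewrite (unsplitK (inl l)) algM mulrA.
    by rewrite (unsplitK (inr l)) algM mulrA.
  have := lam0 (unsplit (inl i)); have := lam0 (unsplit (inr j)); rewrite /lam !unsplitK.
  by move=> /eqP; rewrite mulf_eq0 (negPf uj) orbF => /eqP-> /eqP; rewrite mulf_eq0 (negPf vi) orbF => /eqP->.
set a := leaf_comb 0 v in v1 v2 indep; set b := leaf_comb N u in u1 u2 indep.
have b0 : b != 0.
  apply/eqP => b0; have [|_ /eqP] := indep 0 1; last by rewrite oner_eq0.
  by rewrite b0 mulr0 addr0 scale0r rmorph0 mul0r.
exists (a / b); split=> [c abc|].
  have [|/eqP] := indep 1 (- c); last by rewrite oner_eq0.
  by rewrite scale1r rmorph1 mul1r scaleNr rmorphN mulNr -abc divfK // subrr.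
have quot (V : F -> F) c : derivation V -> V a + c * a = 0 -> V b + c * b = 0 -> V (a / b) = 0.
  move=> VP /eqP; rewrite addr_eq0 => /eqP Va /eqP; rewrite addr_eq0 => /eqP Vb.
  by rewrite (der_fraction _ VP) //= Va Vb mulrN opprK mulNr mulrCA -mulrA addNr mul0r.
have uniq b' (V V' : F -> F) : derivation V -> derivation V' ->
    (forall a, V (psi a) = psi (br a (w b')) / psi h) ->
    (forall a, V' (psi a) = psi (br a (w b')) / psi h) -> V' (a / b) = 0 -> V (a / b) = 0.
  move=> VP V'P VE V'E <-; apply: (der_eq_fraction psi_frac VP V'P) => z.
  by rewrite VE V'E.
move=> [] V VP VE.
  exact: (uniq _ _ _ VP V1P VE V1E (quot _ _ V1P v1 u1)).
exact: (uniq _ _ _ VP V2P VE V2E (quot _ _ V2P v2 u2)).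
Qed.

End Family.

Lemma algebraic_closed (K : closedFieldType) (L : fieldType) (iota : {rmorphism K -> L}) z p :
  p != 0 -> root (map_poly iota p) z -> exists c, z = iota c.
Proof.
move=> p0; have [r ->] := closed_field_poly_normal p.
rewrite map_polyZ rootZ /= ?fmorph_eq0 ?lead_coef_eq0 // rmorph_prod rootE horner_prod prodf_seq_eq0.
move=> /hasP[c _]; rewrite /= rmorphB /= map_polyX map_polyC hornerXsubC subr_eq0 => /eqP->.
by exists c.
Qed.

(** * Elements killed by both Hamiltonian derivations *)

Section Central.
Variable R : realType.
Local Notation K := R[i].
Local Notation T := {poly {poly K}}.
Variables (k : fieldType) (tT : {rmorphism T -> k}).
Hypotheses (tT_inj : injective tT) (tT_frac : fraction_map tT).
Local Notation E := {fraction {poly k}}.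
Local Notation inc := (inc tT).
Variables (A : comAlgType K) (br : A -> A -> A).
Hypothesis hbr : poisson_bracket br.
Variables (x1 x2 x3 : A).
Local Notation h := (br x1 x2).
Local Notation ev2 := (ev2 x1 x2).
Local Notation ev3 := (ev3 x1 x2 x3).
Variables (F : fieldType) (psi : {rmorphism A -> F}) (iE : {rmorphism E -> F}).
Variable B : field_basis iE.
Hypotheses (psi_inj : injective psi) (psi_frac : fraction_map psi) (h0 : h != 0).
Hypothesis iE_inc : forall s, iE (inc s) = psi (ev3 s).

Lemma brxx a : br a a = 0. Proof. by case: hbr. Qed.

Lemma brNr a b : br a (- b) = - br a b.
Proof. by rewrite (brC hbr) (brNl hbr) (brC hbr b) opprK. Qed.

Lemma derivation_frame_ext (D D' : F -> F) : derivation D -> derivation D' ->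
  (forall c : K, D (psi c%:A) = D' (psi c%:A)) -> D (psi x1) = D' (psi x1) ->
  D (psi x2) = D' (psi x2) -> D (psi x3) = D' (psi x3) -> forall f, D f = D' f.
Proof.
move=> DP D'P DK D1 D2 D3; apply: (derivation_frame_eq tT_inj tT_frac B iE_inc DP D'P) => // p.
have De := derivation_comp (ev2 : {rmorphism T -> A})
  (derivation_comp psi (DP : derivation_along idfun D)).
have D'e := derivation_comp (ev2 : {rmorphism T -> A})
  (derivation_comp psi (D'P : derivation_along idfun D')).
apply: (der_eq_poly De D'e) p => [p|/=]; last first.
  by rewrite (_ : ev2 'X = x2) //; apply: evalpX.
have Dc := derivation_comp (polyC : {rmorphism {poly K} -> _}) De.
have D'c := derivation_comp (polyC : {rmorphism {poly K} -> _}) D'e.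
apply: (der_eq_poly Dc D'c) p => [c|] /=; first by rewrite ev2C ev1C.
by rewrite ev2C (_ : ev1 x1 'X = x1) //; apply: evalpX.
Qed.

(* The bracket has rank two on a three-dimensional space, so it is
   [h (V1 f V2 g - V1 g V2 f)] for its values [V1 = {-, x2} / h] and [V2 = {x1, -} / h]. *)
Lemma bracket_frame (V1 V2 V : F -> F) a : derivation V1 -> derivation V2 -> derivation V ->
  (forall b, V1 (psi b) = psi (br b x2) / psi h) ->
  (forall b, V2 (psi b) = psi (br b (- x1)) / psi h) ->
  (forall b, V (psi b) = psi (br b a) / psi h) ->
  forall f, V f = V1 f * V2 (psi a) - V1 (psi a) * V2 f.
Proof.
move=> V1P V2P + V1E V2E.
have hn0 : psi h != 0 by rewrite psi_eq0.
have V11 : V1 (psi x1) = 1 by rewrite V1E divff.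
have V12 : V1 (psi x2) = 0 by rewrite V1E brxx rmorph0 mul0r.
have V21 : V2 (psi x1) = 0 by rewrite V2E brNr brxx oppr0 rmorph0 mul0r.
have V22 : V2 (psi x2) = 1 by rewrite V2E brNr (brC hbr) opprK divff.
have rhsP a' : derivation (fun f => V1 f * V2 (psi a') - V1 (psi a') * V2 f).
  split=> f g; first by rewrite (derD V1P) (derD V2P); ring.
  by rewrite (derM V1P) (derM V2P) /=; ring.
have K0 (V' : F -> F) w : (forall b, V' (psi b) = psi (br b w) / psi h) ->
    forall c : K, V' (psi c%:A) = 0.
  by move=> V'E c; rewrite V'E (br_alg hbr) rmorph0 mul0r.
have ext a' (V' : F -> F) : derivation V' -> (forall b, V' (psi b) = psi (br b a') / psi h) ->
    V' (psi x1) = V2 (psi a') -> V' (psi x2) = - V1 (psi a') ->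
    V' (psi x3) = V1 (psi x3) * V2 (psi a') - V1 (psi a') * V2 (psi x3) ->
    forall f, V' f = V1 f * V2 (psi a') - V1 (psi a') * V2 f.
  move=> V'P V'E E1 E2 E3; apply: (derivation_frame_ext V'P (rhsP a')) => //.
  - by move=> c; rewrite (K0 _ _ V'E) (K0 _ _ V1E) (K0 _ _ V2E) mul0r mulr0 subrr.
  - by rewrite V11 V21 mul1r mulr0 subr0.
  by rewrite V12 V22 mul0r mulr1 sub0r.
have swap (b c : A) : psi (br b c) / psi h = - (psi (br c b) / psi h).
  by rewrite (brC hbr) rmorphN mulNr.
have [V3 [V3P V3E]] := bracket_derivation hbr x1 x2 psi_inj psi_frac x3.
have V3f : forall f, V3 f = V1 f * V2 (psi x3) - V1 (psi x3) * V2 f.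
  apply: ext => //.
  - by rewrite V3E V2E brNr rmorphN mulNr -swap.
  - by rewrite V3E V1E -swap.
  by rewrite V3E brxx rmorph0 mul0r subrr.
move=> VP VE; apply: ext => //.
- by rewrite VE V2E brNr rmorphN mulNr -swap.
- by rewrite VE V1E -swap.
by rewrite VE swap -V3E V3f opprB mulrC [X in _ - X]mulrC.
Qed.

Hypothesis rat0 : poisson_rational br (fun a => a = 0).

Lemma central_scalar g :
  (forall V : F -> F, derivation V -> (forall b, V (psi b) = psi (br b x2) / psi h) -> V g = 0) ->
  (forall V : F -> F, derivation V -> (forall b, V (psi b) = psi (br b (- x1)) / psi h) -> V g = 0) ->
  exists c : K, g = psi c%:A.
Proof.
move=> g1 g2.
have [V1 [V1P V1E]] := bracket_derivation hbr x1 x2 psi_inj psi_frac x2.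
have [V2 [V2P V2E]] := bracket_derivation hbr x1 x2 psi_inj psi_frac (- x1).
have [a [b [b0 gE]]] := psi_frac g.
have hn0 : psi h != 0 by rewrite psi_eq0.
have cross z : br a z * b = a * br b z.
  have [V [VP VE]] := bracket_derivation hbr x1 x2 psi_inj psi_frac z.
  have : V g = 0 by rewrite (bracket_frame V1P V2P VP V1E V2E VE) g1 // g2 // mul0r mulr0 subrr.
  rewrite gE (der_fraction _ VP) //= !VE => /eqP; rewrite mulf_eq0 invr_eq0 expf_eq0 (negPf b0) orbF.
  rewrite mulrAC mulrA -mulrBl mulf_eq0 invr_eq0 (negPf hn0) orbF -!rmorphM -rmorphB psi_eq0 //.
  by rewrite subr_eq0 => /eqP.
have [_ alg] := rat0.
have [|c d _|p [p0 pe]] := alg a b.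
- by move=> b00; rewrite b00 rmorph0 eqxx in b0.
- rewrite /frac_br_num cross [br a d * b]cross; ring.
apply: (@algebraic_closed _ _ (psi \o (GRing.in_alg A : {rmorphism K -> A})) g p p0).
rewrite rootE -evalpE (evalp_sum _ _ (leqnn _)) gE.
have bn0 : psi b ^+ (size p).-1 != 0 by rewrite expf_neq0.
rewrite -(mulrI_eq0 _ (mulfI bn0)) mulr_sumr; apply/eqP.
rewrite -[RHS](rmorph0 psi) -[in RHS]pe rmorph_sum; apply: eq_bigr => i _ /=.
have -> : psi (p`_i *: (a ^+ i * b ^+ ((size p).-1 - i))) =
    psi (p`_i)%:A * (psi a ^+ i * psi b ^+ ((size p).-1 - i)).
  by rewrite -[in LHS]mulr_algl (rmorphM psi) (rmorphM psi) !(rmorphXn psi).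
rewrite expr_div_n.
have -> : psi b ^+ (size p).-1 = psi b ^+ ((size p).-1 - i) * psi b ^+ i.
  by rewrite -exprD subnK // -ltnS (leq_trans (ltn_ord i)) // leqSpred.
have bi : psi b ^+ i != 0 by rewrite expf_neq0.
by move: (psi b ^+ i) bi => u u0; field.
Qed.

End Central.

(** This serves to make a basis integral over [S]. Surjectivity of [f] is recorded in order to find
    the basis vector 1 again. *)
Lemma field_basis_scale (k L : fieldType) (iota : {rmorphism k -> L}) (B : field_basis iota)
    (c : 'I_(bdim B) -> k) : (forall i, c i != 0) ->
  exists (B' : field_basis iota) (f : 'I_(bdim B') -> 'I_(bdim B)),
    (forall i, exists i', f i' = i) /\ forall i, bvec i = iota (c (f i)) * bvec (f i).
Proof.
move=> c0; have ic i : iota (c i) != 0 by rewrite fmorph_eq0.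
pose co z : 'rV_(bdim B) := \row_i (bco B z 0 i / c i).
have coK z : z = \sum_i iota (co z 0 i) * (iota (c i) * bvec i).
  rewrite [LHS](bcoK B); apply: eq_bigr => i _.
  by rewrite mxE rmorphM fmorphV mulrA divfK.
have coU (v : 'rV_(bdim B)) : co (\sum_i iota (v 0 i) * (iota (c i) * bvec i)) = v.
  have -> : \sum_i iota (v 0 i) * (iota (c i) * bvec i) =
      \sum_i iota ((\row_j (v 0 j * c j)) 0 i) * bvec i.
    by apply: eq_bigr => i _; rewrite mxE rmorphM mulrA.
  by apply/rowP => i; rewrite !mxE bcoU mxE mulfK.
exists (FieldBasis coK coU), id; split=> // i; by exists i.
Qed.

(** A polynomial over [k] has a denominator in [T], so injectivity on [{poly T}] suffices for
    extending to all fractions. *)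
Lemma morphism_to_fraction (T : idomainType) (k F : fieldType) (tT : {rmorphism T -> k})
    (ik : {rmorphism k -> F}) (psi : {rmorphism {poly T} -> F}) :
  injective tT -> fraction_map tT -> injective psi -> (forall c, ik (tT c) = psi c%:P) ->
  exists iE : {rmorphism {fraction {poly k}} -> F}, forall s, iE (inc tT s) = psi s.
Proof.
move=> tT_inj tT_frac psi_inj ikE.
have [chi chi_def] : exists chi : {rmorphism {poly k} -> F}, chi =1 evalp ik (psi 'X).
  by exists (evalp ik (psi 'X)).
have chiE s : chi (map_poly tT s) = psi s.
  elim/poly_ind: s => [|s c IHs]; first by rewrite map_poly0 (rmorph0 chi) rmorph0.
  rewrite !rmorphD !rmorphM /= map_polyX map_polyC /= IHs.
  by congr (_ * _ + _); rewrite chi_def ?evalpX // evalpC ikE.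
have psi0 s : psi s = 0 -> s = 0 by rewrite -(rmorph0 psi) => /psi_inj.
have chi0 p : chi p = 0 -> p = 0.
  move=> p0; have [c [s [c0 cs]]] := poly_den tT_inj tT_frac p.
  have cn : inc tT c%:P != 0 by rewrite inc_eq0 // polyC_eq0.
  have tinj : injective (@FracField.tofrac {poly k}).
    by move=> u v uv; apply/eqP; rewrite -tofrac_eq uv.
  have sE : map_poly tT s = p * map_poly tT c%:P.
    by apply: tinj; rewrite tofracM cs -!incE divfK.
  have s0 : s = 0 by apply: psi0; rewrite -chiE sE rmorphM p0 mul0r.
  apply: tinj; rewrite cs s0 (rmorph0 (inc tT)) mul0r tofrac0 //.
have ker p : FracField.tofrac p = 0 <-> chi p = 0.
  split=> [p0|/chi0->]; last exact: tofrac0.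
  by have /eqP := p0; rewrite tofrac_eq0 => /eqP->; rewrite rmorph0.
have [iE iEE] := fraction_lift (@fraction_map_tofrac {poly k}) ker.
by exists iE => s; rewrite incE iEE chiE.
Qed.

(** * Integral bases and the contradiction from infinitely many leaves *)

Section Scale.
Variable R : realType.
Local Notation K := R[i].
Local Notation T := {poly {poly K}}.
Local Notation S := {poly T}.
Variables (A : comAlgType K) (x1 x2 x3 : A).
Local Notation ev := (ev3 x1 x2 x3).
Hypothesis indep : forall s, ev s = 0 -> s = 0.
Hypothesis alg : forall a, exists p : {poly S}, p != 0 /\ ev4 x1 x2 x3 a p = 0.

Lemma integral_bound_mono e e' a : (e <= e')%N ->
  integral_bound x1 x2 x3 e a -> integral_bound x1 x2 x3 e' a.
Proof.
move=> ee' [P [mP sP Pe Pa]]; exists P; split=> // b bP.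
by apply: tdeg3_le_mono (Pe b bP); rewrite leq_mul2l ee' orbT.
Qed.

Lemma integral_bound1 e : integral_bound x1 x2 x3 e 1.
Proof.
exists ('X - 1%:P); split; [exact: monicXsubC | by rewrite size_XsubC | |].
  rewrite size_XsubC => -[|b] // _.
  rewrite coefB coefX coefC /= sub0r; apply: tdeg3_leN.
  have := @tdeg3_leXn (complex_complex__canonical__GRing_ClosedField R) 0.
  by rewrite expr0; apply: tdeg3_le_mono.
by rewrite rmorphB [X in X - _]evalpX [X in _ - X]evalpC rmorph1 subrr.
Qed.

(** With [c] the leading coefficient of a relation of degree [m] for [a], multiplication by
    [c ^ m.-1] turns it into a monic relation for [c * a]. *)
Lemma integral_multiple a : exists s e, s != 0 /\ integral_bound x1 x2 x3 e (ev s * a).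
Proof.
have [p [p0 pa]] := alg a; pose m := (size p).-1; pose c := lead_coef p.
have c0 : c != 0 by rewrite lead_coef_eq0.
have sp : size p = m.+1 by rewrite prednK // size_poly_gt0.
have m0 : (0 < m)%N.
  rewrite lt0n; apply/eqP => m0; have /size1_polyC pC : (size p <= 1)%N by rewrite sp m0.
  have c00 : p`_0 = 0 by apply: indep; rewrite -[RHS]pa pC coefC; apply/esym/evalpC.
  by rewrite pC c00 eqxx in p0.
pose cf i : S := p`_i * c ^+ (m.-1 - i).
pose P : {poly S} := 'X^m + \poly_(i < m) cf i.
have sl : (size (\poly_(i < m) cf i) < size ('X^m : {poly S}))%N.
  by rewrite size_polyXn ltnS size_poly.
have sP : size P = m.+1 by rewrite size_polyDl // size_polyXn.
have /choice[d dP] : forall i, exists d, tdeg3_le d (cf i).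
  by move=> i; apply: tdeg3_le_exists.
(* The sum of all degrees is a crude weight that works: [m - b] is at least 1, so [(m - b) * e] is
   at least the degree bound of coefficient [b]. *)
exists c, (\sum_(i < m) d i)%N; split=> //; exists P; rewrite sP; split=> //.
- by rewrite monicE lead_coefDl // lead_coefXn.
- move=> b /= bm; rewrite coefD coefXn coef_poly bm (ltn_eqF bm) add0r.
  apply: tdeg3_le_mono (dP b); rewrite (bigD1 (Ordinal bm)) //= mulnDr.
  rewrite -{1}[d b]mul1n; apply: leq_trans (leq_addr _ _); rewrite leq_mul2r.
  by rewrite subn_gt0 bm orbT.
have pE : \sum_(i < m.+1) ev p`_i * a ^+ i = 0.
  by rewrite -[RHS]pa; apply/esym/evalp_sum; rewrite sp.
rewrite (evalp_sum _ _ (n := m.+1)) ?sP // -[RHS](mulr0 (ev c ^+ m.-1)) -[in RHS]pE [RHS]mulr_sumr.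
apply: eq_bigr => i _; rewrite coefD coefXn coef_poly.
have [->|im] := eqVneq (i : nat) m.
  rewrite ltnn addr0 rmorph1 mul1r exprMn -/m (_ : p`_m = c) ?lead_coefE //.
  by rewrite mulrA -exprSr prednK.
have im' : (i < m)%N by rewrite ltn_neqAle im -ltnS ltn_ord.
have cE : ev c ^+ m.-1 = ev c ^+ (m.-1 - i) * ev c ^+ i.
  by rewrite -exprD subnK // -ltnS prednK.
rewrite im' add0r rmorphM rmorphXn exprMn cE.
by rewrite [X in X * _ = _]mulrC mulrACA.
Qed.

End Scale.

Section Leaves.
Variable R : realType.
Local Notation K := R[i].
Local Notation T := {poly {poly K}}.
Local Notation S := {poly T}.
Variables (A : comAlgType K) (br : A -> A -> A).
Hypotheses (fgA : finitely_generated A) (domA : integral_domain A) (hbr : poisson_bracket br).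
Variables (x1 x2 x3 : A).
Local Notation h := (br x1 x2).
Local Notation ev2 := (ev2 x1 x2).
Local Notation ev := (ev3 x1 x2 x3).
Hypothesis h0 : h != 0.
Hypothesis indep : forall s, ev s = 0 -> s = 0.
Hypothesis alg : forall a, exists p : {poly S}, p != 0 /\ ev4 x1 x2 x3 a p = 0.
Hypothesis rat0 : poisson_rational br (fun a => a = 0).
Variables (Q : nat -> A -> Prop) (d : nat -> nat) (q : nat -> S).
Hypothesis pQ : forall i, poisson_prime br (Q i).
Hypothesis Qh : forall i, ~ Q i h.
Hypothesis mq : forall i, wmonic (d i).+1 (q i).
Hypothesis Qq : forall i, Q i (ev (q i)).
Hypothesis Qnq : forall i j, (i < j)%N -> ~ Q j (ev (q i)).
Hypothesis Qalg : forall i z, exists p : S, p != 0 /\ Q i (ev3 x1 x2 z p).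

Section Functional.
Variables (k : fieldType) (tT : {rmorphism T -> k}) (t : nat -> A -> k).
Hypotheses (tT_inj : injective tT) (tT_frac : fraction_map tT).
Local Notation E := {fraction {poly k}}.
Local Notation inc := (inc tT).
Hypothesis tD : forall i a b, t i (a + b) = t i a + t i b.
Hypothesis tZ : forall i p a, t i (ev2 p * a) = tT p * t i a.
Hypothesis Qt : forall i a, Q i a -> t i a = 0.
Hypothesis t1 : forall i, t i 1 != 0.
Hypothesis tV : forall i w dl, direction br x1 x2 w dl -> compatible tT br x1 x2 w dl (t i).
Hypothesis t_bound : forall i e a, integral_bound x1 x2 x3 e a -> forall l, exists p,
  t i (x3 ^+ l * a) = tT p /\ tdeg_le (l + e) p.

Lemma no_leaf_functionals : False.
Proof.
have [F [psi [psi0 psi_frac]]] := residue_field (zero_prime domA).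
have psi_inj : injective psi.
  by move=> a b /eqP; rewrite -subr_eq0 -rmorphB => /eqP/psi0/eqP; rewrite subr_eq0 => /eqP.
have psi3_inj : injective (psi \o ev).
  move=> s u /= /psi_inj/eqP; rewrite -subr_eq0 -rmorphB => /eqP/indep/eqP.
  by rewrite subr_eq0 => /eqP.
have ker p : tT p = 0 <-> (psi \o ev2) p = 0.
  split=> [|/= p0]; first by rewrite -(rmorph0 tT) => /tT_inj->; rewrite rmorph0.
  have /eqP : p%:P = 0 :> S by apply: psi3_inj; rewrite /= ev3C p0 !rmorph0.
  by rewrite polyC_eq0 => /eqP->; rewrite rmorph0.
have [ik ikE] := fraction_lift tT_frac ker.
have [iE iE_inc] := morphism_to_fraction tT_inj tT_frac psi3_inj
  (fun p => etrans (ikE p) (congr1 psi (esym (ev3C x1 x2 x3 p)))).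
rewrite /= in iE_inc.
have [c|a|B0 [y0 [[i0 yi0] y0E]]] := @finite_basis _ A E F iE psi fgA psi_frac.
- by exists (inc c%:P%:P%:P); rewrite iE_inc ev3C ev2C ev1C.
- have [p [p0 pa]] := alg a; exists (map_poly inc p); split.
    rewrite map_poly_eq0_id0 ?inc_eq0 ?lead_coef_eq0 //.
  rewrite rootE -[X in X == _]evalpE (evalp_sum _ _ (size_poly _ _)).
  apply/eqP; rewrite -[RHS](rmorph0 psi) -[in RHS]pa [ev4 _ _ _ _ _](evalp_sum _ _ (leqnn _)).
  rewrite rmorph_sum; apply: eq_bigr => i _.
  by rewrite coef_map iE_inc rmorphM rmorphXn.
(* The basis vector 1 is left unscaled. *)
have /choice[s /choice[ee see]] : forall j, exists s e, s != 0 /\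
    integral_bound x1 x2 x3 e (ev s * y0 j) /\ (j = i0 -> s = 1).
  move=> j; have [->|ji] := eqVneq j i0.
    exists 1, 0%N; rewrite oner_eq0 yi0 rmorph1 mulr1; split=> //; split=> //; exact: integral_bound1.
  have [s [e [s0 se]]] := integral_multiple indep alg (y0 j).
  by exists s, e; split=> //; split=> // ji'; rewrite ji' eqxx in ji.
have is0 j : inc (s j) != 0 by rewrite inc_eq0 //; case: (see j).
have [B [f [fs Bf]]] := field_basis_scale is0.
pose y j := ev (s (f j)) * y0 (f j).
have yE j : bvec j = psi (y j) by rewrite Bf iE_inc y0E -rmorphM.
have [j0 fj0] := fs i0.
have yj0 : y j0 = 1.
  by have [_ [_ s1]] := see i0; rewrite /y fj0 s1 // yi0 rmorph1 mulr1.
pose e0 := (\sum_j ee j)%N.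
have yb j : integral_bound x1 x2 x3 e0 (y j).
  have [_ [yb _]] := see (f j); apply: integral_bound_mono yb.
  by rewrite /e0 (bigD1 (f j)) //= leq_addr.
have [e [eb _]] := dual_basis B (char0E tT_inj).
have /choice[tau0 tau0P] : forall il : nat * nat * 'I_(bdim B), exists p,
    t il.1.1 (x3 ^+ il.1.2 * y il.2) = tT p /\ tdeg_le (il.1.2 + e0) p.
  by move=> [[i l] j]; apply: t_bound.
have tL i : leaf_functional tT x1 x2 x3 y e0 (t i) (d i) (q i) (fun l j => tau0 (i, l, j)).
  split=> // [a|l j|l j].
  - by apply: Qt; have [[[_ _ iM] _ _] _] := pQ i; rewrite mulrC; apply: iM.
  - by have [] := tau0P (i, l, j).
  by have [] := tau0P (i, l, j).
pose w b := if b then x2 else - x1.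
pose dl (b : bool) : T -> T := if b then map_poly (@deriv K) else @deriv {poly K}.
have dirP b : direction br x1 x2 (w b) (dl b).
  by case: b; [apply: direction1 | apply: direction2].
have [g [gK gV]] := leaf_quotient tT_inj tT_frac hbr psi_inj psi_frac h0 iE_inc yE eb yj0 tL
  (fun i => (pQ i).1) Qt t1 Qnq Qalg dirP (fun b i => tV i (dirP b)).
have [c] := central_scalar tT_inj tT_frac hbr B psi_inj psi_frac h0 iE_inc rat0
  (gV true) (gV false).
exact: gK.
Qed.

End Functional.

Lemma no_infinite_leaves : False.
Proof.
pose tT : {rmorphism T -> _} := @FracField.tofrac T.
have /choice[t tP] := fun i => exists_trace fgA hbr (pQ i) (@Qh i) (Qalg i).
have tT_inj : injective tT by move=> u v uv; apply/eqP; rewrite -tofrac_eq; apply/eqP.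
apply: (@no_leaf_functionals _ tT t tT_inj (@fraction_map_tofrac T)).
- by move=> i; have [] := tP i.
- by move=> i; have [] := tP i.
- by move=> i; have [] := tP i.
- by move=> i; have [] := tP i.
- move=> i w dl dirP dk dkP dkE a a' aa'; have [_ _ _ _ [tV _]] := tP i.
  exact: tV dirP dkP dkE aa'.
move=> i e a ab l; have [_ _ _ _ [_ tb]] := tP i.
exact: tb (mq i) (Qq i) ab l.
Qed.

End Leaves.

Lemma coef_top_mul (B : comNzRingType) (p q : {poly B}) m n :
  (size p <= m.+1)%N -> (size q <= n.+1)%N ->
  (size (p * q)%R <= (m + n).+1)%N /\ (p * q)`_(m + n) = p`_m * q`_n.
Proof.
move=> pm qn; split.
  by apply: leq_trans (size_polyMleq _ _) _; move: pm qn; lia.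
rewrite coefM (bigD1 (inord m)) //= big1 ?addr0 => [|i im].
  by rewrite inordK ?addKn // ltnS leq_addr.
have {}im : (i : nat) != m.
  by apply: contra_neq im => im; apply: val_inj; rewrite /= inordK ?im // ltnS leq_addr.
have [lt|ge] := ltnP m i; first by rewrite (nth_default _ (leq_trans pm lt)) mul0r.
rewrite [q`_ _]nth_default ?mulr0 // (leq_trans qn) //.
by have := ltn_ord i; move: im ge; lia.
Qed.

(** * Generic coordinates *)

Section Substitution.
Variable K : closedFieldType.
Local Notation T := {poly {poly K}}.
Local Notation S := {poly T}.

Lemma poly3_ext (L : comNzRingType) (f g : {rmorphism S -> L}) :
  (forall c, f c%:P%:P%:P = g c%:P%:P%:P) -> f ('X)%:P%:P = g ('X)%:P%:P ->
  f ('X)%:P = g ('X)%:P -> f 'X = g 'X -> f =1 g.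
Proof.
move=> fC f1 f2 f3; elim/poly_ind => [|s p IHs]; first by rewrite !rmorph0.
rewrite !rmorphD !rmorphM /= f3 IHs; congr (_ + _); move: p {s IHs}.
elim/poly_ind => [|p u IHp]; first by rewrite !rmorph0.
rewrite !polyCD !polyCM !rmorphD !rmorphM /= f2 IHp; congr (_ + _); move: u {p IHp}.
elim/poly_ind => [|u c IHu]; first by rewrite !rmorph0.
by rewrite !polyCD !polyCM !rmorphD !rmorphM /= f1 IHu fC.
Qed.

(** The outer variable is the third coordinate [X3]. The substitution, sending [X1] to [X1 + c1 X3]
    and [X2] to [X2 + c2 X3], is the one of Noether normalization. *)
Definition is_shear c1 c2 (f : {rmorphism S -> S}) :=
  [/\ forall c, f c%:P%:P%:P = c%:P%:P%:P, f ('X)%:P%:P = c1%:P%:P%:P * 'X + ('X)%:P%:P,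
      f ('X)%:P = c2%:P%:P%:P * 'X + ('X)%:P & f 'X = 'X].

Lemma shear_exists c1 c2 : exists f, is_shear c1 c2 f.
Proof.
exists (evalp (evalp (evalp (polyC \o polyC \o polyC : {rmorphism K -> S})
    (c1%:P%:P%:P * 'X + ('X)%:P%:P)) (c2%:P%:P%:P * 'X + ('X)%:P)) 'X); split=> [c|||].
- exact: etrans (evalpC _ _ _) (etrans (evalpC _ _ _) (evalpC _ _ _)).
- exact: etrans (evalpC _ _ _) (etrans (evalpC _ _ _) (evalpX _ _)).
- exact: etrans (evalpC _ _ _) (evalpX _ _).
exact: evalpX.
Qed.

Lemma shearK c1 c2 f g : is_shear c1 c2 f -> is_shear (- c1) (- c2) g -> cancel g f.
Proof.
move=> [fC f1 f2 f3] [gC g1 g2 g3].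
apply: (poly3_ext (f := f \o g) (g := idfun)) => [c|||]; rewrite ?[LHS]/= ?[RHS]/=.
- by rewrite gC fC.
- by rewrite g1 (rmorphD f) (rmorphM f) fC f1 f3 !polyCN mulNr addKr.
- by rewrite g2 (rmorphD f) (rmorphM f) fC f2 f3 !polyCN mulNr addKr.
by rewrite g3 f3.
Qed.

(** The homogeneous part of degree [d], dehomogenized by [X3 = 1]. Its value at [c1], [c2] becomes
    the coefficient of [X3 ^ d] after the shear. *)
Definition top_form d (f : S) : T :=
  \poly_(j < d.+1) \poly_(i < d.+1) (if (i + j <= d)%N then f`_(d - i - j)`_j`_i else 0).

(** [d] is taken minimal, which keeps the top form from vanishing. *)
Lemma exists_degree (f : S) : f != 0 ->
  exists d, [/\ tdeg3_le d f, top_form d f != 0 & d = 0%N -> exists2 c, c != 0 & f = c%:P%:P%:P].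
Proof.
move=> f0; have ex : exists d, `[< tdeg3_le d f >].
  by have [d fd] := tdeg3_le_exists f; exists d; apply/asboolP.
case: (ex_minnP ex) => d /asboolP fd dmin.
have [l [j [i [ljid c0]]]] : exists l j i, (i + j + l = d)%N /\ f`_l`_j`_i != 0.
  apply: contrapT => no; have top0 l j i : (d <= i + j + l)%N -> f`_l`_j`_i = 0.
    rewrite leq_eqVlt => /orP[/eqP E|]; last exact: fd.
    by apply/eqP; apply: contraT => c0; case: no; exists l, j, i.
  case: d fd dmin top0 {no} => [|d] _ dmin top0.
    case/eqP: f0; apply/polyP => l; apply/polyP => j; apply/polyP => i.
    by rewrite !coef0 top0.
  have /dmin : `[< tdeg3_le d f >] by apply/asboolP => l j i; apply: top0.
  by rewrite ltnn.
exists d; split=> //.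
  apply: contra_neq c0 => top0; have := congr1 (fun p : T => p`_j`_i) top0.
  rewrite !coef0 coef_poly ifT; last by lia.
  rewrite coef_poly ifT; last by lia.
  by rewrite ifT; [rewrite (_ : d - i - j = l)%N //; lia | lia].
move=> d0; exists f`_l`_j`_i => //.
apply/polyP => l'; apply/polyP => j'; apply/polyP => i'.
have [E|ne] := eqVneq (i' + j' + l')%N 0%N; last first.
  rewrite fd; last by rewrite d0 lt0n.
  rewrite coefC; case: eqP => [l0|_]; last by rewrite !coef0.
  rewrite coefC; case: eqP => [j00|_]; last by rewrite coef0.
  by rewrite coefC; case: eqP => // i00; case/eqP: ne; rewrite l0 j00 i00.
move/eqP: E; rewrite !addn_eq0 => /andP[/andP[/eqP-> /eqP->] /eqP->].
move/eqP: ljid; rewrite d0 !addn_eq0 => /andP[/andP[/eqP-> /eqP->] /eqP->].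
by rewrite !coefC.
Qed.

Definition has_top d c (s : S) := tdeg3_le d s /\ s`_d = c%:P%:P.

Lemma has_topM m n a b s u : has_top m a s -> has_top n b u -> has_top (m + n) (a * b) (s * u).
Proof.
move=> [sm sa] [un ub]; split; first exact: tdeg3_leM.
have size_le d (v : S) : tdeg3_le d v -> (size v <= d.+1)%N.
  by move=> vd; apply/leq_sizeP => l dl; apply: tdeg3_coef_gt vd _.
have [_ ->] := coef_top_mul (size_le _ _ sm) (size_le _ _ un).
by rewrite sa ub !polyCM.
Qed.

Lemma has_top_sum d (I : Type) (r : seq I) (c : I -> K) (s : I -> S) :
  (forall i, has_top d (c i) (s i)) -> has_top d (\sum_(i <- r) c i) (\sum_(i <- r) s i).
Proof.
move=> cs; elim/big_rec2: _ => [|i a u _ [ua uE]]; first by split; [apply: tdeg3_le0 | rewrite coef0].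
by have [si sE] := cs i; split; [apply: tdeg3_leD | rewrite coefD sE uE !polyCD].
Qed.

Lemma has_top_lift m n a s : has_top m a s -> (m < n)%N -> has_top n 0 s.
Proof.
move=> [sm _] mn; split; first exact: tdeg3_le_mono (ltnW mn) sm.
by rewrite (tdeg3_coef_gt sm mn).
Qed.

Lemma has_topX m a s i : has_top m a s -> has_top (i * m) (a ^+ i) (s ^+ i).
Proof.
move=> sa; elim: i => [|i IHi]; last by rewrite mulSn !exprS; apply: has_topM.
rewrite mul0n !expr0; split; last by rewrite coef1.
by rewrite -(expr0 'X); apply: tdeg3_leXn.
Qed.

Lemma has_topC c : has_top 0 c c%:P%:P%:P.
Proof.
by split; [move=> [|l] [|j] [|i] //= _; rewrite ?coefC //= ?coefC //= ?coefC | rewrite coefC].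
Qed.

Lemma tdeg3_expand d (f : S) : tdeg3_le d f ->
  f = \sum_(l < d.+1) \sum_(j < d.+1) \sum_(i < d.+1)
        (f`_l`_j`_i)%:P%:P%:P * ('X)%:P%:P ^+ i * ('X)%:P ^+ j * 'X ^+ l.
Proof.
move=> fd; have expand (B : nzRingType) (p : {poly B}) :
    (forall i, (d < i)%N -> p`_i = 0) -> p = \sum_(i < d.+1) (p`_i)%:P * 'X ^+ i.
  move=> pd; transitivity (\poly_(i < d.+1) p`_i).
    by apply/polyP => i; rewrite coef_poly; case: ltnP => // /pd.
  by rewrite poly_def; apply: eq_bigr => i _; rewrite mul_polyC.
rewrite {1}[f]expand; last by move=> l; apply: tdeg3_coef_gt.
apply: eq_bigr => l _; rewrite {1}[f`_l]expand; last first.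
  by move=> j dj; apply/polyP => i; rewrite coef0 fd //; lia.
rewrite rmorph_sum mulr_suml; apply: eq_bigr => j _ /=.
rewrite {1}[f`_l`_j]expand; last by move=> i di; rewrite fd //; lia.
rewrite polyCM polyC_exp !rmorph_sum !mulr_suml; apply: eq_bigr => i _ /=.
by rewrite !polyCM !polyC_exp.
Qed.

(** A monomial with exponents [i], [j], [l] contributes its coefficient times [c1 ^ i * c2 ^ j] to
    the coefficient of [X3 ^ d] if [i + j + l = d], and nothing if its degree is smaller. *)
Lemma shear_top c1 c2 g d f : is_shear c1 c2 g -> tdeg3_le d f ->
  has_top d (map_poly (horner_eval c1) (top_form d f)).[c2] (g f).
Proof.
move=> [gC g1 g2 g3] fd; rewrite [in g f](tdeg3_expand fd).
have t3 : has_top 1 1 'X by split; [rewrite -['X]expr1; apply: tdeg3_leXn | rewrite coefX].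
have t0 c (p : S) : has_top 1 0 p -> has_top 1 c (c%:P%:P%:P * 'X + p).
  move=> [p1 pE]; have [cX cE] := has_topM (has_topC c) t3.
  by split; [apply: tdeg3_leD | rewrite coefD cE pE mulr1 !polyC0 addr0].
have t1 : has_top 1 c1 (g ('X)%:P%:P).
  rewrite g1; apply: t0; split; last by rewrite coefC.
  apply/tdeg3_leC => i j ij; rewrite coefC; case: j ij => [|j] ij; rewrite ?coef0 // coefX.
  by case: eqP ij => //; lia.
have t2 : has_top 1 c2 (g ('X)%:P).
  rewrite g2; apply: t0; split; last by rewrite coefC.
  apply/tdeg3_leC => i j ij; rewrite coefX; case: eqP ij => [->|]; rewrite ?coef0 // coef1.
  by case: i => //; lia.
pose c (l j i : nat) := if (l + j + i == d)%N then f`_l`_j`_i * c1 ^+ i * c2 ^+ j else 0.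
have mono l j i : has_top d (c l j i)
    (g ((f`_l`_j`_i)%:P%:P%:P * ('X)%:P%:P ^+ i * ('X)%:P ^+ j * 'X ^+ l)).
  rewrite !rmorphM !rmorphXn gC g3.
  have := has_topM (has_topM (has_topM (has_topC f`_l`_j`_i) (has_topX i t1)) (has_topX j t2))
    (has_topX l t3).
  rewrite expr1n mulr1 !muln1 add0n /c.
  have [ljid|ljid|ljid] := ltngtP (l + j + i)%N d.
  - by move/has_top_lift; apply; lia.
  - move=> _; rewrite (fd l i j) ?mul0r; last by lia.
    by split; [apply: tdeg3_le0 | rewrite coef0].
  by rewrite (_ : i + j + l = d)%N //; lia.
have -> : (map_poly (horner_eval c1) (top_form d f)).[c2] =
    \sum_(l < d.+1) \sum_(j < d.+1) \sum_(i < d.+1) c l j i.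
  rewrite -evalpE (evalp_sum _ _ (size_poly _ _)) [RHS]exchange_big; apply: eq_bigr => j _.
  rewrite coef_poly ltn_ord /= [LHS](congr1 ( *%R^~ _) (horner_poly _ _ _)) mulr_suml.
  rewrite exchange_big; apply: eq_bigr => i _ /=.
  have [le|gt] := leqP (i + j) d; last first.
    by rewrite !mul0r big1 // => l _; rewrite /c; case: eqP => //; lia.
  have lt : (d - i - j < d.+1)%N by lia.
  rewrite (bigD1 (Ordinal lt)) //= big1 ?addr0 => [|l].
    by rewrite /c ifT //; apply/eqP; lia.
  move=> ne; rewrite /c; case: eqP => // E1; case/eqP: ne; apply: val_inj => /=.
  by move: (nat_of_ord l) (nat_of_ord i) (nat_of_ord j) E1; lia.
rewrite rmorph_sum; apply: has_top_sum => l; rewrite rmorph_sum; apply: has_top_sum => j.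
by rewrite rmorph_sum; apply: has_top_sum => i; apply: mono.
Qed.

End Substitution.

Lemma poly_roots_finite (K : closedFieldType) (p : {poly K}) : p != 0 ->
  exists s : seq K, forall c, p.[c] = 0 -> c \in s.
Proof.
have [s ->] := closed_field_poly_normal p; rewrite scaler_eq0 negb_or lead_coef_eq0 => /andP[p0 _].
exists s => c /eqP; rewrite hornerZ mulf_eq0 lead_coef_eq0 (negPf p0) /= -rootE.
by rewrite root_prod_XsubC.
Qed.

Lemma has_top1_wmonic (K : closedFieldType) d (s : {poly {poly {poly K}}}) :
  has_top d 1 s -> wmonic d s.
Proof.
move=> [sd sE]; have ss : size s = d.+1.
  apply/eqP; rewrite eqn_leq; apply/andP; split.
    by apply/leq_sizeP => l dl; apply: tdeg3_coef_gt sd _.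
  by rewrite ltnNge; apply/negP => /leq_sizeP/(_ d (leqnn _))/eqP; rewrite sE oner_eq0.
by split; rewrite // monicE lead_coefE ss sE.
Qed.

(** * Rational Poisson primes are locally closed *)

Section Generic.
Variable R : realType.
Local Notation K := R[i].
Local Notation T := {poly {poly K}}.
Local Notation S := {poly T}.
Variables (A : comAlgType K) (br : A -> A -> A).
Hypotheses (fgA : finitely_generated A) (domA : integral_domain A) (hbr : poisson_bracket br).
Hypothesis dimA : krull_dim_le A 3.
Local Notation ev2 := (@ev2 R A).
Local Notation ev3 := (@ev3 R A).
Local Notation zero_ideal := (fun a : A => a = 0).

(** Two such scalars would put [b], and then [a], into [Q]; so there is at most one. *)
Lemma prime_line_finite (Q : A -> Prop) a b : prime_ideal Q -> ~ Q a ->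
  exists s : seq K, forall c, Q (a - c *: b) -> c \in s.
Proof.
move=> [iQ _ _] Qa; have [[c0 Qc0]|no] := pselect (exists c, Q (a - c *: b)); last first.
  by exists [::] => c Qc; case: no; exists c.
exists [:: c0] => c Qc; rewrite inE; apply: contraT => cc0; case: Qa.
have Qb : Q b.
  have -> : b = (c0 - c)^-1 *: ((a - c *: b) - (a - c0 *: b)).
    rewrite opprB [X in _ *: X]addrC addrA subrK -scalerBl scalerA mulVf ?scale1r //.
    by rewrite subr_eq0 eq_sym.
  by apply: (idealZ _ iQ); apply: (idealB iQ).
by rewrite -[a](subrK (c0 *: b)); case: (iQ) => _ QD _; apply: QD => //; apply: idealZ.
Qed.

(** The new bracket is [{x1, x2} - c1 {x3, x2} - c2 {x1, x3}]. For each [i] only finitely many [c1]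
    are bad, and then only finitely many [c2], so one choice serves all [i]. *)
Lemma generic_shear x1 x2 x3 (Q : nat -> A -> Prop) (F : nat -> T) :
  (forall i, prime_ideal (Q i)) -> (forall i, ~ Q i (br x1 x2)) -> (forall i, F i != 0) ->
  exists c1 c2, forall i, (map_poly (horner_eval c1) (F i)).[c2] != 0 /\
    ~ Q i (br (x1 - c1 *: x3) (x2 - c2 *: x3)).
Proof.
move=> pQ Qh F0.
have union (B B' : K -> Prop) : (exists s : seq K, forall c, B c -> c \in s) ->
    (exists s : seq K, forall c, B' c -> c \in s) ->
    exists s : seq K, forall c, B c \/ B' c -> c \in s.
  move=> [s sB] [s' sB']; exists (s ++ s') => c; rewrite mem_cat.
  by case=> [/sB->|/sB'->]; rewrite ?orbT.
have [c1 c1P] : exists c1, forall i,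
    ~ (map_poly (horner_eval c1) (F i) = 0 \/ Q i (br x1 x2 - c1 *: br x3 x2)).
  apply: avoid_countable => i; apply: union; last exact: prime_line_finite.
  have [s sP] := poly_roots_finite (K := complex_complex__canonical__GRing_ClosedField R)
    (p := lead_coef (F i)) (etrans (congr1 negb (lead_coef_eq0 _)) (F0 i)).
  exists s => c /(congr1 (fun p : {poly K} => p`_(size (F i)).-1)); rewrite coef_map coef0.
  exact: sP.
have [c2 c2P] : exists c2, forall i, ~ ((map_poly (horner_eval c1) (F i)).[c2] = 0 \/
    Q i ((br x1 x2 - c1 *: br x3 x2) - c2 *: br x1 x3)).
  apply: avoid_countable => i; apply: union; last first.
    by apply: prime_line_finite => // Qi; apply: (c1P i); right.
  apply: poly_roots_finite; apply/eqP => F0'; by apply: (c1P i); left.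
exists c1, c2 => i; split; first by apply/eqP => F0'; apply: (c2P i); left.
move=> Qi; apply: (c2P i); right; move: Qi; congr (Q i _).
have brZr c a b : br a (c *: b) = c *: br a b.
  by rewrite (brC hbr) (brZl hbr) -scalerN -(brC hbr).
rewrite (brDr hbr) (brNr hbr) brZr !(brBl hbr) !(brZl hbr) (brxx hbr) scaler0 subr0 //.
Qed.

(** Otherwise three elements independent modulo [Q] give a chain of length three starting at [Q],
    and the zero ideal lengthens it to four. *)
Lemma algebraic_mod (Q : A -> Prop) x1 x2 z : prime_ideal Q -> (exists2 a, Q a & a != 0) ->
  exists p : S, p != 0 /\ Q (ev3 x1 x2 z p).
Proof.
move=> pQ [a Qa a0]; apply: contrapT => no.
apply: (krull_dim_chain (P := zero_ideal) dimA); split; first exact: zero_prime.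
exists Q; split.
  split; first by move=> b ->; case: pQ => -[].
  by exists a; split=> //; apply/eqP.
apply: (indep3_chain fgA pQ (x := x1) (y := x2) (z := z)) => p Qp; apply/eqP; apply: contraT => p0.
by case: no; exists p.
Qed.

Lemma algebraic4 (x1 x2 x3 a : A) : exists p : {poly S}, p != 0 /\ ev4 x1 x2 x3 a p = 0.
Proof.
apply: contrapT => no; apply: (krull_dim_chain (P := zero_ideal) dimA).
apply: (indep4_chain fgA (zero_prime domA) (x := x1) (y := x2) (z := x3) (t := a)) => p p0.
by apply/eqP; apply: contraT => pn0; case: no; exists p.
Qed.

(** A shear makes every [f i] monic in [x3] up to a scalar, as the degree bounds require, and keeps
    the bracket of the first two coordinates outside all [Q i]. *)
Lemma no_sequence x1 x2 x3 (Q : nat -> A -> Prop) (f : nat -> S) :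
  (forall s, ev3 x1 x2 x3 s = 0 -> s = 0) -> poisson_rational br zero_ideal ->
  (forall i, poisson_prime br (Q i)) -> (forall i, ~ Q i (br x1 x2)) ->
  (forall i, f i != 0) -> (forall i, Q i (ev3 x1 x2 x3 (f i))) ->
  (forall i j, (i < j)%N -> ~ Q j (ev3 x1 x2 x3 (f i))) -> False.
Proof.
move=> indep rat0 pQ Qh f0 Qf Qnf.
have /choice[d dP] : forall i, exists d, [/\ tdeg3_le d (f i), top_form d (f i) != 0 &
    d = 0%N -> exists2 c, c != 0 & f i = c%:P%:P%:P] by move=> i; apply: exists_degree.
have [c1 [c2 cP]] := @generic_shear x1 x2 x3 Q (fun i => top_form (d i) (f i))
  (fun i => (pQ i).1) Qh (fun i => let: And3 _ H _ := dP i in H).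
have [s sP] := shear_exists (c1 : complex_complex__canonical__GRing_ClosedField R) c2.
have [s' s'P] := shear_exists (- c1 : complex_complex__canonical__GRing_ClosedField R) (- c2).
have sK := shearK sP s'P.
have [sC s1 s2 s3] := sP; have [s'C s'1 s'2 s'3] := s'P.
pose x1' := x1 - c1 *: x3; pose x2' := x2 - c2 *: x3.
pose tau i := (map_poly (horner_eval c1) (top_form (d i) (f i))).[c2].
have tau0 i : tau i != 0 by case: (cP i).
pose q i : S := (tau i)^-1%:P%:P%:P * s (f i).
have evs u : ev3 x1' x2' x3 (s u) = ev3 x1 x2 x3 u.
  apply: (poly3_ext (f := ev3 x1' x2' x3 \o s) (g := ev3 x1 x2 x3)) u => [c|||] /=.
  - by rewrite sC !ev3C !ev2C !ev1C.
  - rewrite s1 rmorphD rmorphM !ev3C !ev2C !ev1C mulr_algl.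
    rewrite ![ev1 _ 'X]evalpX [ev3 _ _ _ 'X]evalpX /x1' addrC subrK //.
  - rewrite s2 rmorphD rmorphM !ev3C !ev2C !ev1C mulr_algl.
    rewrite ![ev2 _ _ 'X]evalpX [ev3 _ _ _ 'X]evalpX /x2' addrC subrK //.
  by rewrite s3 ![ev3 _ _ _ 'X]evalpX.
have evs' u : ev3 x1 x2 x3 (s' u) = ev3 x1' x2' x3 u by rewrite -evs sK.
have evq i : ev3 x1' x2' x3 (q i) = (tau i)^-1 *: ev3 x1 x2 x3 (f i).
  by rewrite rmorphM evs ev3C ev2C ev1C mulr_algl.
(* In degree zero [f i] would be a nonzero scalar lying in [Q i]. *)
have d0 i : (0 < d i)%N.
  rewrite lt0n; apply/eqP => di0; have [_ _ /(_ di0)[c c0 fc]] := dP i.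
  have := Qf i; rewrite fc ev3C ev2C ev1C => /(alg_neq0 (pQ i).1) c00.
  by rewrite c00 eqxx in c0.
apply: (@no_infinite_leaves R A br fgA domA hbr x1' x2' x3 _ _ _ rat0 Q (fun i => (d i).-1) q) => //.
- by apply/eqP => h0; have [_] := cP 0%N; apply; rewrite -/x1' -/x2' h0; case: (pQ 0%N) => -[[]].
- by move=> u; rewrite -evs' => /indep/(congr1 s); rewrite sK rmorph0.
- exact: algebraic4.
- by move=> i; have [] := cP i.
- move=> i; have [fd _ _] := dP i.
  rewrite prednK //; apply: has_top1_wmonic; rewrite -(mulVf (tau0 i)).
  exact: has_topM (has_topC _) (shear_top sP fd).
- by move=> i; rewrite evq; apply: idealZ => //; case: (pQ i) => -[].
- move=> i j ij; rewrite evq => Qj; apply: (Qnf i j ij).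
  have -> : ev3 x1 x2 x3 (f i) = tau i *: ((tau i)^-1 *: ev3 x1 x2 x3 (f i)).
    by rewrite scalerA mulfV ?scale1r.
  by apply: idealZ => //; case: (pQ j) => -[].
move=> i z; apply: algebraic_mod; first exact: (pQ i).1.
exists (ev3 x1 x2 x3 (f i)) => //; apply/eqP => /indep f00.
by have := f0 i; rewrite f00 eqxx.
Qed.

(** The element [g i] to be avoided by the next prime is the product of [h] and the polynomials
    found for all earlier primes. *)
Lemma sequence_of_leaves x1 x2 x3 : (forall s, ev3 x1 x2 x3 s = 0 -> s = 0) -> br x1 x2 != 0 ->
  (forall g, g != 0 -> exists Q, [/\ poisson_prime br Q, ~ Q g & exists2 a, Q a & a != 0]) ->
  exists (Q : nat -> A -> Prop) (f : nat -> S),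
    [/\ forall i, poisson_prime br (Q i), forall i, ~ Q i (br x1 x2),
        forall i, f i != 0 /\ Q i (ev3 x1 x2 x3 (f i)) &
        forall i j, (i < j)%N -> ~ Q j (ev3 x1 x2 x3 (f i))].
Proof.
move=> indep h0 avoid.
have /choice[Qf QfP] : forall g : A, exists Qf : (A -> Prop) * S, g != 0 ->
    [/\ poisson_prime br Qf.1, ~ Qf.1 g, Qf.2 != 0 & Qf.1 (ev3 x1 x2 x3 Qf.2)].
  move=> g; have [->|/avoid[Q [pQ Qg Qa]]] := eqVneq g 0.
    (* A dummy value, since only nonzero [g] will occur. *)
    by exists ((fun _ => True), 0); rewrite eqxx.
  by have [f [f0 Qf]] := algebraic_mod x1 x2 x3 pQ.1 Qa; exists (Q, f).
pose fix g i := if i is i'.+1 then g i' * ev3 x1 x2 x3 (Qf (g i')).2 else br x1 x2.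
have g0 i : g i != 0.
  elim: i => //= i IHi; have [_ _ f0 _] := QfP _ IHi.
  case: domA => _ dom; apply/eqP => /dom[/eqP|/indep/eqP]; first by rewrite (negPf IHi).
  by rewrite (negPf f0).
have nQ i j u : ~ (Qf (g j)).1 (g j) -> g j = u * i -> ~ (Qf (g j)).1 i.
  move=> Qg gE Qi; have [[[[_ _ QM] _ _] _] _ _ _] := QfP _ (g0 j).
  by apply: Qg; have := QM u _ Qi; rewrite -gE.
have dvd i j : (i <= j)%N -> exists u, g j = u * g i.
  move=> /subnK<-; elim: (j - i)%N => [|l [u IHl]]; first by exists 1; rewrite mul1r.
  by exists (u * ev3 x1 x2 x3 (Qf (g (l + i)%N)).2); rewrite /= IHl mulrAC.
exists (fun i => (Qf (g i)).1), (fun i => (Qf (g i)).2); split=> [i|i|i|i j ij].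
- by have [] := QfP _ (g0 i).
- have [_ Qg _ _] := QfP _ (g0 i); have [u gE] := dvd 0%N i isT; exact: nQ gE.
- by have [] := QfP _ (g0 i).
have [_ Qg _ _] := QfP _ (g0 j); have [u gE] := dvd i.+1 j ij.
by apply: (nQ _ j (u * g i)) => //; rewrite gE /= mulrA.
Qed.

Lemma rational_locally_closed P : poisson_rational br P -> poisson_locally_closed br P.
Proof.
move=> rat; have [pP alg] := rat; have [[iP P1 PM] Pbr] := pP.
apply/poisson_locally_closedP; split=> //.
have [[x1 [x2 Ph]]|commP] := pselect (exists x1 x2, ~ P (br x1 x2)); last first.
  exists 1; split=> // Q pQ PQ Q1 a Qa.
  have Pbrab b c : P (br b c) by apply: contrapT => Pbc; apply: commP; exists b, c.
  have [p [p0 pa]] : frac_algebraic P a 1.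
    apply: alg => // c d _; rewrite /frac_br_num.
    have Pt b c' e e' : P (br b c' * e * e') by rewrite -mulrA; apply: idealMr.
    case: (iP) => _ PD _; apply: (PD); last exact: Pt.
    by do 2![apply: (idealB iP); last exact: Pt]; exact: Pt.
  have [l Pal] : exists l : K, P (a - l%:A).
    apply: (alg_point pP.1 p0); move: pa; congr (P _); rewrite /frac_poly_eval_num.
    rewrite [RHS](evalp_sum _ _ (leqnn _)); apply: eq_bigr => i _.
    by rewrite expr1n mulr1 /= mulr_algl.
  have Ql : Q l%:A.
    by rewrite -[_%:A](subKr a); apply: idealB => //; [case: (pQ.1) | apply: PQ].
  by move: Pal; rewrite (alg_neq0 pQ.1 Ql) scale0r subr0.
have h0 : br x1 x2 != 0 by apply/eqP => h0; apply: Ph; rewrite h0; case: iP.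
have indep2 Q : poisson_prime br Q -> ~ Q (br x1 x2) -> forall p, Q (ev2 x1 x2 p) -> p = 0.
  move=> pQ Qh p; exact: (poisson_prime_ev2 hbr pQ Qh).
have [[a Pa a0]|Pz] := pselect (exists2 a, P a & a != 0).
  exists (br x1 x2); split=> // Q pQ PQ Qh b Qb; apply: contrapT => Pb.
  (* The zero ideal, [P] and [Q], followed by two more steps above [Q], form a chain that is too
     long. *)
  apply: (krull_dim_chain (P := zero_ideal) dimA); split; first exact: zero_prime.
  exists P; split; first by split; [move=> c ->; case: iP | exists a; split=> //; apply/eqP].
  split; first exact: pP.1.
  exists Q; split; first by split=> //; exists b.
  exact: (indep2_chain fgA pQ.1 (indep2 Q pQ Qh) : prime_chain 2 Q).
have P0 a : P a -> a = 0 by move=> Pa; apply/eqP; apply: contraT => a0; case: Pz; exists a.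
have PE : P = zero_ideal.
  apply/funext => a; apply/propext; split; [exact: P0 | by move->; case: iP].
rewrite PE in rat *.
have [[x3 indep]|dep] := pselect (exists x3, forall s, ev3 x1 x2 x3 s = 0 -> s = 0); last first.
  (* A nonzero [z] in [Q] would be transcendental over [K(x1, x2)]: in a relation the constant term
     lies in [Q], hence vanishes, and [z] can be cancelled. *)
  exists (br x1 x2); split=> [|Q pQ _ Qh z Qz]; first exact/eqP.
  apply: contrapT => z0; apply: dep; exists z; elim/poly_ind => // p c IHp.
  rewrite rmorphD rmorphM ev3C [ev3 _ _ _ 'X]evalpX => pc0.
  have c0 : c = 0.
    apply: (indep2 Q pQ Qh); have [[[_ QD QM] _ _] _] := pQ.
    rewrite -[ev2 _ _ _](addKr (ev3 x1 x2 z p * z)) pc0 addr0 -mulNr; exact: QM.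
  rewrite c0 addr0 IHp ?mul0r // ; case: domA => _ dom.
  by move: pc0; rewrite c0 rmorph0 addr0 => /dom[].
apply: contrapT => no.
(* If no single element isolates the zero ideal, every nonzero [g] is avoided by some nonzero
   Poisson prime. *)
have [|Q [f [pQ Qh fP Qf]]] := sequence_of_leaves indep h0.
  move=> g g0; apply: contrapT => noQ; apply: no; exists g; split=> [/eqP|Q pQ _ Qg a Qa].
    by rewrite (negPf g0).
  apply/eqP; apply: contraT => a0; case: noQ; exists Q; split=> //; by exists a.
exact: (no_sequence indep rat pQ Qh (fun i => (fP i).1) (fun i => (fP i).2) Qf).
Qed.

End Generic.

Theorem theorem7p3 (R : realType) (A : comAlgType R[i]) (br : A -> A -> A) :
  complex_affine_poisson_algebra br ->
  krull_dim_le A 3 ->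
  forall P : A -> Prop,
    (poisson_primitive br P <-> poisson_locally_closed br P) /\
    (poisson_locally_closed br P <-> poisson_rational br P).
Proof.
move=> [fgA domA hbr] dimA P.
have pr : poisson_primitive br P -> poisson_rational br P by apply: (primitive_rational fgA dimA hbr).
have lp : poisson_locally_closed br P -> poisson_primitive br P.
  exact: (locally_closed_primitive fgA dimA hbr).
have rl := rational_locally_closed fgA domA hbr dimA (P := P).
by split; split; [move=> /pr/rl | exact: lp | move=> /lp/pr | exact: rl].
Qed.
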